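(* Let $F\subset\mathbb G$ be a finite Morin configuration of planes in $\mathbb P^5=\mathbb P(W)$, let $u$ be a smooth point of $F$, and let $A\in LG(10,\wedge^3W)$ be the Lagrangian subspace such that $\langle F\rangle=\mathbb P(A)$. Let $V_A\subset P_u\times P_u^\perp\cong\mathbb P^2\times\mathbb P^2$ be the bidegree $(2,2)$ hypersurface associated to $(A,u)$. Then there exists a natural biregular map (isomorphism of schemes) between $F-\{u\}$ and $\operatorname{Sing}V_A$, namely the one induced by the linear projection of $\mathbb P(A)$ from $u$.
   Context: The base field is $\mathbb C$; $W$ is a $6$-dimensional vector space; $\mathbb G\subset\mathbb P(\wedge^3W)$ is the Grassmannian of planes of $\mathbb P(W)$; for $e\in\mathbb G$, $P_e$ is the corresponding plane; $\sigma_e:=\{e'\in\mathbb G : P_e\cap P_{e'}\neq\emptyset\}$. A Morin configuration is a closed scheme $F\subset\mathbb G$ with $F=\bigcap_{e\in F}\sigma_e$. Equivalently (well known) $\langle F\rangle=\mathbb P(A)$ with $A\in LG(10,\wedge^3W)$ and $F=\mathbb P(A)\cdot\mathbb G$ (scheme-theoretic intersection), where $LG(10,\wedge^3W)$ is the Lagrangian Grassmannian of maximal isotropic subspaces for the symplectic pairing $\wedge^3W\times\wedge^3W\to\wedge^6W$ given by wedge product. Construction of $V_A$. Let $P_u=\mathbb P(U)$ with $U\subset W$ of dimension $3$, and let $P_u^\perp$ be the net of hyperplanes through $P_u$, identified with $\mathbb P(\wedge^2(W/U))$. For $1\le i\le 3$ let $W^i_u\subset\wedge^3W$ be the image of $\wedge^iU\otimes\wedge^{3-i}W$.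 Then $A\subset W^1_u$, and smoothness of $F$ at $u$ means $A\cap W^2_u=\wedge^3U$. Hence $A/\wedge^3U\cong W^1_u/W^2_u\cong U\otimes\wedge^2(W/U)$, and the projection of $\mathbb P(A)$ from $u$ is a map $\tau_A:\mathbb P(A)\dashrightarrow\mathbb P^8=\mathbb P(W^1_u/W^2_u)$, where $\mathbb P^8$ contains the Segre embedding of $P_u\times P_u^\perp$. Choose a complement $V$ of $U$ in $W$ and write each $a\in W^1_u$ as $a=a_1+a_2+a_3$ with $a_1\in U\wedge(\wedge^2V)$, $a_2\in(\wedge^2U)\wedge V$, $a_3\in\wedge^3U$. For $(x,y)\in P_u\times P_u^\perp$ and $a\in A$ lying over $(x,y)$, the value $a_1\wedge a_2\in\wedge^6W\cong\mathbb C$ is independent of the choice of $V$ and defines a section $v_A\in H^0(\mathcal O_{P_u\times P_u^\perp}(2,2))$. Put $V_A:=\operatorname{div}(v_A)$. The scheme $\operatorname{Sing}V_A$ is defined by the vanishing of all partial derivatives of a bihomogeneous equation of $V_A$. *)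

(* Defs.v *)
(* Schemes over a field K are handled through their functors of points on
   commutative K-algebras.  All schemes below are subfunctors of a projective
   space, or of a product of two projective spaces. *)
From HB Require Import structures.
From mathcomp Require Import all_boot all_order all_algebra.
From mathcomp Require Import qpoly classical_sets functions.
From mathcomp Require Import reals complex.
From mathcomp Require mpoly.

Set Implicit Arguments.
Unset Strict Implicit.
Unset Printing Implicit Defensive.

Import GRing.Theory.
Local Open Scope ring_scope.
Local Open Scope classical_set_scope.

Notation vec I R := {ffun I -> R^o}.
Notation ext R := (vec {set 'I_6} R).

Section Linear.
Variables (R : comNzRingType) (I : finType).

Definition dot (f v : vec I R) : R := \sum_i f i * v i.

Definition lin_span (X : set (vec I R)) : set (vec I R) :=
  [set w | exists n (c : 'I_n -> R) (x : 'I_n -> vec I R),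
     (forall k, X (x k)) /\ w = \sum_k c k *: x k].

Definition submodule (L : set (vec I R)) : Prop :=
  [/\ L 0, forall v w, L v -> L w -> L (v + w) &
      forall (c : R) v, L v -> L (c *: v)].

(* The elements f_k = dot (phi k) (v k) generate the unit ideal and, on the
   open subset f_k != 0 of Spec R, the submodule L is free on the vector v k,
   which spans a direct summand there because phi k takes the invertible value
   f_k on it; moreover every v k lies in D.  (Denominators can be cleared, so
   no localisation is needed.) *)
Definition locally_spanned_by (D L : set (vec I R)) : Prop :=
  submodule L /\
  exists n (v phi : 'I_n -> vec I R),
    [/\ forall k, L (v k), forall k, D (v k),
        \sum_k dot (phi k) (v k) = 1 &
        forall k w, L w -> dot (phi k) (v k) *: w = dot (phi k) w *: v k].

(* The R-points of P(K^I): rank one locally direct summands of R^I. *)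
Definition proj_space : set (set (vec I R)) :=
  [set L | locally_spanned_by setT L].

End Linear.

Definition map_vec (R S : comNzRingType) (I : finType) (f : R -> S)
    (v : vec I R) : vec I S :=
  [ffun i => f (v i)].

(* Pushforward of a submodule of R^I along a ring morphism f : R -> S. *)
Definition base_change (R S : comNzRingType) (I : finType) (f : R -> S)
    (L : set (vec I R)) : set (vec I S) :=
  lin_span (map_vec f @` L).

(* The exterior algebra of R^6: the basis element indexed by S is the wedge of
   the basis vectors e_i, i in S, taken in increasing order. *)
Section Exterior.
Variable R : comNzRingType.

Definition inversions (S T : {set 'I_6}) : nat :=
  #|[set p : 'I_6 * 'I_6 | [&& p.1 \in S, p.2 \in T & (p.2 < p.1)%N]]%SET|.

Definition wedge (a b : ext R) : ext R :=
  [ffun S : {set 'I_6} => \sum_(T : {set 'I_6} | T \subset S)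
     (-1) ^+ inversions T (S :\: T) * a T * b (S :\: T)].

Definition ext1 (w : vec 'I_6 R) : ext R :=
  [ffun S : {set 'I_6} => \sum_(i | S == [set i]%SET) w i].

Definition wedge3 (x y z : vec 'I_6 R) : ext R :=
  wedge (wedge (ext1 x) (ext1 y)) (ext1 z).

(* The image of X (x) Y (x) Z in the third exterior power. *)
Definition wspan (X Y Z : set (vec 'I_6 R)) : set (ext R) :=
  lin_span [set a | exists x y z, [/\ X x, Y y, Z z & a = wedge3 x y z]].

(* The isomorphism from the sixth exterior power of R^6 to R. *)
Definition top_coord (a : ext R) : R := a [set: 'I_6]%SET.

(* The R-points of the Grassmannian of planes of P^5 in its Pluecker
   embedding. *)
Definition grass : set (set (ext R)) :=
  [set L | locally_spanned_by [set a | exists x y z, a = wedge3 x y z] L].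

(* The planes meeting the plane e, with the scheme structure of the Schubert
   divisor: e' meets e iff the map e + e' -> W is degenerate, and its
   determinant is the wedge product of the Pluecker vectors of e and e'. *)
Definition sigma (e : set (ext R)) : set (set (ext R)) :=
  [set e' | grass e' /\ forall a b, e a -> e' b -> top_coord (wedge a b) = 0].

End Exterior.

Section Schemes.
Variable K : fieldType.

Notation W := (vec 'I_6 K).

Definition subfunctor (I : finType) :=
  forall R : comAlgType K, set (set (vec I R)).

Definition from_base (I : finType) (R : comAlgType K) :
    set (vec I K) -> set (vec I R) :=
  base_change (in_alg R).
#[global] Arguments from_base {I} R _ _.

Definition included (I : finType) (X Y : subfunctor I) : Prop :=
  forall R, X R `<=` Y R.

(* For every R-point of Y, the locus of Spec R where it lies in X is closed,
   defined by the ideal generated by J. *)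
Definition closed_subscheme (I : finType) (X Y : subfunctor I) : Prop :=
  included X Y /\
  forall (R : comAlgType K) (L : set (vec I R)), Y R L ->
    exists J : set R, forall (S : comAlgType K) (f : {lrmorphism R -> S}),
      X S (base_change f L) <-> (forall r, J r -> f r = 0).

(* X is isomorphic to Spec B for a finite dimensional algebra B. *)
Definition finite_scheme (I : finType) (X : subfunctor I) : Prop :=
  exists B : comAlgType K,
    (exists n (b : 'I_n -> B),
       forall x, exists c : 'I_n -> K, x = \sum_k c k *: b k) /\
    exists2 xi : set (vec I B), X B xi &
      forall (R : comAlgType K) (L : set (vec I R)), X R L ->
        exists2 f : {lrmorphism B -> R}, base_change f xi = L &
          forall g : {lrmorphism B -> R}, base_change g xi = L -> g =1 f.

Definition lin_space (I : finType) (A : {vspace vec I K}) : subfunctor I :=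
  fun R => [set L | proj_space L /\ L `<=` from_base R [set` A]].
#[global] Arguments lin_space {I} A R _.

(* The smallest linear subspace containing X as a subscheme is P(A). *)
Definition linear_span (I : finType) (X : subfunctor I)
    (A : {vspace vec I K}) : Prop :=
  included X (lin_space A) /\
  forall B : {vspace vec I K}, included X (lin_space B) -> (A <= B)%VS.

Definition dual_numbers : comAlgType K := {poly %/ ('X^2 : {poly K})}.

Definition dual_aug (x : dual_numbers) : K := (x : {poly K})`_0.

(* A finite scheme has dimension 0, so it is smooth at the K-point u iff its
   Zariski tangent space at u is zero: the only dual number point above u is
   the constant one. *)
Definition finite_smooth_at (I : finType) (X : subfunctor I)
    (u : set (vec I K)) : Prop :=
  X K^o u /\
  forall L : set (vec I dual_numbers), X dual_numbers L ->
    base_change dual_aug L = u -> L = from_base dual_numbers u.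

(* The open complement of the closed point u in X: the linear forms vanishing
   on u, which define u in the projective space, take on L values which
   generate the unit ideal. *)
Definition minus_point (I : finType) (X : subfunctor I)
    (u : set (vec I K)) : subfunctor I :=
  fun R => [set L | X R L /\
    exists n (phi : 'I_n -> vec I K) (a : 'I_n -> vec I R),
      [/\ forall k v, u v -> dot (phi k) v = 0, forall k, L (a k) &
          \sum_k dot (map_vec (in_alg R) (phi k)) (a k) = 1]].
#[global] Arguments minus_point {I} X u R _.

Definition grassmannian : subfunctor {set 'I_6} := fun R => @grass R.
#[global] Arguments grassmannian R _ : clear implicits.

(* In F = \bigcap_(e in F) sigma_e the intersection is scheme-theoretic: e runs
   over all points of F with values in K-algebras. *)
Definition morin_configuration (F : subfunctor {set 'I_6}) : Prop :=
  closed_subscheme F grassmannian /\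
  forall (R : comAlgType K) (e' : set (ext R)),
    F R e' <->
    grassmannian R e' /\
    forall (S : comAlgType K) (f : {lrmorphism R -> S}) (e : set (ext S)),
      F S e -> sigma e (base_change f e').

Definition lagrangian (A : {vspace ext K}) : Prop :=
  [/\ [set` A] `<=` wspan [set: W] [set: W] [set: W], \dim A = 10%N &
      forall a b, a \in A -> b \in A -> top_coord (wedge a b) = 0].

Definition wedge_cube (U : {vspace W}) : set (ext K) :=
  wspan [set` U] [set` U] [set` U].

(* Below, W^i_u is the image of Wedge^i U (x) Wedge^(3 - i) W, and u is the
   point Wedge^3 U.  For U (+) V = W, these are the components a_1, a_2, a_3 of
   an element a of W^1_u, over a K-algebra R. *)
Definition decomposes (U V : {vspace W}) (R : comAlgType K)
    (a a1 a2 a3 : ext R) : Prop :=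
  [/\ from_base R (wspan [set` U] [set` V] [set` V]) a1,
      from_base R (wspan [set` U] [set` U] [set` V]) a2,
      from_base R (wedge_cube U) a3 & a = a1 + a2 + a3].

(* The projection from u, with W^1_u / W^2_u identified with U /\ V /\ V. *)
Definition project (U V : {vspace W}) (R : comAlgType K)
    (L : set (ext R)) : set (ext R) :=
  [set a1 | exists a a2 a3, L a /\ decomposes U V a a1 a2 a3].

(* P_u x P_u^perp is identified with P^2 x P^2 by means of a basis u of U and
   the basis v_1 /\ v_2, v_2 /\ v_0, v_0 /\ v_1 (indices modulo 3) of the second
   exterior power of V, which is isomorphic to that of W / U. *)
Definition segre_vec (u v : 3.-tuple W) (R : comAlgType K)
    (x y : vec 'I_3 R) : ext R :=
  \sum_(i < 3) \sum_(j < 3)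
    (x i * y j) *: map_vec (in_alg R)
      (wedge3 (tnth u i) (tnth v (j + 1)) (tnth v (j + 1 + 1))).

Definition segre (u v : 3.-tuple W) (R : comAlgType K)
    (p : set (vec 'I_3 R) * set (vec 'I_3 R)) : set (ext R) :=
  lin_span [set a | exists x y, [/\ p.1 x, p.2 y & a = segre_vec u v x y]].

(* The variables of a bihomogeneous polynomial on P^2 x P^2 are numbered with
   the three coordinates of the first factor before those of the second. *)
Definition coords (R : comAlgType K) (x y : vec 'I_3 R) (i : 'I_(3 + 3)) : R :=
  match fintype.split i with inl j => x j | inr j => y j end.

Definition eval_at (R : comAlgType K) (q : mpoly.mpoly (3 + 3) K)
    (x y : vec 'I_3 R) : R :=
  mpoly.mmap (in_alg R) (coords x y) q.

(* q is the equation v_A of V_A: for every a in A over (x, y), its value at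
   (x, y) is a_1 /\ a_2.  As A maps onto U /\ V /\ V when A is Lagrangian and
   meets W^2_u in u only, this determines q. *)
Definition equation_VA (A : {vspace ext K}) (U V : {vspace W})
    (u v : 3.-tuple W) (q : mpoly.mpoly (3 + 3) K) : Prop :=
  forall (R : comAlgType K) (x y : vec 'I_3 R) (a a2 a3 : ext R),
    from_base R [set` A] a -> decomposes U V a (segre_vec u v x y) a2 a3 ->
    eval_at q x y = top_coord (wedge (segre_vec u v x y) a2).

Definition sing (q : mpoly.mpoly (3 + 3) K) (R : comAlgType K) :
    set (set (vec 'I_3 R) * set (vec 'I_3 R)) :=
  [set p | [/\ proj_space p.1, proj_space p.2 &
    forall x y, p.1 x -> p.2 y ->
      forall i, eval_at (mpoly.mderiv i q) x y = 0]].
#[global] Arguments sing q R _ : clear implicits.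

(* eta is an isomorphism of functors from X to Y, hence of schemes. *)
Definition scheme_iso (I J1 J2 : finType) (X : subfunctor I)
    (Y : forall R : comAlgType K, set (set (vec J1 R) * set (vec J2 R)))
    (eta : forall R : comAlgType K,
       set (vec I R) -> set (vec J1 R) * set (vec J2 R)) : Prop :=
  (forall R, set_bij (X R) (Y R) (@eta R)) /\
  forall (R S : comAlgType K) (f : {lrmorphism R -> S}) (L : set (vec I R)),
    X R L ->
    eta S (base_change f L) =
      (base_change f (eta R L).1, base_change f (eta R L).2).

End Schemes.

(* Main.v *)
(* Let W = U (+) V.  Grading by the degree in U, an element of the third
   exterior power of W has coordinates (c, n, m, d), with scalars c and d and
   3 x 3 matrices n and m.  It is decomposable iff cof m = d n, cof n = c m and
   m n^T = n^T m = c d I.  As A is Lagrangian, contains u = (1, 0, 0, 0) and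
   meets W^2_u in u only, A is the graph {(c, phi m, m, 0)} of a symmetric
   linear map phi, and v_A (x, y) is, up to a constant, the pairing of
   phi (x y^T) with x y^T.  Hence Sing V_A is defined by phi (x y^T) y = 0 and
   x^T phi (x y^T) = 0.  On the other hand F is the intersection of P(A) and G,
   so that F - {u} is defined by m = x y^T being of rank one, by m n^T = 0 and
   n^T m = 0 for n = phi m, which are the same equations, and by cof n = c m;
   given the previous ones, the last equation has exactly one solution c. *)
Require Import Defs.
From HB Require Import structures.
From mathcomp Require Import classical_sets functions reals complex.
From mathcomp Require Import all_boot all_order all_algebra.
From mathcomp Require Import ring.
From mathcomp Require mpoly.

Set Implicit Arguments.
Unset Strict Implicit.
Unset Printing Implicit Defensive.

Import GRing.Theory.
Local Open Scope ring_scope.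

(** * The exterior algebra *)

(** An R-point is a module that need not be free, so there is no global m, x or y, and localisation
    is avoided. A relation known for decomposable elements is written as the vanishing of a bilinear
    expression, which then holds for all pairs in L. Other local claims are settled by an ideal of
    multipliers r that contains a family generating (1), such as the entries of m. This shapes the
    return from Sing V_A. Since phi (x y^T) kills y on the right and x on the left, its cofactor
    matrix is proportional to x y^T; the local quotients c are glued through the ideal of their
    denominators. Decomposability of the lift needs actual vectors, which are found only up to the
    factor x_s^2 y_r. Two facts about A come from the hypotheses on F: the Morin property and
    isotropy give F = P(A) . G, and for a in A with m = 0 the point u + eps a over the dual numbers
    must be constant, so A meets W^2_u in u only. Invertibility of 2 enters in x /\ x = 0, in the
    polarisation of the singular equations and in the derivative of a quadratic form. *)

Lemma vecZE (R : comNzRingType) (I : finType) (k : R) (v : vec I R) i :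
  (k *: v) i = k * v i :> R.
Proof. by rewrite ffunE. Qed.

Lemma vecDE (R : comNzRingType) (I : finType) (v w : vec I R) i :
  (v + w) i = (v i : R) + w i :> R.
Proof. by rewrite ffunE. Qed.

Lemma vecNE (R : comNzRingType) (I : finType) (v : vec I R) i : (- v) i = - (v i : R) :> R.
Proof. by rewrite ffunE. Qed.

Lemma vec0E (R : comNzRingType) (I : finType) i : (0 : vec I R) i = 0 :> R.
Proof. by rewrite ffunE. Qed.

Section ExteriorAlgebra.
Variable R : comNzRingType.
Implicit Types (a b c : ext R) (x y z : vec 'I_6 R) (S T P Q Z : {set 'I_6}).

Lemma wedgeDl a b c : wedge (a + b) c = wedge a c + wedge b c.
Proof.
apply/ffunP => S; rewrite !ffunE -big_split; apply: eq_bigr => T _.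
by rewrite /= !ffunE mulrDr mulrDl.
Qed.

Lemma wedgeDr a b c : wedge a (b + c) = wedge a b + wedge a c.
Proof.
apply/ffunP => S; rewrite !ffunE -big_split; apply: eq_bigr => T _.
by rewrite /= !ffunE mulrDr.
Qed.

Lemma wedgeZl (k : R) a b : wedge (k *: a) b = k *: wedge a b.
Proof.
apply/ffunP => S; rewrite vecZE !ffunE mulr_sumr; apply: eq_bigr => T _.
by rewrite vecZE mulrCA !mulrA.
Qed.

Lemma wedgeZr (k : R) a b : wedge a (k *: b) = k *: wedge a b.
Proof.
apply/ffunP => S; rewrite vecZE !ffunE mulr_sumr; apply: eq_bigr => T _.
by rewrite vecZE mulrCA.
Qed.

Lemma wedge0l a : wedge 0 a = 0.
Proof. by rewrite -(scale0r (0 : ext R)) wedgeZl !scale0r. Qed.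

Lemma wedge0r a : wedge a 0 = 0.
Proof. by rewrite -(scale0r (0 : ext R)) wedgeZr !scale0r. Qed.

Lemma wedgeNl a b : wedge (- a) b = - wedge a b.
Proof. by rewrite -scaleN1r wedgeZl scaleN1r. Qed.

Lemma wedgeNr a b : wedge a (- b) = - wedge a b.
Proof. by rewrite -scaleN1r wedgeZr scaleN1r. Qed.

Lemma wedge_suml (I : Type) (r : seq I) (p : pred I) (F : I -> ext R) a :
  wedge (\sum_(i <- r | p i) F i) a = \sum_(i <- r | p i) wedge (F i) a.
Proof. by elim/big_rec2: _ => [|i b1 b2 _ <-]; rewrite ?wedge0l ?wedgeDl. Qed.

Lemma wedge_sumr (I : Type) (r : seq I) (p : pred I) (F : I -> ext R) a :
  wedge a (\sum_(i <- r | p i) F i) = \sum_(i <- r | p i) wedge a (F i).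
Proof. exact: (big_morph _ (wedgeDr a) (wedge0r a)). Qed.

Lemma inversionsUl S T Z : [disjoint S & T] ->
  inversions (S :|: T) Z = (inversions S Z + inversions T Z)%N.
Proof.
move=> dST; rewrite /inversions -cardsUI [X in (_ + X)%N]eq_card0 ?addn0.
  by apply: eq_card => p; rewrite !inE andb_orl.
move=> p; rewrite !inE; apply/negP => /andP[/andP[pS _] /andP[pT _]].
by have := disjointFr dST pS; rewrite pT.
Qed.

Lemma inversionsUr S T Z : [disjoint T & Z] ->
  inversions S (T :|: Z) = (inversions S T + inversions S Z)%N.
Proof.
move=> dTZ; rewrite /inversions -cardsUI [X in (_ + X)%N]eq_card0 ?addn0.
  apply: eq_card => p; rewrite !inE.
  by case: (p.1 \in S); case: (p.2 \in T); case: (p.2 \in Z); case: (p.2 < p.1)%N.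
move=> p; rewrite !inE; apply/negP => /andP[/and3P[_ pT _] /and3P[_ pZ _]].
by have := disjointFr dTZ pT; rewrite pZ.
Qed.

Lemma setUDid S T : T \subset S -> T :|: S :\: T = S.
Proof.
move=> TS; apply/setP => i; rewrite !inE.
by case: (boolP (i \in T)) => //= iT; rewrite (subsetP TS).
Qed.

(** Both sides are sums over ordered partitions of S into Q, P, Z, with sign exponent inv(Q, P) +
    inv(Q, Z) + inv(P, Z); the outer set T of the left side is Q :|: P. *)
Lemma wedgeA a b c : wedge (wedge a b) c = wedge a (wedge b c).
Proof.
apply/ffunP => S; rewrite !ffunE.
transitivity (\sum_(T : {set 'I_6} | T \subset S) \sum_(Q : {set 'I_6} | Q \subset T)
   (-1) ^+ inversions T (S :\: T) * ((-1) ^+ inversions Q (T :\: Q) *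
     a Q * b (T :\: Q)) * c (S :\: T)).
  by apply: eq_bigr => T _; rewrite ffunE mulr_sumr mulr_suml.
rewrite (exchange_big_dep (fun Q : {set 'I_6} => Q \subset S)) /=; last first.
  by move=> T Q TS QT; apply: subset_trans QT TS.
apply: eq_bigr => Q QS; rewrite ffunE mulr_sumr.
rewrite (reindex_onto (fun P => Q :|: P) (fun T => T :\: Q)) /=; last first.
  by move=> T /andP[_ QT]; apply: setUDid.
rewrite (eq_bigl (fun P : {set 'I_6} => P \subset S :\: Q)); last first.
  move=> P; rewrite subsetUl andbT subUset QS /= setDUl setDv set0U.
  by rewrite subsetD; congr (_ && _); apply: (sameP eqP setDidPl).
apply: eq_bigr => P; rewrite subsetD => /andP[PS dPQ].
have dQP : [disjoint Q & P] by rewrite disjoint_sym.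
have -> : (Q :|: P) :\: Q = P.
  by rewrite setDUl setDv set0U; apply/setDidPl.
have -> : S :\: (Q :|: P) = (S :\: Q) :\: P by rewrite setDDl.
set Z := _ :\: P.
have -> : S :\: Q = P :|: Z by rewrite /Z setUDid // subsetD PS.
have dPZ : [disjoint P & Z].
  by rewrite -setI_eq0 /Z; apply/eqP/setP => i; rewrite !inE; case: (i \in P).
by rewrite inversionsUl // inversionsUr // !exprD; ring.
Qed.

Lemma ext1D x y : ext1 (x + y) = ext1 x + ext1 y.
Proof.
apply/ffunP => S; rewrite !ffunE -big_split; apply: eq_bigr => i _.
by rewrite ffunE.
Qed.

Lemma ext1Z (k : R) x : ext1 (k *: x) = k *: ext1 x.
Proof.
apply/ffunP => S; rewrite vecZE !ffunE mulr_sumr; apply: eq_bigr => i _.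
by rewrite vecZE.
Qed.

Lemma ext1_0 : ext1 (0 : vec 'I_6 R) = 0.
Proof. by rewrite -(scale0r (0 : vec 'I_6 R)) ext1Z scale0r. Qed.

Lemma ext1_sum (I : Type) (r : seq I) (p : pred I) (F : I -> vec 'I_6 R) :
  ext1 (\sum_(i <- r | p i) F i) = \sum_(i <- r | p i) ext1 (F i).
Proof. exact: (big_morph _ ext1D ext1_0). Qed.

Lemma ext1_set1 x i : ext1 x [set i]%SET = x i.
Proof.
rewrite ffunE (eq_bigl (fun j => j == i)) ?big_pred1_eq // => j.
by rewrite (inj_eq set1_inj) eq_sym.
Qed.

Lemma ext1_not1 x S : #|S| != 1%N -> ext1 x S = 0.
Proof.
move=> nS; rewrite ffunE big_pred0 // => i; apply/negP => /eqP eS.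
by rewrite eS cards1 in nS.
Qed.

Lemma inversions1 i j : inversions [set i]%SET [set j]%SET = (j < i)%N.
Proof.
rewrite /inversions; case: ltnP => ij.
  rewrite (_ : [set _ | _]%SET = [set (i, j)]%SET) ?cards1 //.
  apply/setP => -[k l]; rewrite !inE /= xpair_eqE.
  by case: eqP => //= ->; case: eqP => //= ->; rewrite ij.
rewrite (_ : [set _ | _]%SET = set0) ?cards0 //.
apply/setP => -[k l]; rewrite !inE /=.
by case: eqP => //= ->; case: eqP => //= ->; rewrite ltnNge ij.
Qed.

Lemma wedge_ext1C x y : wedge (ext1 x) (ext1 y) = - wedge (ext1 y) (ext1 x).
Proof.
apply/ffunP => S; rewrite !ffunE -sumrN.
rewrite (reindex_onto (fun T => S :\: T) (fun T => S :\: T)) /=; last first.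
  by move=> T TS; rewrite setDDr setDv set0U; apply/setIidPr.
rewrite (eq_bigl (fun T : {set 'I_6} => T \subset S)); last first.
  move=> T; rewrite subsetDl /= setDDr setDv set0U.
  by apply/eqP/idP => [<-|/setIidPr//]; rewrite subsetIl.
apply: eq_bigr => T TS.
have -> : S :\: (S :\: T) = T by rewrite setDDr setDv set0U; apply/setIidPr.
have [/cards1P[i Ti]|nT] := boolP (#|T| == 1%N); last first.
  by rewrite (ext1_not1 y nT) !(mulr0, mul0r, oppr0).
have [/cards1P[j Sj]|nS] := boolP (#|S :\: T| == 1%N); last first.
  by rewrite (ext1_not1 x nS) !(mulr0, mul0r, oppr0).
rewrite Sj Ti !ext1_set1 !inversions1.
have : j \in S :\: T by rewrite Sj inE.
rewrite Ti !inE => /andP[ji _].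
rewrite -val_eqE /= in ji.
by case: ltngtP ji => //= _ _; ring.
Qed.

Definition ext_one : ext R := [ffun S => (S == set0)%:R].

Lemma wedge1l a : wedge ext_one a = a.
Proof.
apply/ffunP => S; rewrite ffunE (bigD1 set0) ?sub0set //= big1.
  rewrite ffunE eqxx setD0 addr0 mulr1.
  rewrite /inversions (_ : [set _ | _]%SET = set0) ?cards0 ?expr0 ?mul1r //.
  by apply/setP => p; rewrite !inE.
by move=> T /andP[_ /negPf T0]; rewrite ffunE T0 mulr0 mul0r.
Qed.

Lemma wedge1r a : wedge a ext_one = a.
Proof.
apply/ffunP => S; rewrite ffunE (bigD1 S) ?subxx //= big1.
  rewrite ffunE setDv eqxx addr0 mulr1.
  rewrite /inversions (_ : [set _ | _]%SET = set0) ?cards0 ?expr0 ?mul1r //.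
  by apply/setP => p; rewrite !inE andbF.
move=> T /andP[TS nT]; rewrite ffunE; case: eqP => [|_]; last by rewrite mulr0.
move/eqP; rewrite setD_eq0 => ST; case/negP: nT.
by rewrite eqEsubset TS.
Qed.

End ExteriorAlgebra.

(** * Words in anticommuting letters *)

Section Words.
Variable R : comNzRingType.
Implicit Types (x y z : vec 'I_6 R) (s t : seq (vec 'I_6 R)).

Definition vword s : ext R := foldr (fun x a => wedge (ext1 x) a) (ext_one R) s.

Lemma vword_cat s t : vword (s ++ t) = wedge (vword s) (vword t).
Proof. by elim: s => [|x s IH] /=; rewrite ?wedge1l // IH wedgeA. Qed.

Lemma wedge3E x y z : wedge3 x y z = vword [:: x; y; z].
Proof. by rewrite /= wedge1r /wedge3 wedgeA. Qed.

Lemma vword_swap x y s : vword [:: x, y & s] = - vword [:: y, x & s].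
Proof.
by rewrite /= -!wedgeA wedge_ext1C -scaleN1r wedgeZl scaleN1r.
Qed.

End Words.

(* Insertion sort of a word in anticommuting letters: the parity of the number
   of transpositions, and the sorted word. *)
Fixpoint sort_insert (i : nat) (s : seq nat) : bool * seq nat :=
  if s is j :: s' then
    if (i <= j)%N then (false, i :: s)
    else let: (p, t) := sort_insert i s' in (~~ p, j :: t)
  else (false, [:: i]).

Fixpoint sort_sign (s : seq nat) : bool * seq nat :=
  if s is i :: s' then
    let: (p, t) := sort_sign s' in
    let: (p', t') := sort_insert i t in (p (+) p', t')
  else (false, [::]).

Fixpoint has_repeat (s : seq nat) : bool :=
  if s is i :: s' then (if s' is j :: _ then i == j else false) || has_repeat s'
  else false.

(** [None] encodes a product that vanishes because a letter repeats, [Some p] the sign of the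
    sorting permutation. *)
Definition word_code (s : seq nat) : option bool :=
  if has_repeat (sort_sign s).2 then None else Some (sort_sign s).1.

Fixpoint words (n : nat) : seq (seq nat) :=
  if n is m.+1 then [seq i :: s | i <- iota 0 6, s <- words m] else [:: [::]].

Lemma mem_words s : all (fun i => (i < 6)%N) s -> s \in words (size s).
Proof.
elim: s => // i s IH /andP[i6 s6].
change (i :: s \in [seq j :: r | j <- iota 0 6, r <- words (size s)]).
apply/allpairsPdep; exists i, s.
by rewrite mem_iota IH.
Qed.

(** An exhaustive check of the 6^6 words, which replaces a pigeonhole argument: six letters without
    repetition sort to 0, ..., 5. *)
Lemma sort_sign_top : all (fun s => has_repeat (sort_sign s).2 ||
  ((sort_sign s).2 == iota 0 6)) (words 6).
Proof. by vm_compute. Qed.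

Section LetterWords.
Variables (R : comNzRingType) (b : nat -> vec 'I_6 R).
Hypothesis sqr0 : forall i, wedge (ext1 (b i)) (ext1 (b i)) = 0.
Local Notation word s := (vword (map b s)).

Lemma word_insert i s :
  word (i :: s) = (-1) ^+ (sort_insert i s).1 *: word (sort_insert i s).2.
Proof.
elim: s => [|j s IH] /=; first by rewrite scale1r.
case: leqP => _ /=; first by rewrite scale1r.
case: (sort_insert i s) IH => p t /= IH.
have := vword_swap (b i) (b j) (map b s); rewrite /= => ->.
rewrite IH wedgeZr; case: p {IH} => /=; rewrite ?expr0 ?expr1 ?scale1r ?scaleN1r //.
by rewrite opprK.
Qed.

Lemma word_sort s : word s = (-1) ^+ (sort_sign s).1 *: word (sort_sign s).2.
Proof.
elim: s => [|i s IH] /=; first by rewrite scale1r.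
case: (sort_sign s) IH => p t /= ->; rewrite wedgeZr.
have := word_insert i t; case: (sort_insert i t) => p' t' /= ->.
by rewrite scalerA signr_addb.
Qed.

Lemma word_repeat s : has_repeat s -> word s = 0.
Proof.
elim: s => //= i [//|j s] IH /orP[/eqP <-|/IH ->]; last by rewrite wedge0r.
by rewrite /= -wedgeA sqr0 wedge0l.
Qed.

Lemma top_word s : all (fun i => (i < 6)%N) s -> size s = 6%N ->
  top_coord (word s) =
  (if word_code s is Some p then (-1) ^+ p else 0) * top_coord (word (iota 0 6)).
Proof.
move=> s6 sz; have := mem_words s6; rewrite sz => /(allP sort_sign_top).
rewrite /word_code word_sort; case: ifP => [r _|_ /= /eqP ->].
  by rewrite word_repeat // scaler0 mul0r /top_coord vec0E.
by rewrite /top_coord vecZE.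
Qed.

Hypothesis spanning : forall x, exists c : 'I_6 -> R, x = \sum_i c i *: b i.

(** By multilinearity, the letters of [xs] are expanded one at a time in the spanning family and
    moved into [s], until only a word of six letters is left; it is a multiple of the sorted one.
    Hence if b_0 /\ ... /\ b_5 vanishes, so does every product of six vectors. *)
Lemma top_word_gen (s : seq nat) (xs : seq (vec 'I_6 R)) :
  top_coord (word (iota 0 6)) = 0 -> all (fun i => (i < 6)%N) s ->
  (size s + size xs)%N = 6%N -> top_coord (wedge (word s) (vword xs)) = 0.
Proof.
move=> d0; elim: xs s => [|x xs IH] s s6 /= sz.
  by rewrite wedge1r top_word ?d0 ?mulr0 // -sz addn0.
have [c ->] := spanning x.
rewrite ext1_sum wedge_suml wedge_sumr /top_coord sum_ffunE big1 // => i _.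
rewrite ext1Z wedgeZl wedgeZr vecZE -wedgeA.
have -> : wedge (word s) (ext1 (b i)) = word (rcons s i).
  by rewrite -cats1 map_cat vword_cat /= wedge1r.
have := IH (rcons s i); rewrite /top_coord => ->; rewrite ?mulr0 //.
  by rewrite all_rcons s6 ltn_ord.
by rewrite size_rcons addSnnS.
Qed.

End LetterWords.

(** Stated for the last k standard vectors because [vword] adds letters on the left: the new index
    precedes all others and causes no inversion. *)
Lemma ext_std_word (R : comNzRingType) (k : nat) : (k <= 6)%N ->
  vword [seq [ffun j : 'I_6 => ((j : nat) == i)%:R] : vec 'I_6 R | i <- iota (6 - k) k] =
  [ffun S : {set 'I_6} => (S == [set j : 'I_6 | (6 - k <= j)%N])%:R].
Proof.
elim: k => [_|k IH k6] /=.
  apply/ffunP => S; rewrite !ffunE; congr (_ == _)%:R.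
  by apply/setP => j; rewrite !inE subn0 leqNgt ltn_ord.
rewrite -subSn // subSS IH ?(ltnW k6) //; apply/ffunP => S; rewrite !ffunE.
have lt6 : (6 - k.+1 < 6)%N by rewrite ltn_subrL.
pose i := Ordinal lt6.
have ext1i (Q : {set 'I_6}) :
  ext1 ([ffun j : 'I_6 => ((j : nat) == (6 - k.+1)%N)%:R] : vec 'I_6 R) Q = (Q == [set i])%:R.
  rewrite ffunE; case: (eqVneq Q [set i]) => [->|Qi].
    rewrite (big_pred1 i) ?ffunE ?eqxx // => j.
    by rewrite (inj_eq set1_inj) eq_sym.
  rewrite big1 // => j /eqP Qj; rewrite ffunE; case: eqP => // ji.
  by case/eqP: Qi; rewrite Qj; congr [set _]; apply/val_inj.
have tailE : [set j : 'I_6 | (6 - k.+1 <= j)%N] =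
             i |: [set j : 'I_6 | (6 - k <= j)%N].
  by apply/setP => j; rewrite !inE -val_eqE /= leq_eqVlt eq_sym subnSK.
have inotin : i \notin [set j : 'I_6 | (6 - k <= j)%N].
  by rewrite inE /= -ltnNge ltn_sub2l.
have [iS|iS] := boolP (i \in S); last first.
  rewrite big1 => [|Q QS]; last first.
    rewrite ext1i; case: eqP => [Qi|_]; last by rewrite mulr0 mul0r.
    by case/negP: iS; rewrite -sub1set -Qi.
  by case: eqP => // SE; case/negP: iS; rewrite SE inE /=.
rewrite (bigD1 [set i]) ?sub1set //= big1 => [|Q /andP[_ /negPf Qi]]; last first.
  by rewrite ext1i Qi mulr0 mul0r.
rewrite ext1i eqxx addr0 mulr1 ffunE tailE.
have -> : (S :\: [set i] == [set j : 'I_6 | (6 - k <= j)%N]) =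
          (S == i |: [set j : 'I_6 | (6 - k <= j)%N]).
  apply/eqP/eqP => [<-|->]; first by rewrite setD1K.
  by rewrite setU1K.
case: eqP => [->|]; last by rewrite mulr0.
rewrite setU1K // /inversions (_ : [set _ | _] = set0) ?cards0 ?expr0 ?mul1r //.
apply/setP => -[j l]; rewrite !inE /=; case: eqP => //= ->; apply/negP => /andP[].
by move=> /= h; rewrite ltnNge -ltnS -subSn // (ltnW _) // ltnS (leq_trans _ h) // leq_sub2l.
Qed.

(** * Coordinates adapted to W = U (+) V *)

Section Dot.
Variables (R : comNzRingType) (I : finType).
Implicit Types f v w : vec I R.

Lemma dotDr f v w : dot f (v + w) = dot f v + dot f w.
Proof.
by rewrite /dot -big_split; apply: eq_bigr => i _; rewrite vecDE mulrDr.
Qed.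

Lemma dotZr (k : R) f v : dot f (k *: v) = k * dot f v.
Proof.
by rewrite /dot mulr_sumr; apply: eq_bigr => i _; rewrite vecZE mulrCA.
Qed.

Lemma dotZl (k : R) f v : dot (k *: f) v = k * dot f v.
Proof.
by rewrite /dot mulr_sumr; apply: eq_bigr => i _; rewrite vecZE mulrA.
Qed.

Lemma dot0r f : dot f 0 = 0.
Proof. by rewrite -(scale0r (0 : vec I R)) dotZr mul0r. Qed.

Lemma dot_sumr (J : Type) (r : seq J) (p : pred J) f (F : J -> vec I R) :
  dot f (\sum_(j <- r | p j) F j) = \sum_(j <- r | p j) dot f (F j).
Proof. exact: (big_morph _ (dotDr f) (dot0r f)). Qed.

Lemma dot_delta (i : I) v : dot ([ffun j => (j == i)%:R] : vec I R) v = v i.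
Proof.
rewrite /dot (bigD1 i) //= ffunE eqxx mul1r big1 ?addr0 // => j /negPf ji.
by rewrite ffunE ji mul0r.
Qed.

End Dot.

Section MapVec.
Variables (R S : comNzRingType) (f : {rmorphism R -> S}).

Lemma map_vec0 (I : finType) : map_vec f (0 : vec I R) = 0.
Proof. by apply/ffunP => i; rewrite !ffunE rmorph0. Qed.

Lemma map_vecD (I : finType) (v w : vec I R) :
  map_vec f (v + w) = map_vec f v + map_vec f w.
Proof. by apply/ffunP => i; rewrite !ffunE rmorphD. Qed.

Lemma map_vecZ (I : finType) (k : R) (v : vec I R) :
  map_vec f (k *: v) = f k *: map_vec f v.
Proof. by apply/ffunP => i; rewrite vecZE !ffunE rmorphM. Qed.

Lemma map_vec_sum (I : finType) (J : Type) (r : seq J) (p : pred J)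
    (F : J -> vec I R) :
  map_vec f (\sum_(j <- r | p j) F j) = \sum_(j <- r | p j) map_vec f (F j).
Proof. exact: (big_morph _ (@map_vecD I) (@map_vec0 I)). Qed.

Lemma map_vec_wedge (a b : ext R) :
  map_vec f (wedge a b) = wedge (map_vec f a) (map_vec f b).
Proof.
apply/ffunP => T; rewrite !ffunE rmorph_sum; apply: eq_bigr => Q _.
by rewrite !rmorphM rmorphXn rmorphN1 !ffunE.
Qed.

Lemma map_vec_ext1 (x : vec 'I_6 R) : map_vec f (ext1 x) = ext1 (map_vec f x).
Proof.
apply/ffunP => T; rewrite !ffunE rmorph_sum; apply: eq_bigr => i _.
by rewrite ffunE.
Qed.

Lemma map_vec_wedge3 (x y z : vec 'I_6 R) :
  map_vec f (wedge3 x y z) = wedge3 (map_vec f x) (map_vec f y) (map_vec f z).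
Proof. by rewrite /wedge3 !map_vec_wedge !map_vec_ext1. Qed.

Lemma dot_map_vec (I : finType) (v w : vec I R) :
  dot (map_vec f v) (map_vec f w) = f (dot v w).
Proof.
by rewrite /dot rmorph_sum; apply: eq_bigr => i _; rewrite !ffunE rmorphM.
Qed.

End MapVec.

(** The wedge pairing with [b], as a linear form in the sense of [dot]. *)
Definition pairing_vec (R : comNzRingType) (b : ext R) : ext R :=
  [ffun T => (-1) ^+ inversions T (~: T) * b (~: T)].

Lemma dot_pairing_vec (R : comNzRingType) (a b : ext R) :
  dot (pairing_vec b) a = top_coord (wedge a b).
Proof.
rewrite /top_coord ffunE; apply: eq_big => [T|T _]; first by rewrite subsetT.
by rewrite ffunE setTD mulrAC.
Qed.

Lemma map_pairing_vec (R S : comNzRingType) (f : {rmorphism R -> S}) (b : ext R) :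
  map_vec f (pairing_vec b) = pairing_vec (map_vec f b).
Proof.
by apply/ffunP => T; rewrite !ffunE rmorphM rmorphXn rmorphN1.
Qed.

Section Coordinates.
Variables (K : fieldType) (u v : 3.-tuple (vec 'I_6 K)).
Hypothesis two_neq0 : 2%:R != 0 :> K.
Hypothesis spanning : forall x : vec 'I_6 K, exists g h : 'I_3 -> K,
  x = \sum_i g i *: tnth u i + \sum_i h i *: tnth v i.

Definition basis_c := wedge3 (tnth u 0) (tnth u 1) (tnth u (1 + 1)).
(** The row index is the vector of [u] left out, and the other two are taken in cyclic order; this
    keeps signs out of the cofactor formulas. The same is done with [v] in [basis_m]. *)
Definition basis_n (i j : 'I_3) :=
  wedge3 (tnth u (i + 1)) (tnth u (i + 1 + 1)) (tnth v j).
Definition basis_m (i j : 'I_3) :=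
  wedge3 (tnth u i) (tnth v (j + 1)) (tnth v (j + 1 + 1)).
Definition basis_d := wedge3 (tnth v 0) (tnth v 1) (tnth v (1 + 1)).
Definition volume := top_coord (wedge basis_c basis_d).

Let letter (i : nat) : vec 'I_6 K := nth 0 (u ++ v) i.

Let letter_u (i : 'I_3) : tnth u i = letter i.
Proof. by rewrite /letter nth_cat size_tuple ltn_ord (tnth_nth 0). Qed.

Let letter_v (i : 'I_3) : tnth v i = letter (3 + i).
Proof. by rewrite /letter nth_cat size_tuple /= addKn (tnth_nth 0). Qed.

Let sqr0 i : wedge (ext1 (letter i)) (ext1 (letter i)) = 0.
Proof.
apply/ffunP => S; have /ffunP/(_ S) := wedge_ext1C (letter i) (letter i).
rewrite [in RHS]ffunE => /eqP; rewrite -addr_eq0 -mulr2n -mulr_natl mulf_eq0.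
by rewrite (negPf two_neq0) /= => /eqP ->; rewrite ffunE.
Qed.

Let spanning_letters x : exists c : 'I_6 -> K, x = \sum_i c i *: letter i.
Proof.
have [g [h ->]] := spanning x.
exists (fun k : 'I_(3 + 3) => match split k with inl i => g i | inr i => h i end).
rewrite (@big_split_ord _ _ _ 3 3) /=; congr (_ + _); apply: eq_bigr => i _.
  by rewrite letter_u (unsplitK (inl i)).
by rewrite letter_v (unsplitK (inr i)).
Qed.

Let volumeE : volume = top_coord (vword (map letter (iota 0 6))).
Proof. by rewrite /volume /basis_c /basis_d !wedge3E -vword_cat !letter_u !letter_v. Qed.

(** Otherwise every product of six vectors would have top coordinate 0, including that of the
    standard basis, where it is 1. *)
Lemma volume_neq0 : volume != 0.
Proof.
apply/eqP; rewrite volumeE => v0.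
have := ext_std_word K (leqnn 6); rewrite subnn.
set xs := map _ _ => /(congr1 (@top_coord K)).
have := top_word_gen sqr0 spanning_letters (s := [::]) (xs := xs) v0 isT erefl.
rewrite /= wedge1l => ->; rewrite /top_coord ffunE.
rewrite (_ : [set: _] == _) => [/eqP|]; first by rewrite eq_sym oner_eq0.
by apply/eqP/setP => j; rewrite !inE.
Qed.

Let word_c := [:: 0; 1; 2]%N.
Let word_n (i j : 'I_3) : seq nat := [:: (i + 1)%R : nat; (i + 1 + 1)%R : nat; 3 + j]%N.
Let word_m (i j : 'I_3) : seq nat := [:: i : nat; 3 + (j + 1)%R; 3 + (j + 1 + 1)%R]%N.
Let word_d := [:: 3; 4; 5]%N.

Let basis_cE : basis_c = vword (map letter word_c).
Proof. by rewrite /basis_c wedge3E !letter_u. Qed.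
Let basis_nE i j : basis_n i j = vword (map letter (word_n i j)).
Proof. by rewrite /basis_n wedge3E !letter_u letter_v. Qed.
Let basis_mE i j : basis_m i j = vword (map letter (word_m i j)).
Proof. by rewrite /basis_m wedge3E letter_u !letter_v. Qed.
Let basis_dE : basis_d = vword (map letter word_d).
Proof. by rewrite /basis_d wedge3E !letter_v. Qed.

(** The wedge pairing makes c dual to d and n dual to m. It is alternating in degree three: c /\ d
    and m /\ n give [volume], the opposite orders give its negative, whence the signs. *)
Definition coord_c := volume^-1 *: pairing_vec basis_d.
Definition coord_n i j := (- volume^-1) *: pairing_vec (basis_m i j).
Definition coord_m i j := volume^-1 *: pairing_vec (basis_n i j).
Definition coord_d := (- volume^-1) *: pairing_vec basis_c.

Let pair_words (s t : seq nat) : size s = 3%N -> size t = 3%N ->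
  all (fun i => (i < 6)%N) s -> all (fun i => (i < 6)%N) t ->
  top_coord (wedge (vword (map letter s)) (vword (map letter t))) =
  (if word_code (s ++ t) is Some p then (-1) ^+ p else 0) * volume.
Proof.
move=> s3 t3 s6 t6; rewrite volumeE -vword_cat -map_cat (top_word sqr0) //.
  by rewrite all_cat s6 t6.
by rewrite size_cat s3 t3.
Qed.

Let word_c6 : all (fun i => (i < 6)%N) word_c. Proof. by []. Qed.
Let word_d6 : all (fun i => (i < 6)%N) word_d. Proof. by []. Qed.
Let word_n6 i j : all (fun i => (i < 6)%N) (word_n i j).
Proof. by case: i j => [[|[|[|//]]] ?] [[|[|[|//]]] ?]. Qed.
Let word_m6 i j : all (fun i => (i < 6)%N) (word_m i j).
Proof. by case: i j => [[|[|[|//]]] ?] [[|[|[|//]]] ?]. Qed.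

Ltac table :=
  rewrite /coord_c /coord_n /coord_m /coord_d dotZl dot_pairing_vec
    ?basis_cE ?basis_nE ?basis_mE ?basis_dE pair_words //
    (_ : word_code _ = None) ?mul0r ?mulr0 //.
Ltac cases i := case: i => [[|[|[|//]]] ?].

Lemma coord_cc : dot coord_c basis_c = 1.
Proof.
rewrite /coord_c dotZl dot_pairing_vec basis_dE basis_cE pair_words //=.
by rewrite expr0 mul1r mulVf ?volume_neq0.
Qed.
Lemma coord_cn i j : dot coord_c (basis_n i j) = 0.
Proof. table; cases i; cases j; by vm_compute. Qed.
Lemma coord_cm i j : dot coord_c (basis_m i j) = 0.
Proof. table; cases i; cases j; by vm_compute. Qed.
Lemma coord_cd : dot coord_c basis_d = 0.
Proof. by table. Qed.

Lemma coord_nc i j : dot (coord_n i j) basis_c = 0.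
Proof. table; cases i; cases j; by vm_compute. Qed.
Lemma coord_nn i j k l : dot (coord_n i j) (basis_n k l) = ((i == k) && (j == l))%:R.
Proof.
rewrite /coord_n dotZl dot_pairing_vec basis_mE basis_nE pair_words //.
have -> : word_code (word_n k l ++ word_m i j) =
    if (i == k) && (j == l) then Some true else None.
  by cases i; cases j; cases k; cases l; vm_compute.
case: ifP => _; last by rewrite mul0r mulr0.
by rewrite expr1 mulN1r mulrN mulNr opprK mulVf ?volume_neq0.
Qed.
Lemma coord_nm i j k l : dot (coord_n i j) (basis_m k l) = 0.
Proof. table; cases i; cases j; cases k; cases l; by vm_compute. Qed.
Lemma coord_nd i j : dot (coord_n i j) basis_d = 0.
Proof. table; cases i; cases j; by vm_compute. Qed.

Lemma coord_mc i j : dot (coord_m i j) basis_c = 0.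
Proof. table; cases i; cases j; by vm_compute. Qed.
Lemma coord_mn i j k l : dot (coord_m i j) (basis_n k l) = 0.
Proof. table; cases i; cases j; cases k; cases l; by vm_compute. Qed.
Lemma coord_mm i j k l : dot (coord_m i j) (basis_m k l) = ((i == k) && (j == l))%:R.
Proof.
rewrite /coord_m dotZl dot_pairing_vec basis_mE basis_nE pair_words //.
have -> : word_code (word_m k l ++ word_n i j) =
    if (i == k) && (j == l) then Some false else None.
  by cases i; cases j; cases k; cases l; vm_compute.
case: ifP => _; last by rewrite mul0r mulr0.
by rewrite expr0 mul1r mulVf ?volume_neq0.
Qed.
Lemma coord_md i j : dot (coord_m i j) basis_d = 0.
Proof. table; cases i; cases j; by vm_compute. Qed.

Lemma coord_dc : dot coord_d basis_c = 0.
Proof. by table. Qed.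
Lemma coord_dn i j : dot coord_d (basis_n i j) = 0.
Proof. table; cases i; cases j; by vm_compute. Qed.
Lemma coord_dm i j : dot coord_d (basis_m i j) = 0.
Proof. table; cases i; cases j; by vm_compute. Qed.
Lemma coord_dd : dot coord_d basis_d = 1.
Proof.
rewrite /coord_d dotZl dot_pairing_vec basis_dE basis_cE pair_words //=.
by rewrite expr1 mulN1r mulrN mulNr opprK mulVf ?volume_neq0.
Qed.

End Coordinates.

Lemma ord3_add : 1 + 1 + 1 = 0 :> 'I_3.
Proof. exact/val_inj. Qed.

Lemma ord3_add0 : 0 + 1 = 1 :> 'I_3.
Proof. exact/val_inj. Qed.

Definition ord3E := (ord3_add0, ord3_add).

Lemma ord3P (i : 'I_3) : [\/ i = 0, i = 1 | i = 1 + 1].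
Proof.
by case: i => [[|[|[|//]]] ?]; [apply: Or31 | apply: Or32 | apply: Or33];
  apply/val_inj.
Qed.

Lemma sum3E (V : nmodType) (F : 'I_3 -> V) : \sum_i F i = F 0 + F 1 + F (1 + 1).
Proof.
rewrite !big_ord_recr big_ord0 /= add0r.
by congr (F _ + F _ + F _); apply/val_inj.
Qed.

(** * Cross products and the Pluecker coordinates of a 3 x 6 matrix *)

Section Cross.
Variable R : comNzRingType.
Implicit Types f g h : 'I_3 -> R.

Definition dot3 f g := \sum_i f i * g i.

Definition cross g h (i : 'I_3) : R :=
  g (i + 1) * h (i + 1 + 1) - g (i + 1 + 1) * h (i + 1).

Definition det3 f g h := dot3 f (cross g h).

Section Combinations.
Variable t : 'I_3 -> vec 'I_6 R.
Hypothesis sqr0 : forall i, wedge (ext1 (t i)) (ext1 (t i)) = 0.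
Local Notation "a ^^ b" := (wedge a b) (at level 40, left associativity).

Let C i j : ext1 (t j) ^^ ext1 (t i) = - (ext1 (t i) ^^ ext1 (t j)).
Proof. exact: wedge_ext1C. Qed.

Lemma wedge_cross g h :
  ext1 (\sum_i g i *: t i) ^^ ext1 (\sum_i h i *: t i) =
  \sum_i cross g h i *: (ext1 (t (i + 1)) ^^ ext1 (t (i + 1 + 1))).
Proof.
rewrite !sum3E /cross !ord3E !ext1D !ext1Z !wedgeDl !wedgeDr !wedgeZl !wedgeZr.
rewrite !sqr0 (C 0 1) (C 1 (1 + 1)) (C 0 (1 + 1)).
apply/ffunP => S; rewrite !(vecDE, vecZE, vec0E, vecNE).
by ring.
Qed.

Lemma wedge_det f g h :
  ext1 (\sum_i f i *: t i) ^^ ext1 (\sum_i g i *: t i) ^^ ext1 (\sum_i h i *: t i) =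
  det3 f g h *: (ext1 (t 0) ^^ ext1 (t 1) ^^ ext1 (t (1 + 1))).
Proof.
have rot i j k : ext1 (t i) ^^ ext1 (t j) ^^ ext1 (t k) =
                 ext1 (t k) ^^ ext1 (t i) ^^ ext1 (t j).
  by rewrite [LHS]wedgeA [ext1 (t j) ^^ _]C wedgeNr -wedgeA [in LHS]C wedgeNl opprK.
have rep i j : ext1 (t i) ^^ ext1 (t j) ^^ ext1 (t i) = 0.
  by rewrite rot sqr0 wedge0l.
rewrite wedgeA wedge_cross /det3 /dot3 !sum3E /cross !ord3E.
rewrite !ext1D !ext1Z !wedgeDl !wedgeDr !wedgeZl !wedgeZr -!wedgeA.
rewrite !sqr0 !rep !wedge0l (rot 1 (1 + 1) 0) !(rot 0 1 (1 + 1)).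
apply/ffunP => S; rewrite !(vecDE, vecZE, vec0E).
by ring.
Qed.

End Combinations.
End Cross.

Lemma wedge3_rot (R : comNzRingType) (x y z : vec 'I_6 R) :
  wedge3 x y z = wedge3 z x y.
Proof.
rewrite /wedge3 wedgeA [wedge (ext1 y) _]wedge_ext1C wedgeNr -wedgeA.
by rewrite [in LHS]wedge_ext1C wedgeNl opprK.
Qed.

Section Embedding.
Variables (K : fieldType) (u v : 3.-tuple (vec 'I_6 K)).
Hypothesis two_neq0 : 2%:R != 0 :> K.
Hypothesis spanning : forall x : vec 'I_6 K, exists g h : 'I_3 -> K,
  x = \sum_i g i *: tnth u i + \sum_i h i *: tnth v i.
Variable R : comAlgType K.
Implicit Types (a b : ext R) (c d : R) (m n : 'I_3 -> 'I_3 -> R) (g h : 'I_3 -> R).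

Definition emb (I : finType) (x : vec I K) : vec I R := map_vec (in_alg R) x.

Lemma dot_emb (I : finType) (x y : vec I K) : dot (emb x) (emb y) = (dot x y)%:A.
Proof. exact: (dot_map_vec (in_alg R)). Qed.

Lemma two_regular (r : R) : 2%:R * r = 0 -> r = 0.
Proof.
move=> r0; rewrite -[r]scale1r -(mulVf two_neq0) -scalerA.
by rewrite scaler_nat -[r *+ 2]mulr_natl r0 scaler0.
Qed.

Lemma ext1_sqr (x : vec 'I_6 R) : wedge (ext1 x) (ext1 x) = 0.
Proof.
apply/ffunP => S; have /ffunP/(_ S) := wedge_ext1C x x.
rewrite vecNE vec0E => /eqP; rewrite -addr_eq0 -mulr2n -mulr_natl => /eqP.
exact: two_regular.
Qed.

(* The letters c, n, m, d stand for the parts of degree 3, 2, 1, 0 in U; the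
   coordinates in these parts are read off by [cc], [nn], [mm], [dd]. *)
Definition El c n m d : ext R :=
  c *: emb (basis_c u) + \sum_i \sum_j n i j *: emb (basis_n u v i j) +
  \sum_i \sum_j m i j *: emb (basis_m u v i j) + d *: emb (basis_d v).

Definition cc a : R := dot (emb (coord_c u v)) a.
Definition nn a i j : R := dot (emb (coord_n u v i j)) a.
Definition mm a i j : R := dot (emb (coord_m u v i j)) a.
Definition dd a : R := dot (emb (coord_d u v)) a.

Lemma nnE a i j : nn a i j = dot (emb (coord_n u v i j)) a. Proof. by []. Qed.
Lemma mmE a i j : mm a i j = dot (emb (coord_m u v i j)) a. Proof. by []. Qed.
Lemma ddE a : dd a = dot (emb (coord_d u v)) a. Proof. by []. Qed.
Lemma ElE c n m d : El c n m d = c *: emb (basis_c u) +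
  \sum_i \sum_j n i j *: emb (basis_n u v i j) +
  \sum_i \sum_j m i j *: emb (basis_m u v i j) + d *: emb (basis_d v).
Proof. by []. Qed.

Lemma ccD a b : cc (a + b) = cc a + cc b.
Proof. exact: dotDr. Qed.
Lemma ccZ k a : cc (k *: a) = k * cc a.
Proof. exact: dotZr. Qed.
Lemma cc0 : cc 0 = 0.
Proof. exact: dot0r. Qed.
Lemma nnD a b i j : nn (a + b) i j = nn a i j + nn b i j.
Proof. exact: dotDr. Qed.
Lemma nnZ k a i j : nn (k *: a) i j = k * nn a i j.
Proof. exact: dotZr. Qed.
Lemma nn0 i j : nn 0 i j = 0.
Proof. exact: dot0r. Qed.
Lemma mmD a b i j : mm (a + b) i j = mm a i j + mm b i j.
Proof. exact: dotDr. Qed.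
Lemma mmZ k a i j : mm (k *: a) i j = k * mm a i j.
Proof. exact: dotZr. Qed.
Lemma mm0 i j : mm 0 i j = 0.
Proof. exact: dot0r. Qed.
Lemma ddD a b : dd (a + b) = dd a + dd b.
Proof. exact: dotDr. Qed.
Lemma ddZ k a : dd (k *: a) = k * dd a.
Proof. exact: dotZr. Qed.
Lemma dd0 : dd 0 = 0.
Proof. exact: dot0r. Qed.

Lemma dot_El (f : ext K) c n m d : dot (emb f) (El c n m d) =
  c * (dot f (basis_c u))%:A +
  \sum_i \sum_j n i j * (dot f (basis_n u v i j))%:A +
  \sum_i \sum_j m i j * (dot f (basis_m u v i j))%:A +
  d * (dot f (basis_d v))%:A.
Proof.
rewrite /El !dotDr !dotZr !dot_sumr !dot_emb.
congr (_ + _ + _ + _); apply: eq_bigr => i _; rewrite dot_sumr;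
  by apply: eq_bigr => j _; rewrite dotZr dot_emb.
Qed.

Let sum_delta m i j : \sum_k \sum_l m k l * ((i == k) && (j == l))%:R%:A = m i j.
Proof.
rewrite (bigD1 i) //= [X in _ + X]big1 ?addr0 => [|k /negPf ki]; last first.
  by apply: big1 => l _; rewrite eq_sym ki scale0r mulr0.
rewrite (bigD1 j) //= big1 ?addr0 => [|l /negPf lj].
  by rewrite !eqxx scale1r mulr1.
by rewrite [j == l]eq_sym lj andbF scale0r mulr0.
Qed.

Let sum0 m : \sum_(i < 3) \sum_(j < 3) m i j * 0%:A = 0.
Proof. by apply: big1 => i _; apply: big1 => j _; rewrite scale0r mulr0. Qed.

Lemma cc_El c n m d : cc (El c n m d) = c.
Proof.
rewrite /cc dot_El coord_cc // coord_cd //.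
under eq_bigr => i _ do under eq_bigr => j _ do rewrite coord_cn //.
under [X in _ + X + _]eq_bigr => i _ do under eq_bigr => j _ do rewrite coord_cm //.
by rewrite !sum0 scale0r scale1r mulr0 mulr1 !addr0.
Qed.

Lemma nn_El c n m d i j : nn (El c n m d) i j = n i j.
Proof.
rewrite /nn dot_El coord_nc // coord_nd //.
under eq_bigr => k _ do under eq_bigr => l _ do rewrite coord_nn //.
under [X in _ + X + _]eq_bigr => k _ do under eq_bigr => l _ do rewrite coord_nm //.
by rewrite !sum0 sum_delta scale0r !mulr0 !addr0 add0r.
Qed.

Lemma mm_El c n m d i j : mm (El c n m d) i j = m i j.
Proof.
rewrite /mm dot_El coord_mc // coord_md //.
under eq_bigr => k _ do under eq_bigr => l _ do rewrite coord_mn //.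
under [X in _ + X + _]eq_bigr => k _ do under eq_bigr => l _ do rewrite coord_mm //.
by rewrite !sum0 sum_delta scale0r !mulr0 !addr0 !add0r.
Qed.

Lemma dd_El c n m d : dd (El c n m d) = d.
Proof.
rewrite /dd dot_El coord_dc // coord_dd //.
under eq_bigr => i _ do under eq_bigr => j _ do rewrite coord_dn //.
under [X in _ + X + _]eq_bigr => i _ do under eq_bigr => j _ do rewrite coord_dm //.
by rewrite !sum0 scale0r scale1r mulr0 mulr1 !add0r.
Qed.

Lemma El_ext c n m d c' n' m' d' :
  c = c' -> n =2 n' -> m =2 m' -> d = d' -> El c n m d = El c' n' m' d'.
Proof.
move=> -> nE mE ->; rewrite /El; congr (_ + _ + _ + _).
  by apply: eq_bigr => i _; apply: eq_bigr => j _; rewrite nE.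
by apply: eq_bigr => i _; apply: eq_bigr => j _; rewrite mE.
Qed.

Lemma ElD c n m d c' n' m' d' : El c n m d + El c' n' m' d' =
  El (c + c') (fun i j => n i j + n' i j) (fun i j => m i j + m' i j) (d + d').
Proof.
rewrite /El !scalerDl.
rewrite [RHS](_ : _ = c *: emb (basis_c u) + c' *: emb (basis_c u) +
  (\sum_i \sum_j n i j *: emb (basis_n u v i j) +
   \sum_i \sum_j n' i j *: emb (basis_n u v i j)) +
  (\sum_i \sum_j m i j *: emb (basis_m u v i j) +
   \sum_i \sum_j m' i j *: emb (basis_m u v i j)) +
  (d *: emb (basis_d v) + d' *: emb (basis_d v))).
  by rewrite addrACA; congr (_ + _); rewrite addrACA; congr (_ + _); rewrite addrACA.
congr (_ + _ + _ + _); rewrite -big_split; apply: eq_bigr => i _;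
  by rewrite -big_split; apply: eq_bigr => j _; rewrite scalerDl.
Qed.

Lemma ElZ (k : R) c n m d : k *: El c n m d =
  El (k * c) (fun i j => k * n i j) (fun i j => k * m i j) (k * d).
Proof.
rewrite /El !scalerDr !scalerA; congr (_ + _ + _ + _); rewrite scaler_sumr;
  by apply: eq_bigr => i _; rewrite scaler_sumr; apply: eq_bigr => j _; rewrite scalerA.
Qed.

Lemma El0 : El 0 (fun _ _ => 0) (fun _ _ => 0) 0 = 0.
Proof.
rewrite -[RHS](scale0r (El 0 (fun _ _ => 0) (fun _ _ => 0) 0)) ElZ.
by apply: El_ext => *; rewrite mul0r.
Qed.

Lemma El_nc c n : El c n (fun _ _ => 0) 0 =
  c *: emb (basis_c u) + \sum_i \sum_j n i j *: emb (basis_n u v i j).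
Proof.
rewrite /El scale0r addr0 [X in _ + X]big1 ?addr0 // => i _.
by apply: big1 => j _; rewrite scale0r.
Qed.

Lemma El_c c : El c (fun _ _ => 0) (fun _ _ => 0) 0 = c *: emb (basis_c u).
Proof.
rewrite El_nc [X in _ + X]big1 ?addr0 // => i _.
by apply: big1 => j _; rewrite scale0r.
Qed.

Lemma cc_emb (x : ext K) : cc (emb x) = (dot (coord_c u v) x)%:A.
Proof. exact: dot_emb. Qed.
Lemma nn_emb (x : ext K) i j : nn (emb x) i j = (dot (coord_n u v i j) x)%:A.
Proof. exact: dot_emb. Qed.
Lemma mm_emb (x : ext K) i j : mm (emb x) i j = (dot (coord_m u v i j) x)%:A.
Proof. exact: dot_emb. Qed.
Lemma dd_emb (x : ext K) : dd (emb x) = (dot (coord_d u v) x)%:A.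
Proof. exact: dot_emb. Qed.

Definition uv_vec g h : vec 'I_6 R :=
  \sum_i g i *: emb (tnth u i) + \sum_i h i *: emb (tnth v i).

Let U g : vec 'I_6 R := \sum_i g i *: emb (tnth u i).
Let V h : vec 'I_6 R := \sum_i h i *: emb (tnth v i).

Let sqr_emb (t : 3.-tuple (vec 'I_6 K)) i :
  wedge (ext1 (emb (tnth t i))) (ext1 (emb (tnth t i))) = 0.
Proof. exact: ext1_sqr. Qed.

Let emb_wedge3 x y z : emb (wedge3 x y z) = wedge3 (emb x) (emb y) (emb z).
Proof. exact: (map_vec_wedge3 (in_alg R)). Qed.

Let wedge3UUU f g h : wedge3 (U f) (U g) (U h) = det3 f g h *: emb (basis_c u).
Proof. by rewrite /wedge3 (wedge_det (sqr_emb u)) emb_wedge3. Qed.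

Let wedge3VVV f g h : wedge3 (V f) (V g) (V h) = det3 f g h *: emb (basis_d v).
Proof. by rewrite /wedge3 (wedge_det (sqr_emb v)) emb_wedge3. Qed.

Let wedge3UUV f g h : wedge3 (U f) (U g) (V h) =
  \sum_i \sum_j (cross f g i * h j) *: emb (basis_n u v i j).
Proof.
rewrite /wedge3 (wedge_cross (sqr_emb u)) ext1_sum wedge_suml.
apply: eq_bigr => i _; rewrite wedge_sumr; apply: eq_bigr => j _.
by rewrite ext1Z wedgeZl wedgeZr scalerA emb_wedge3.
Qed.

Let wedge3UVV f g h : wedge3 (U f) (V g) (V h) =
  \sum_i \sum_j (f i * cross g h j) *: emb (basis_m u v i j).
Proof.
rewrite /wedge3 wedgeA (wedge_cross (sqr_emb v)) ext1_sum wedge_suml.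
apply: eq_bigr => i _; rewrite wedge_sumr; apply: eq_bigr => j _.
by rewrite ext1Z wedgeZl wedgeZr scalerA -wedgeA emb_wedge3.
Qed.

(** These are the 3 x 3 minors of the matrix with rows (g_k | h_k), sorted by the number of columns
    taken from the first half. *)
Lemma wedge3_uv g1 h1 g2 h2 g3 h3 :
  wedge3 (uv_vec g1 h1) (uv_vec g2 h2) (uv_vec g3 h3) =
  El (det3 g1 g2 g3)
     (fun i j => cross g2 g3 i * h1 j + cross g3 g1 i * h2 j + cross g1 g2 i * h3 j)
     (fun i j => g1 i * cross h2 h3 j + g2 i * cross h3 h1 j + g3 i * cross h1 h2 j)
     (det3 h1 h2 h3).
Proof.
rewrite [LHS](_ : _ = wedge3 (U g1) (U g2) (U g3) +
  (wedge3 (U g2) (U g3) (V h1) + wedge3 (U g3) (U g1) (V h2) +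
   wedge3 (U g1) (U g2) (V h3)) +
  (wedge3 (U g1) (V h2) (V h3) + wedge3 (U g2) (V h3) (V h1) +
   wedge3 (U g3) (V h1) (V h2)) +
  wedge3 (V h1) (V h2) (V h3)); last first.
  (* Cyclic rotation of three vectors costs no sign and brings the letters of U to the front in each
     of the eight terms. *)
  rewrite (wedge3_rot (U g2) (U g3)) (wedge3_rot (U g3) (U g1)).
  rewrite (wedge3_rot (V h2) (U g3)) (wedge3_rot (U g2) (V h3)).
  rewrite (wedge3_rot (U g3) (V h1)) (wedge3_rot (V h2) (U g3)).
  apply/ffunP => S.
  by rewrite /wedge3 !ext1D !wedgeDl !wedgeDr !wedgeDl !vecDE; ring.
rewrite wedge3UUU wedge3VVV !wedge3UUV !wedge3UVV /El.
congr (_ + _ + _ + _).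
  rewrite -!big_split; apply: eq_bigr => i _; rewrite -!big_split.
  by apply: eq_bigr => j _; rewrite !scalerDl.
rewrite -!big_split; apply: eq_bigr => i _; rewrite -!big_split.
by apply: eq_bigr => j _; rewrite !scalerDl.
Qed.

Lemma spanning_uv (x : vec 'I_6 R) : exists g h, x = uv_vec g h.
Proof.
have [g gP] := boolp.choice (fun k : 'I_6 => spanning [ffun j => (j == k)%:R]).
have [h hP] := boolp.choice gP.
exists (fun i => \sum_k x k * (g k i)%:A), (fun i => \sum_k x k * (h k i)%:A).
rewrite {1}(_ : x = \sum_k x k *: emb [ffun j => (j == k)%:R]); last first.
  apply/ffunP => j; rewrite sum_ffunE (bigD1 j) //= big1 => [|k /negPf kj].
    by rewrite addr0 vecZE !ffunE eqxx rmorph1 mulr1.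
  by rewrite vecZE !ffunE eq_sym kj rmorph0 mulr0.
transitivity (\sum_k (\sum_i (x k * (g k i)%:A) *: emb (tnth u i) +
                     \sum_i (x k * (h k i)%:A) *: emb (tnth v i))).
  apply: eq_bigr => k _; rewrite {1}hP [emb _](map_vecD (in_alg R)) scalerDr.
  rewrite !(map_vec_sum (in_alg R)) !scaler_sumr.
  by congr (_ + _); apply: eq_bigr => i _; rewrite (map_vecZ (in_alg R)) scalerA.
rewrite big_split /uv_vec; congr (_ + _); rewrite exchange_big;
  by apply: eq_bigr => i _; rewrite scaler_suml.
Qed.

End Embedding.

Lemma map_vec_emb (K : fieldType) (R S : comAlgType K) (f : {lrmorphism R -> S})
    (I : finType) (x : vec I K) :
  map_vec f (emb R x) = emb S x.
Proof. by apply/ffunP => i; rewrite !ffunE /= rmorph_alg. Qed.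

Lemma mm_map_vec (K : fieldType) (u v : 3.-tuple (vec 'I_6 K)) (R S : comAlgType K)
    (f : {lrmorphism R -> S}) (w : ext R) i j :
  mm u v (map_vec f w) i j = f (mm u v w i j).
Proof. by rewrite /mm -(map_vec_emb f) dot_map_vec. Qed.

(** * Modules of rank one and comaximal families *)

Local Open Scope classical_set_scope.

Section Submodules.
Variables (R : comNzRingType) (I : finType).
Implicit Types (X L D : set (vec I R)) (w : vec I R).

Lemma submodule_sum L n (F : 'I_n -> vec I R) :
  submodule L -> (forall k, L (F k)) -> L (\sum_k F k).
Proof. by move=> [L0 LD _] LF; elim/big_ind: _. Qed.

Lemma lin_span_submodule X : submodule (lin_span X).
Proof.
split.
- exists 0, (fun=> 0), (fun=> 0); split; first by case.
  by rewrite big_ord0.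
- move=> _ _ [n [c [x [Xx ->]]]] [m [d [y [Xy ->]]]].
  exists (n + m)%N, (fun k => match split k with inl i => c i | inr j => d j end),
    (fun k => match split k with inl i => x i | inr j => y j end).
  split=> [k|]; first by case: (split k).
  rewrite big_split_ord /=; congr (_ + _); apply: eq_bigr => k _.
    by rewrite (unsplitK (inl k)).
  by rewrite (unsplitK (inr k)).
- move=> k _ [n [c [x [Xx ->]]]]; exists n, (fun i => k * c i), x; split=> //.
  by rewrite scaler_sumr; apply: eq_bigr => i _; rewrite scalerA.
Qed.

Lemma sub_lin_span X : X `<=` lin_span X.
Proof.
move=> x Xx; exists 1%N, (fun=> 1), (fun=> x); split=> //.
by rewrite big_ord1 scale1r.
Qed.

Lemma lin_span_min X L : submodule L -> X `<=` L -> lin_span X `<=` L.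
Proof.
move=> sL XL _ [n [c [x [Xx ->]]]]; apply: (submodule_sum sL) => k.
by case: sL => _ _; apply; apply: XL.
Qed.

End Submodules.

Section Comaximal.
Variable R : comNzRingType.
Implicit Types (Z J : set R).

Definition is_ideal J := [/\ J 0, forall a b, J a -> J b -> J (a + b) &
  forall c a, J a -> J (c * a)].

(* [Z] generates the unit ideal; in this form the property can be used without
   choosing coefficients. *)
Definition comaximal Z := forall J, is_ideal J -> Z `<=` J -> J 1.

Lemma comaximal_eq Z (x y : R) :
  comaximal Z -> (forall z, Z z -> z * x = z * y) -> x = y.
Proof.
move=> cZ Zxy; rewrite -[x]mul1r -[y]mul1r.
apply: (cZ [set z | z * x = z * y]) => //; split=> [|a b|c a] /=.
- by rewrite !mul0r.
- by rewrite !mulrDl => -> ->.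
- by rewrite -!mulrA => ->.
Qed.

Lemma is_ideal_sum J n (F : 'I_n -> R) :
  is_ideal J -> (forall k, J (F k)) -> J (\sum_k F k).
Proof. by move=> [J0 JD _] JF; elim/big_ind: _. Qed.

(** A local computation at z often yields its conclusion only up to a power of z. It still
    globalises, because the radical of J is an ideal. *)
Lemma comaximal_radical Z J : comaximal Z -> is_ideal J ->
  (forall z, Z z -> exists n, J (z ^+ n)) -> J 1.
Proof.
move=> cZ iJ ZJ; have [J0 JD JM] := iJ.
have [] := cZ [set z | exists n, J (z ^+ n)] _ ZJ; last by move=> n; rewrite expr1n.
split=> [|a b [n Jn] [m Jm]|c a [n Jn]]; first by exists 1%N; rewrite expr1.
  exists (n + m)%N; rewrite exprDn; apply: is_ideal_sum => // k; rewrite -mulr_natl.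
  (* The k-th binomial term contains a^n if k <= m, and b^m otherwise. *)
  apply: (JM); case: (leqP k m) => km.
    by rewrite -addnBA // exprD -mulrA mulrC; apply: JM.
  by rewrite -(subnK (ltnW km)) exprD mulrA; apply: JM.
by exists n; rewrite exprMn; apply: JM.
Qed.

Lemma comaximal_mul Z Z' : comaximal Z -> comaximal Z' ->
  comaximal [set r | exists z z', [/\ Z z, Z' z' & r = z * z']].
Proof.
move=> cZ cZ' J [J0 JD JM] ZJ.
apply: cZ => // z Zz; rewrite -[z]mul1r.
apply: (cZ' [set r | J (r * z)]) => [|z' Zz'] /=.
  split=> [|a b|c a] /=; first by rewrite mul0r.
    by rewrite mulrDl; apply: JD.
  by rewrite -mulrA; apply: JM.
by apply: ZJ; exists z, z'; rewrite mulrC.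
Qed.

End Comaximal.

Section RankOne.
Variables (R : comNzRingType) (I : finType).
Implicit Types (X L D : set (vec I R)) (w : vec I R).

Definition proportional X := forall w w', X w -> X w' ->
  forall i j, w i * w' j = w j * w' i.

Definition entries X : set R := [set r | exists w i, X w /\ r = w i].

Lemma proportional_dot X : proportional X -> forall w w', X w -> X w' ->
  forall f g, dot f w * dot g w' = dot f w' * dot g w.
Proof.
move=> pX w w' Xw Xw' f g; rewrite /dot !mulr_suml; apply: eq_bigr => i _.
rewrite !mulr_sumr; apply: eq_bigr => j _.
by rewrite mulrACA (pX w w') // [w j * _]mulrC mulrACA.
Qed.

Lemma dot_in_ideal (J : set R) f w : is_ideal J -> (forall i, J (w i)) -> J (dot f w).
Proof. by move=> [J0 JD JM] Jw; rewrite /dot; elim/big_ind: _ => // i _; apply: JM. Qed.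

(* [w = (s / r) v] and [w' = (s' / r) v] with [v] in [D], locally on Spec R. *)
Lemma locally_spanned_by_transfer D L (Q : vec I R -> vec I R -> R) :
  locally_spanned_by D L ->
  (forall k w w', Q (k *: w) w' = k * Q w w') ->
  (forall k w w', Q w (k *: w') = k * Q w w') ->
  (forall w, L w -> D w -> Q w w = 0) ->
  forall w w', L w -> L w' -> Q w w' = 0.
Proof.
move=> [_ [n [v [phi [Lv Dv sum1 vP]]]]] QZl QZr Q0 w w' Lw Lw'.
pose J := [set r | r * Q w w' = 0].
have iJ : is_ideal J.
  split=> [|a b|c a]; rewrite /J /=; first by rewrite mul0r.
    by rewrite mulrDl => -> ->; rewrite addr0.
  by rewrite -mulrA => ->; rewrite mulr0.
have /comaximal_radical/(_ iJ) : comaximal [set r | exists k, r = dot (phi k) (v k)].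
  move=> J' iJ' ZJ'; rewrite -sum1; apply: is_ideal_sum => // k.
  by apply: ZJ'; exists k.
rewrite /J /= mul1r; apply => _ [k ->]; exists 2%N.
by rewrite expr2 -mulrA -QZr -QZl !vP // QZl QZr Q0 // !mulr0.
Qed.

(** A description without chosen generators: rank one is the vanishing of all 2 x 2 minors. The two
    unit ideal conditions agree because the sums of values phi_k (v_k), with v_k in L and D, form an
    ideal that contains the entries of such vectors and is contained in the ideal they generate. *)
Lemma locally_spanned_byP D L : locally_spanned_by D L <->
  [/\ submodule L, proportional L & comaximal (entries (L `&` D))].
Proof.
split=> [LD|[sL pL cL]].
  have [sL [n [v [phi [Lv Dv sum1 vP]]]]] := LD; split=> // [w w' Lw Lw' i j|J iJ sJ].
    apply/eqP; rewrite -subr_eq0; apply/eqP.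
    apply: (locally_spanned_by_transfer (Q := fun w w' => w i * w' j - w j * w' i) LD)
      => //.
    - by move=> k x y; rewrite !vecZE mulrBr !mulrA.
    - by move=> k x y; rewrite !vecZE mulrBr !(mulrCA _ k).
    - by move=> x _ _; rewrite mulrC subrr.
  rewrite -sum1; apply: is_ideal_sum => // k; apply: dot_in_ideal => // i.
  by apply: sJ; exists (v k), i.
split=> //.
pose J : set R := [set r | exists n (v phi : 'I_n -> vec I R),
  [/\ forall k, L (v k), forall k, D (v k) & \sum_k dot (phi k) (v k) = r]].
have [] := cL J.
- split=> [|_ _ [n [v [phi [Lv Dv <-]]]] [m [w [psi [Lw Dw <-]]]]|
           c _ [n [v [phi [Lv Dv <-]]]]].
  + by exists 0, (fun=> 0), (fun=> 0); split; [case|case|rewrite big_ord0].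
  + exists (n + m)%N, (fun k => match split k with inl i => v i | inr j => w j end),
      (fun k => match split k with inl i => phi i | inr j => psi j end).
    split=> [k|k|]; [by case: (split k)|by case: (split k)|].
    rewrite big_split_ord /=; congr (_ + _); apply: eq_bigr => k _.
      by rewrite (unsplitK (inl k)).
    by rewrite (unsplitK (inr k)).
  + exists n, v, (fun k => c *: phi k); split=> //.
    by rewrite mulr_sumr; apply: eq_bigr => k _; rewrite dotZl.
- move=> _ [w [i [[Lw Dw] ->]]].
  exists 1%N, (fun=> w), (fun=> [ffun j => (j == i)%:R]); split=> //.
  by rewrite big_ord1 dot_delta.
move=> n [v [phi [Lv Dv sum1]]]; exists n, v, phi; split=> // k w Lw.
apply/ffunP => i; rewrite !vecZE -[w i]dot_delta -[v k i]dot_delta.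
exact: (proportional_dot pL).
Qed.

Lemma proj_spaceP L : proj_space L <->
  [/\ submodule L, proportional L & comaximal (entries L)].
Proof. by rewrite /proj_space /= locally_spanned_byP classical_sets.setIT. Qed.

End RankOne.

Section BaseChange.
Variables (R S : comNzRingType) (f : {rmorphism R -> S}) (I : finType).
Implicit Types (X L : set (vec I R)).

Lemma base_change_submodule L : submodule (base_change f L).
Proof. exact: lin_span_submodule. Qed.

Lemma map_in_base_change L w : L w -> base_change f L (map_vec f w).
Proof. by move=> Lw; apply: sub_lin_span; exists w. Qed.

Lemma base_change_min L (M : set (vec I S)) :
  submodule M -> (forall w, L w -> M (map_vec f w)) -> base_change f L `<=` M.
Proof. by move=> sM LM; apply: lin_span_min => // _ [w Lw <-]; apply: LM. Qed.

Lemma base_change_span X : base_change f (lin_span X) = lin_span (map_vec f @` X).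
Proof.
apply/seteqP; split.
  apply: base_change_min => [|w]; first exact: lin_span_submodule.
  apply: (lin_span_min (L := [set w | lin_span (map_vec f @` X) (map_vec f w)])).
    have [s0 sD sZ] := lin_span_submodule (map_vec f @` X).
    split=> [|x y|c x] /=; first by rewrite map_vec0.
      by rewrite map_vecD; apply: sD.
    by rewrite map_vecZ; apply: sZ.
  by move=> x Xx; apply: sub_lin_span; exists x.
apply: lin_span_min; first exact: lin_span_submodule.
by move=> _ [x Xx <-]; apply: map_in_base_change; apply: sub_lin_span.
Qed.

Lemma base_change_locally_spanned_by (D L : set (vec I R)) (D' : set (vec I S)) :
  (forall w, D w -> D' (map_vec f w)) ->
  locally_spanned_by D L -> locally_spanned_by D' (base_change f L).
Proof.
move=> DD' [sL [n [v [phi [Lv Dv sum1 vP]]]]].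
split; first exact: base_change_submodule.
exists n, (fun k => map_vec f (v k)), (fun k => map_vec f (phi k)); split.
- by move=> k; apply: map_in_base_change.
- by move=> k; apply: DD'.
- by rewrite -(rmorph1 f) -sum1 rmorph_sum; apply: eq_bigr => k _; rewrite dot_map_vec.
move=> k; pose M : set (vec I S) := [set w | dot (map_vec f (phi k)) (map_vec f (v k)) *: w =
  dot (map_vec f (phi k)) w *: map_vec f (v k)].
apply: (base_change_min (M := M)); rewrite /M.
  split=> [|x y /= xM yM|c x /= xM] /=; first by rewrite dot0r scaler0 scale0r.
    by rewrite scalerDr xM yM dotDr scalerDl.
  by rewrite scalerA mulrC -scalerA xM scalerA dotZr.
by move=> w Lw /=; rewrite !dot_map_vec -!map_vecZ vP.
Qed.

End BaseChange.

(** * Pluecker relations *)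

Lemma ord3_rot (i : 'I_3) : i + 1 + 1 + 1 = i.
Proof. by rewrite -!addrA (addrA 1) ord3_add addr0. Qed.

Lemma sum3_rot (V : nmodType) (F : 'I_3 -> V) i :
  \sum_j F j = F i + F (i + 1) + F (i + 1 + 1).
Proof.
rewrite sum3E; case: (ord3P i) => ->; rewrite !ord3E //.
  by rewrite [RHS]addrC addrA.
by rewrite [LHS]addrC addrA.
Qed.

Lemma ord3_rotP (i j : 'I_3) : [\/ j = i, j = i + 1 | j = i + 1 + 1].
Proof.
case: (ord3P i) => ->; case: (ord3P j) => ->; rewrite !ord3E;
  by [apply: Or31 | apply: Or32 | apply: Or33].
Qed.

Section Pluecker.
Variable R : comNzRingType.
Implicit Types (f g h x y : 'I_3 -> R) (m n : 'I_3 -> 'I_3 -> R) (c : R).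

(* A bilinear map whose value at [n, n] is the cofactor matrix of [n]. *)
Definition cofp n n' (i j : 'I_3) : R :=
  n (i + 1) (j + 1) * n' (i + 1 + 1) (j + 1 + 1) -
  n (i + 1) (j + 1 + 1) * n' (i + 1 + 1) (j + 1).

Lemma cofp_ext n1 n2 n1' n2' : n1 =2 n2 -> n1' =2 n2' -> cofp n1 n1' =2 cofp n2 n2'.
Proof. by move=> nE nE' i j; rewrite /cofp !nE !nE'. Qed.

Lemma cofpC n n' : (forall i j k l, n i j * n' k l = n' i j * n k l) ->
  cofp n n' =2 cofp n' n.
Proof. by move=> nn' i j; rewrite /cofp nn' [X in _ - X]nn'. Qed.

Section Minors.
Variables g1 g2 g3 h1 h2 h3 : 'I_3 -> R.
Let n i j := cross g2 g3 i * h1 j + cross g3 g1 i * h2 j + cross g1 g2 i * h3 j.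
Let m i j := g1 i * cross h2 h3 j + g2 i * cross h3 h1 j + g3 i * cross h1 h2 j.

Lemma minors_mm i j : cofp m m i j = det3 h1 h2 h3 * n i j.
Proof.
rewrite /cofp /n /m /det3 /dot3 (sum3_rot _ j) /cross !ord3_rot; ring.
Qed.

(** The bracket is c times the identity matrix, left unexpanded: what is used is the factor d =
    [det3 h1 h2 h3], which vanishes on A. *)
Lemma minors_mnT i k : \sum_j m i j * n k j =
  det3 h1 h2 h3 * (g1 i * cross g2 g3 k + g2 i * cross g3 g1 k + g3 i * cross g1 g2 k).
Proof. rewrite /n /m /det3 /dot3 !sum3E /cross !ord3E; ring. Qed.

Lemma minors_mTn j k : \sum_i m i j * n i k =
  if j == k then det3 g1 g2 g3 * det3 h1 h2 h3 else 0.
Proof.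
case: (ord3P j) => ->; case: (ord3P k) => -> /=;
  rewrite /n /m /det3 /dot3 !sum3E /cross !ord3E; ring.
Qed.

Lemma minors_nn i j : cofp n n i j = det3 g1 g2 g3 * m i j.
Proof.
rewrite /cofp /n /m /det3 /dot3 (sum3_rot _ i) /cross !ord3_rot; ring.
Qed.

End Minors.

(** Any two distinct indices among three are cyclically adjacent, so each 2 x 2 minor is a cofactor
    up to sign. *)
Lemma cofp_rank1 m : (forall i j, cofp m m i j = 0) ->
  forall i j k l, m i j * m k l = m k j * m i l.
Proof.
move=> cof0; have step i j l : m i j * m (i + 1) l = m (i + 1) j * m i l.
  have := cof0 (i + 1 + 1) j; have := cof0 (i + 1 + 1) (j + 1).
  have := cof0 (i + 1 + 1) (j + 1 + 1); rewrite /cofp !ord3_rot => e1 e2 e3.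
  apply/eqP; rewrite -subr_eq0; apply/eqP.
  case: (ord3_rotP j l) => ->; first by ring.
    by rewrite -[RHS]e1; ring.
  by rewrite -[RHS]oppr0 -[in RHS]e2; ring.
move=> i j k l; case: (ord3_rotP i k) => ->; [by [] | exact: step |].
by have := step (i + 1 + 1) j l; rewrite ord3_rot => ->.
Qed.

(** The expansion x ^ (f ^ y) = (x.y) f - (x.f) y of the double cross product. *)
Lemma cross_orthogonal f x y : dot3 x f = 0 -> forall i,
  cross x (cross f y) i = dot3 y x * f i.
Proof.
move=> xf i; transitivity (dot3 y x * f i - dot3 x f * y i); last first.
  by rewrite xf mul0r subr0.
rewrite /dot3 !(sum3_rot _ i) /cross !ord3_rot; ring.
Qed.

Lemma det3_cross f x a b :
  det3 x (cross a f) (cross b f) = dot3 f x * dot3 f (cross a b).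
Proof. rewrite /det3 /dot3 !sum3E /cross !ord3E; ring. Qed.

(* Row [i] of [cofp n n'] is a cross product of two vectors orthogonal to [y]. *)
Lemma cofp_row n n' y : (forall i, \sum_j n i j * y j = 0) ->
  (forall i, \sum_j n' i j * y j = 0) ->
  forall i j b, cofp n n' i j * y b = cofp n n' i b * y j.
Proof.
move=> ny ny'; have step i j : cofp n n' i j * y (j + 1) = cofp n n' i (j + 1) * y j.
  apply/eqP; rewrite -subr_eq0 [X in X == _](_ : _ =
    n' (i + 1 + 1) (j + 1 + 1) * (\sum_j n (i + 1) j * y j) -
    n (i + 1) (j + 1 + 1) * (\sum_j n' (i + 1 + 1) j * y j)).
    by rewrite ny ny' !mulr0 subr0.
  rewrite !(sum3_rot _ j) /cofp !ord3_rot; ring.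
move=> i j b; case: (ord3_rotP j b) => ->; [by [] | exact: step |].
by have := step i (j + 1 + 1); rewrite ord3_rot => <-.
Qed.

(** [cofp_row] for the transposed matrices. The polarised cofactor commutes with transposition only
    when n and n' are proportional, hence the first hypothesis. *)
Lemma cofp_col n n' x : (forall i j k l, n i j * n' k l = n' i j * n k l) ->
  (forall j, \sum_i x i * n i j = 0) -> (forall j, \sum_i x i * n' i j = 0) ->
  forall i j a, cofp n n' i j * x a = cofp n n' a j * x i.
Proof.
move=> nn' xn xn'.
have trE i j : cofp n n' i j = cofp (fun k l => n l k) (fun k l => n' l k) j i.
  by rewrite /cofp [n (i + 1) (j + 1 + 1) * _]nn' [X in _ - X]mulrC.
move=> i j a; rewrite !trE; apply: cofp_row => k.
  by rewrite -[RHS](xn k); apply: eq_bigr => l _; rewrite mulrC.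
by rewrite -[RHS](xn' k); apply: eq_bigr => l _; rewrite mulrC.
Qed.

End Pluecker.

Section Decomposable.
Variables (K : fieldType) (u v : 3.-tuple (vec 'I_6 K)).
Hypothesis two_neq0 : 2%:R != 0 :> K.
Hypothesis spanning : forall x : vec 'I_6 K, exists g h : 'I_3 -> K,
  x = \sum_i g i *: tnth u i + \sum_i h i *: tnth v i.
Variable R : comAlgType K.

Let delta (k i : 'I_3) : R := (i == k)%:R.

Let cross_delta1 r (y : 'I_3 -> R) j : cross (delta (r + 1)) y j =
  if j == r then y (r + 1 + 1) else if j == r + 1 then 0 else - y r.
Proof.
by case: (ord3P r) => ->; case: (ord3P j) => ->;
  rewrite /cross /delta !ord3E /= ?eqxx /= ?mul1r ?mul0r ?subr0 ?sub0r.
Qed.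

Let cross_delta2 r (y : 'I_3 -> R) j : cross (delta (r + 1 + 1)) y j =
  if j == r then - y (r + 1) else if j == r + 1 then y r else 0.
Proof.
by case: (ord3P r) => ->; case: (ord3P j) => ->;
  rewrite /cross /delta !ord3E /= ?eqxx /= ?mul1r ?mul0r ?subr0 ?sub0r.
Qed.

(* With e the standard basis, n_p the columns of n and (p, q, r) cyclic, the
   vectors are x, (f.x) (e_p ^ y) + n_p ^ f and (f.x) (e_q ^ y) + n_q ^ f, where
   ^ is the cross product; when f.x and y_r are invertible they span a plane
   which is (c, n, x y^T, 0) in Pluecker coordinates. *)
Lemma decomposable_El (x y f : 'I_3 -> R) n c r :
  (forall j, \sum_i x i * n i j = 0) -> (forall i, \sum_j n i j * y j = 0) ->
  (forall i j, cofp n n i j = c * (x i * y j)) ->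
  wedge3 (uv_vec u v x (fun=> 0))
    (uv_vec u v (cross (n^~ (r + 1)) f)
                (fun j => dot3 f x * cross (delta (r + 1)) y j))
    (uv_vec u v (cross (n^~ (r + 1 + 1)) f)
                (fun j => dot3 f x * cross (delta (r + 1 + 1)) y j)) =
  (dot3 f x ^+ 2 * y r) *: El u v c n (fun i j => x i * y j) 0.
Proof.
have n1 : (r + 1 == r) = false by case: (ord3P r) => ->.
have n2 : (r + 1 + 1 == r) = false by case: (ord3P r) => ->.
have n3 : (r + 1 + 1 == r + 1) = false by case: (ord3P r) => ->.
move=> xn ny cof; rewrite wedge3_uv // ElZ; apply: El_ext.
(* The cross product of columns r + 1 and r + 2 of n is column r of its cofactor matrix, that is c
   y_r x. *)
- rewrite det3_cross [X in _ * X](_ : _ = c * y r * dot3 f x); first ring.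
  rewrite /dot3 mulr_sumr; apply: eq_bigr => i _.
  rewrite [cross _ _ i](_ : _ = cofp n n i r); last by rewrite /cross /cofp; ring.
  by rewrite cof; ring.
- move=> i j; have E k : cross x (cross (n^~ k) f) i = dot3 f x * n i k.
    by rewrite cross_orthogonal //; apply: xn.
  have C a : cross a x i = - cross x a i by rewrite /cross; ring.
  rewrite C !E mulr0 add0r !(cross_delta2 r) !(cross_delta1 r).
  have := ny i; rewrite (sum3_rot _ r) => nyr.
  case: (ord3_rotP r j) => ->; rewrite ?eqxx.
  (* For j = r the determinant produces the two other terms of row i of n y; the relation n y = 0
     trades them for n_ir y_r. *)
  + rewrite [LHS](_ : _ = dot3 f x ^+ 2 * (y r * n i r) - dot3 f x ^+ 2 *
      (n i r * y r + n i (r + 1) * y (r + 1) + n i (r + 1 + 1) * y (r + 1 + 1))).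
      by rewrite nyr; ring.
    by ring.
  + by rewrite n1; ring.
  + by rewrite n2 n3; ring.
- move=> i j; have C0 a : cross (fun=> 0) a j = 0 by rewrite /cross; ring.
  have C0' a : cross a (fun=> 0) j = 0 by rewrite /cross; ring.
  have CE (a b : 'I_3 -> R) : cross a b j =
    a (j + 1) * b (j + 1 + 1) - a (j + 1 + 1) * b (j + 1) by [].
  rewrite C0 C0' CE !mulr0 !addr0 !(cross_delta2 r) !(cross_delta1 r).
  by case: (ord3_rotP r j) => ->; rewrite ?ord3_rot ?eqxx ?n1 ?n2 ?n3; ring.
- by rewrite /det3 /dot3 mulr0 big1 // => i _; rewrite mul0r.
Qed.

End Decomposable.

(** * From F - {u} to Sing V_A *)

Section Core.
Variables (K : fieldType) (u v : 3.-tuple (vec 'I_6 K)).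
Hypothesis two_neq0 : 2%:R != 0 :> K.
Hypothesis spanning : forall x : vec 'I_6 K, exists g h : 'I_3 -> K,
  x = \sum_i g i *: tnth u i + \sum_i h i *: tnth v i.
Variable t : 'I_3 -> 'I_3 -> 'I_3 -> 'I_3 -> K.

Local Notation cc := (cc u v).
Local Notation nn := (nn u v).
Local Notation mm := (mm u v).
Local Notation dd := (dd u v).
Local Notation El := (El u v).

Section OverAlgebra.
Variable R : comAlgType K.
Implicit Types (a b w : ext R) (m : 'I_3 -> 'I_3 -> R) (L : set (ext R)).
Implicit Types (x y : vec 'I_3 R) (X Y : set (vec 'I_3 R)).

Definition phi m i j : R := \sum_k \sum_l m k l * (t i j k l)%:A.

Lemma phi_ext m m' : m =2 m' -> phi m =2 phi m'.
Proof.
by move=> mm' i j; apply: eq_bigr => k _; apply: eq_bigr => l _; rewrite mm'.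
Qed.

Lemma phi_mulr m r i j : phi m i j * r = phi (fun k l => m k l * r) i j.
Proof.
rewrite /phi mulr_suml; apply: eq_bigr => k _; rewrite mulr_suml.
by apply: eq_bigr => l _; rewrite mulrAC.
Qed.

Lemma phiD m m' i j : phi (fun k l => m k l + m' k l) i j = phi m i j + phi m' i j.
Proof.
rewrite /phi -big_split; apply: eq_bigr => k _; rewrite -big_split.
by apply: eq_bigr => l _; rewrite mulrDl.
Qed.

Lemma phiZ (r : R) m i j : phi (fun k l => r * m k l) i j = r * phi m i j.
Proof. by rewrite mulrC phi_mulr; apply: phi_ext => k l; rewrite mulrC. Qed.

Lemma phi_mmD a b i j : phi (mm (a + b)) i j = phi (mm a) i j + phi (mm b) i j.
Proof. by rewrite -phiD; apply: phi_ext => k l; rewrite mmD. Qed.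

Lemma phi_mmZ r a i j : phi (mm (r *: a)) i j = r * phi (mm a) i j.
Proof. by rewrite -phiZ; apply: phi_ext => k l; rewrite mmZ. Qed.

Lemma phi_mm0 i j : phi (mm (0 : ext R)) i j = 0.
Proof. by rewrite -(scale0r (0 : ext R)) phi_mmZ mul0r. Qed.

Lemma phi_proportional m m' : (forall i j k l, m i j * m' k l = m' i j * m k l) ->
  forall i j k l, m i j * phi m' k l = m' i j * phi m k l.
Proof.
move=> mm' i j k l; rewrite mulrC [RHS]mulrC !phi_mulr; apply: phi_ext => p q.
by rewrite mulrC mm' mulrC.
Qed.

(** The coordinate c stays free because the graph has to contain u. *)
Definition graph : set (ext R) := [set a | a = El (cc a) (phi (mm a)) (mm a) 0].

Lemma graph_El c m : graph (El c (phi m) m 0).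
Proof.
rewrite /graph /=; apply: El_ext => [|i j|i j|//]; rewrite ?cc_El ?mm_El //.
by apply: phi_ext => k l; rewrite mm_El.
Qed.

Lemma graph_nn a : graph a -> nn a =2 phi (mm a).
Proof. by rewrite /graph /= => {1}-> i j; rewrite nn_El. Qed.

Lemma graph_dd a : graph a -> dd a = 0.
Proof. by rewrite /graph /= => ->; rewrite dd_El. Qed.

Lemma graph_inj a b : graph a -> graph b -> cc a = cc b -> mm a =2 mm b -> a = b.
Proof.
move=> -> ->; rewrite !cc_El // => cab mab; apply: El_ext => // [i j|i j].
  by apply: phi_ext => k l; have := mab k l; rewrite !mm_El.
by have := mab i j; rewrite !mm_El.
Qed.

Definition mm_entries L : set R := [set r | exists w i j, L w /\ r = mm w i j].

(* When A is the graph of [phi], these are the R-points of F - {u}. *)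
Definition config L :=
  [/\ grass L, L `<=` graph & comaximal (mm_entries L)].

Definition mm_col a j : vec 'I_3 R := [ffun i => mm a i j].
Definition mm_row a i : vec 'I_3 R := [ffun j => mm a i j].

Lemma mm_colE a i j : mm_col a j i = mm a i j. Proof. by rewrite ffunE. Qed.
Lemma mm_rowE a i j : mm_row a i j = mm a i j. Proof. by rewrite ffunE. Qed.
Lemma mm_col0 j : mm_col 0 j = 0.
Proof. by apply/ffunP => i; rewrite mm_colE mm0 vec0E. Qed.
Lemma mm_row0 i : mm_row 0 i = 0.
Proof. by apply/ffunP => j; rewrite mm_rowE mm0 vec0E. Qed.
Lemma mm_colD a b j : mm_col (a + b) j = mm_col a j + mm_col b j.
Proof. by apply/ffunP => i; rewrite vecDE !mm_colE mmD. Qed.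
Lemma mm_rowD a b i : mm_row (a + b) i = mm_row a i + mm_row b i.
Proof. by apply/ffunP => j; rewrite vecDE !mm_rowE mmD. Qed.
Lemma mm_colZ k a j : mm_col (k *: a) j = k *: mm_col a j.
Proof. by apply/ffunP => i; rewrite vecZE !mm_colE mmZ. Qed.
Lemma mm_rowZ k a i : mm_row (k *: a) i = k *: mm_row a i.
Proof. by apply/ffunP => j; rewrite vecZE !mm_rowE mmZ. Qed.

Local Opaque mm_col mm_row phi.

Definition columns L : set (vec 'I_3 R) :=
  [set x | exists w j, L w /\ x = mm_col w j].
Definition rows L : set (vec 'I_3 R) :=
  [set y | exists w i, L w /\ y = mm_row w i].
(** The map of the theorem. Where m = x y^T, the columns of m are the multiples y_j x and the rows
    the multiples x_i y, so their spans are the lines of x and y. No generator of L is chosen, which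
    makes compatibility with base change direct. *)
Definition point_pair L := (lin_span (columns L), lin_span (rows L)).

(* The R-points of Sing V_A. *)
Definition critical (p : set (vec 'I_3 R) * set (vec 'I_3 R)) :=
  [/\ proj_space p.1, proj_space p.2 & forall x y, p.1 x -> p.2 y ->
    (forall i, \sum_j phi (fun k l => x k * y l) i j * y j = 0) /\
    (forall j, \sum_i x i * phi (fun k l => x k * y l) i j = 0)].

Lemma segre_vecE x y : segre_vec u v x y = El 0 (fun _ _ => 0) (fun i j => x i * y j) 0.
Proof.
rewrite /El !scale0r addr0 add0r big1 ?add0r // => i _; apply: big1 => j _.
by rewrite scale0r.
Qed.

(** The Pluecker relations on the hyperplane d = 0, read off from the minors of a matrix whose rows
    span the plane. *)
Lemma wedge3_pluecker a : (exists x y z : vec 'I_6 R, a = wedge3 x y z) -> dd a = 0 ->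
  [/\ forall i j k l, mm a i j * mm a k l = mm a k j * mm a i l,
      forall i k, \sum_j mm a i j * nn a k j = 0,
      forall j k, \sum_i mm a i j * nn a i k = 0 &
      forall i j, cofp (nn a) (nn a) i j = cc a * mm a i j].
Proof.
move=> [x [y [z ->]]].
have [g1 [h1 ->]] := spanning_uv spanning x.
have [g2 [h2 ->]] := spanning_uv spanning y.
have [g3 [h3 ->]] := spanning_uv spanning z.
rewrite wedge3_uv // dd_El // => d0; split.
- move=> i j k l; rewrite !mm_El //; move: i j k l.
  have cof0 i j := minors_mm g1 g2 g3 h1 h2 h3 i j.
  by apply: cofp_rank1 => i j; rewrite cof0 d0 mul0r.
- move=> i k; transitivity (det3 h1 h2 h3 * (g1 i * cross g2 g3 k +
    g2 i * cross g3 g1 k + g3 i * cross g1 g2 k)); last by rewrite d0 mul0r.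
  by rewrite -minors_mnT; apply: eq_bigr => j _; rewrite mm_El // nn_El.
- move=> j k; transitivity (if j == k then det3 g1 g2 g3 * det3 h1 h2 h3 else 0).
    by rewrite -minors_mTn; apply: eq_bigr => i _; rewrite mm_El // nn_El.
  by rewrite d0 mulr0; case: ifP.
- by move=> i j; rewrite /cofp !nn_El // cc_El // mm_El // -minors_nn.
Qed.

Section Config.
Variable L : set (ext R).
Hypothesis cL : config L.

Let gL : grass L. Proof. by case: cL. Qed.
Let subL : L `<=` graph. Proof. by case: cL. Qed.
Let coL : comaximal (mm_entries L). Proof. by case: cL. Qed.
Let sL : submodule L. Proof. by case: gL. Qed.

Lemma config_proportional : proportional L.
Proof. by have /locally_spanned_byP[] := gL. Qed.

Lemma config_mm w w' i j k l : L w -> L w' ->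
  mm w i j * mm w' k l = mm w' i j * mm w k l.
Proof. by move=> Lw Lw'; apply: proportional_dot config_proportional _ _ _ _ _ _. Qed.

Let decL w : L w -> (exists x y z : vec 'I_6 R, w = wedge3 x y z) -> _ :=
  fun Lw Dw => wedge3_pluecker Dw (graph_dd (subL Lw)).

(** The relation is known for decomposable elements only; written bilinearly in (w, w'), it passes
    to all of L by [locally_spanned_by_transfer]. The next three relations are polarised in the same
    way. *)
Lemma config_rank1 w w' i j k l : L w -> L w' ->
  mm w i j * mm w' k l = mm w k j * mm w' i l.
Proof.
move=> Lw Lw'; apply/eqP; rewrite -subr_eq0; apply/eqP.
apply: (locally_spanned_by_transfer
  (Q := fun w w' => mm w i j * mm w' k l - mm w k j * mm w' i l) gL) => //.
- by move=> r x y; rewrite !mmZ; ring.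
- by move=> r x y; rewrite !mmZ; ring.
by move=> a La Da; have [-> _ _ _] := decL La Da; rewrite subrr.
Qed.

Lemma config_mnT w w' i k : L w -> L w' -> \sum_j mm w i j * nn w' k j = 0.
Proof.
move=> Lw Lw'; apply: (locally_spanned_by_transfer
  (Q := fun w w' => \sum_j mm w i j * nn w' k j) gL) => //.
- by move=> r x y; rewrite mulr_sumr; apply: eq_bigr => j _; rewrite mmZ mulrA.
- by move=> r x y; rewrite mulr_sumr; apply: eq_bigr => j _; rewrite nnZ mulrCA.
by move=> a La Da; have [_ -> _ _] := decL La Da.
Qed.

Lemma config_mTn w w' j k : L w -> L w' -> \sum_i mm w i j * nn w' i k = 0.
Proof.
move=> Lw Lw'; apply: (locally_spanned_by_transfer
  (Q := fun w w' => \sum_i mm w i j * nn w' i k) gL) => //.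
- by move=> r x y; rewrite mulr_sumr; apply: eq_bigr => i _; rewrite mmZ mulrA.
- by move=> r x y; rewrite mulr_sumr; apply: eq_bigr => i _; rewrite nnZ mulrCA.
by move=> a La Da; have [_ _ -> _] := decL La Da.
Qed.

Lemma config_cofp w w' i j : L w -> L w' ->
  cofp (nn w) (nn w') i j = cc w * mm w' i j.
Proof.
move=> Lw Lw'; apply/eqP; rewrite -subr_eq0; apply/eqP.
apply: (locally_spanned_by_transfer
  (Q := fun w w' => cofp (nn w) (nn w') i j - cc w * mm w' i j) gL) => //.
- by move=> r x y; rewrite /cofp !nnZ ccZ; ring.
- by move=> r x y; rewrite /cofp !nnZ mmZ; ring.
by move=> a La Da; have [_ _ _ ->] := decL La Da; rewrite subrr.
Qed.

Lemma point_pair_product x y : (point_pair L).1 x -> (point_pair L).2 y ->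
  exists2 w, L w & forall i j, mm w i j = x i * y j.
Proof.
have [L0 LD LZ] := sL.
move=> Xx Yy; move: x Xx; apply: lin_span_min => [|_ [w [j [Lw ->]]]] /=.
  split=> [|x x' [w Lw wE] [w' Lw' wE']|c x [w Lw wE]].
  - by exists 0 => // i j; rewrite mm0 vec0E mul0r.
  - by exists (w + w') => [|i j]; [exact: LD | rewrite mmD wE wE' vecDE mulrDl].
  - by exists (c *: w) => [|i j]; [exact: LZ | rewrite mmZ wE vecZE mulrA].
move: y Yy; apply: lin_span_min => [|_ [w' [k [Lw' ->]]]] /=.
  split=> [|x x' [w1 Lw1 wE] [w' Lw' wE']|c x [w1 Lw1 wE]].
  - by exists 0 => // i k; rewrite mm0 vec0E mulr0.
  - by exists (w1 + w') => [|i k]; [exact: LD | rewrite mmD wE wE' vecDE mulrDr].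
  - by exists (c *: w1) => [|i k]; [exact: LZ | rewrite mmZ wE vecZE mulrCA].
(* Column j of w times row k of w' has entries m_ij m'_kl, which equal m_kj m'_il by the rank one
   relation. *)
exists (mm w k j *: w') => [|i l]; first exact: LZ.
by rewrite mmZ mm_colE mm_rowE config_rank1.
Qed.

Lemma point_pair_projective : proj_space (point_pair L).1 /\ proj_space (point_pair L).2.
Proof.
split; apply/proj_spaceP; split; try exact: lin_span_submodule.
- move=> x x' Xx Xx' i j; move: x Xx.
  apply: (lin_span_min (L := [set x | x i * x' j = x j * x' i])).
    split=> [|x y /= xE yE|c x /= xE] /=; rewrite ?vec0E ?vecDE ?vecZE ?mul0r //.
      by rewrite !mulrDl xE yE.
    by rewrite -!mulrA xE.
  move=> _ [w [k [Lw ->]]]; move: x' Xx'.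
  apply: (lin_span_min (L := [set x' | _ * x' j = _ * x' i])).
    split=> [|x y /= xE yE|c x /= xE] /=; rewrite ?vec0E ?vecDE ?vecZE ?mulr0 //.
      by rewrite !mulrDr xE yE.
    by rewrite !(mulrCA _ c) xE.
  by move=> _ [w' [l [Lw' ->]]]; rewrite /= !mm_colE config_rank1.
- move=> J iJ sJ; apply: coL => // _ [w [i [j [Lw ->]]]]; apply: sJ.
  exists (mm_col w j), i; rewrite mm_colE; split=> //.
  by apply: sub_lin_span; exists w, j.
- move=> x x' Xx Xx' i j; move: x Xx.
  apply: (lin_span_min (L := [set x | x i * x' j = x j * x' i])).
    split=> [|x y /= xE yE|c x /= xE] /=; rewrite ?vec0E ?vecDE ?vecZE ?mul0r //.
      by rewrite !mulrDl xE yE.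
    by rewrite -!mulrA xE.
  move=> _ [w [k [Lw ->]]]; move: x' Xx'.
  apply: (lin_span_min (L := [set x' | _ * x' j = _ * x' i])).
    split=> [|x y /= xE yE|c x /= xE] /=; rewrite ?vec0E ?vecDE ?vecZE ?mulr0 //.
      by rewrite !mulrDr xE yE.
    by rewrite !(mulrCA _ c) xE.
  move=> _ [w' [l [Lw' ->]]]; rewrite /= !mm_rowE.
  by rewrite (config_mm k i l j) // mulrC config_rank1 // mulrC config_mm.
- move=> J iJ sJ; apply: coL => // _ [w [i [j [Lw ->]]]]; apply: sJ.
  exists (mm_row w i), j; rewrite mm_rowE; split=> //.
  by apply: sub_lin_span; exists w, i.
Qed.

Lemma point_pair_critical : critical (point_pair L).
Proof.
have [pX pY] := point_pair_projective; split=> // x y Xx Yy.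
have [w Lw wE] := point_pair_product Xx Yy.
have nE i j : phi (fun k l => x k * y l) i j = nn w i j.
  by rewrite (graph_nn (subL Lw)); apply: phi_ext => k l; rewrite wE.
split=> [i|j].
  under eq_bigr => j _ do rewrite nE.
  move: y Yy {wE nE}; apply: (lin_span_min (L := [set y | \sum_j nn w i j * y j = 0])).
    split=> [|y y' /= yE yE'|c y /= yE] /=.
    - by rewrite big1 // => j _; rewrite vec0E mulr0.
    - under eq_bigr => j _ do rewrite vecDE mulrDr.
      by rewrite big_split /= yE yE' addr0.
    - under eq_bigr => j _ do rewrite vecZE mulrCA.
      by rewrite -mulr_sumr yE mulr0.
  move=> _ [w' [k [Lw' ->]]] /=; rewrite -[RHS](config_mnT k i Lw' Lw).
  by apply: eq_bigr => j _; rewrite mm_rowE mulrC.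
under eq_bigr => i _ do rewrite nE.
move: x Xx {wE nE}; apply: (lin_span_min (L := [set x | \sum_i x i * nn w i j = 0])).
  split=> [|x x' /= xE xE'|c x /= xE] /=.
  - by rewrite big1 // => i _; rewrite vec0E mul0r.
  - under eq_bigr => i _ do rewrite vecDE mulrDl.
    by rewrite big_split /= xE xE' addr0.
  - under eq_bigr => i _ do rewrite vecZE -mulrA.
    by rewrite -mulr_sumr xE mulr0.
move=> _ [w' [k [Lw' ->]]] /=; rewrite -[RHS](config_mTn k j Lw' Lw).
by apply: eq_bigr => i _; rewrite mm_colE.
Qed.

Lemma point_pair_segre : segre u v (point_pair L) =
  [set a | exists2 w, L w & a = El 0 (fun _ _ => 0) (mm w) 0].
Proof.
have [L0 LD LZ] := sL.
apply/seteqP; split.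
  apply: lin_span_min => [|_ [x [y [Xx Yy ->]]]] /=; last first.
    have [w Lw wE] := point_pair_product Xx Yy; exists w => //.
    by rewrite segre_vecE; apply: El_ext.
  split=> [|a b [w Lw ->] [w' Lw' ->]|c a [w Lw ->]].
  - by exists 0 => //; rewrite -[LHS](El0 u v R); apply: El_ext => // i j; rewrite mm0.
  - exists (w + w'); first exact: LD.
    by rewrite ElD; apply: El_ext => // [|i j|i j|]; rewrite ?mmD ?addr0.
  - exists (c *: w); first exact: LZ.
    by rewrite ElZ; apply: El_ext => // [|i j|i j|]; rewrite ?mmZ ?mulr0.
move=> _ [w Lw ->].
pose a : ext R := El 0 (fun _ _ => 0) (mm w) 0.
have [s0 sD sZ] := lin_span_submodule
  [set a | exists x y, [/\ (point_pair L).1 x, (point_pair L).2 y & a = segre_vec u v x y]].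
rewrite -/a -[a]scale1r.
(* An entry (i, j) of the matrix of any w' in L, multiplied by the matrix of w, is the product of
   column j of w' and row i of w. Hence all such entries carry [a] into the Segre line, and they
   generate the unit ideal. *)
apply: (coL (J := [set r | segre u v (point_pair L) (r *: a)])) => [|_ [w' [i [j [Lw' ->]]]]] /=.
  split=> [|b c|c b] /=; first by rewrite scale0r; apply: s0.
    by rewrite scalerDl; apply: sD.
  by rewrite -scalerA; apply: sZ.
apply: sub_lin_span; exists (mm_col w' j), (mm_row w i); split.
- by apply: sub_lin_span; exists w', j.
- by apply: sub_lin_span; exists w, i.
rewrite segre_vecE ElZ; apply: El_ext => [|k l|k l|]; rewrite ?mulr0 //.
by rewrite mm_colE mm_rowE config_rank1.
Qed.

End Config.

(** The pair determines the module of the matrices m through its Segre image, then n = phi m, and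
    finally c by cof n = c m, because the entries of m generate the unit ideal. *)
Lemma point_pair_inj L L' : config L -> config L' -> point_pair L = point_pair L' -> L `<=` L'.
Proof.
move=> cL cL' eL w Lw.
have lift w1 : L w1 -> exists2 w', L' w' & mm w1 =2 mm w'.
  move=> Lw1; have : segre u v (point_pair L) (El 0 (fun _ _ => 0) (mm w1) 0).
    by rewrite point_pair_segre //; exists w1.
  rewrite eL point_pair_segre // => -[w' Lw' E]; exists w' => // i j.
  have /(congr1 (fun a => mm a i j)) := E; by rewrite !mm_El.
have [w' Lw' ww'] := lift _ Lw.
have [_ gL coL] := cL; have [_ gL' _] := cL'.
suff -> : w = w' by [].
apply: graph_inj => //; first exact: gL; first exact: gL'.
apply: (comaximal_eq coL) => _ [z [i [j [Lz ->]]]].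
have [z' Lz' zz'] := lift _ Lz.
rewrite ![mm z i j * _]mulrC -(config_cofp cL) // zz' -(config_cofp cL') //.
have nE a a' : L a -> L' a' -> mm a =2 mm a' -> nn a =2 nn a'.
  move=> La La' aa' p q; rewrite (graph_nn (gL _ La)) (graph_nn (gL' _ La')).
  exact: phi_ext.
by rewrite /cofp !(nE _ _ Lw Lw' ww') !(nE _ _ Lz Lz' zz').
Qed.

End OverAlgebra.
End Core.

(** * From Sing V_A to F - {u} *)

Section FromCritical.
Variables (K : fieldType) (u v : 3.-tuple (vec 'I_6 K)).
Hypothesis two_neq0 : 2%:R != 0 :> K.
Hypothesis spanning : forall x : vec 'I_6 K, exists g h : 'I_3 -> K,
  x = \sum_i g i *: tnth u i + \sum_i h i *: tnth v i.
Variable t : 'I_3 -> 'I_3 -> 'I_3 -> 'I_3 -> K.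

Local Notation cc := (cc u v).
Local Notation mm := (mm u v).
Local Notation El := (El u v).
Local Notation mm_col := (mm_col u v).
Local Notation mm_row := (mm_row u v).
Local Notation phi := (phi t).

Lemma graph_submodule (R : comAlgType K) : submodule (graph u v t (R := R)).
Proof.
split=> [|a b ga gb|c a ga].
- by rewrite /graph /= -[LHS](El0 u v R); apply: El_ext => [|i j|i j|];
    rewrite ?cc0 ?phi_mm0 ?mm0.
- rewrite /graph /= {1}ga {1}gb ElD addr0.
  by apply: El_ext => [|i j|i j|]; rewrite ?ccD ?phi_mmD ?mmD.
rewrite /graph /= {1}ga ElZ mulr0.
by apply: El_ext => [|i j|i j|]; rewrite ?ccZ ?phi_mmZ ?mmZ.
Qed.

Section Critical.
Variable R : comAlgType K.
Implicit Types (a b w : ext R) (m : 'I_3 -> 'I_3 -> R).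
Implicit Types (x y : vec 'I_3 R).
Variables X Y : set (vec 'I_3 R).
Hypothesis crit : critical t (X, Y).

Let sX : submodule X. Proof. by have [/proj_spaceP[]] := crit. Qed.
Let pX : proportional X. Proof. by have [/proj_spaceP[]] := crit. Qed.
Let cX : comaximal (entries X). Proof. by have [/proj_spaceP[]] := crit. Qed.
Let sY : submodule Y. Proof. by have [_ /proj_spaceP[]] := crit. Qed.
Let pY : proportional Y. Proof. by have [_ /proj_spaceP[]] := crit. Qed.
Let cY : comaximal (entries Y). Proof. by have [_ /proj_spaceP[]] := crit. Qed.

(** The candidate for the module of the matrices m, embedded with c = n = d = 0; it must be
    generated by products, as X and Y need not be free. *)
Let M := segre u v (X, Y).

Let M_submodule : submodule M. Proof. exact: lin_span_submodule. Qed.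

Let M_segre x y : X x -> Y y -> M (segre_vec u v x y).
Proof. by move=> Xx Yy; apply: sub_lin_span; exists x, y. Qed.

Let M_ind (P : set (ext R)) : submodule P ->
  (forall x y, X x -> Y y -> P (segre_vec u v x y)) -> M `<=` P.
Proof. by move=> sP Psegre; apply: lin_span_min => // _ [x [y [Xx Yy ->]]]; apply: Psegre. Qed.

Let mm_segre x y i j : mm (segre_vec u v x y) i j = x i * y j.
Proof. by rewrite segre_vecE mm_El. Qed.

Let M_El a : M a -> a = El 0 (fun _ _ => 0) (mm a) 0.
Proof.
move: a; apply: (M_ind (P := [set a | a = El 0 (fun _ _ => 0) (mm a) 0])).
  split=> [|a b aE bE|c a aE] /=.
  - by rewrite -[LHS](El0 u v R); apply: El_ext => // i j; rewrite mm0.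
  - rewrite {1}aE {1}bE ElD.
    by apply: El_ext => [|i j|i j|]; rewrite ?mmD ?addr0.
  - by rewrite {1}aE ElZ; apply: El_ext => [|i j|i j|]; rewrite ?mmZ ?mulr0.
move=> x y _ _ /=; rewrite {1}segre_vecE; apply: El_ext => // i j; exact/esym/mm_segre.
Qed.

Let M_comaximal : comaximal (mm_entries u v M).
Proof.
move=> J iJ sJ; apply: (comaximal_mul cX cY) => //.
move=> _ [_ [_ [[x [i [Xx ->]]] [y [j [Yy ->]]] ->]]]; apply: sJ.
by exists (segre_vec u v x y), i, j; rewrite mm_segre; split=> //; apply: M_segre.
Qed.

Let M_proportional a b : M a -> M b -> forall i j k l,
  mm a i j * mm b k l = mm b i j * mm a k l.
Proof.
move=> Ma Mb i j k l; move: a Ma.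
apply: (M_ind (P := [set a | mm a i j * mm b k l = mm b i j * mm a k l])).
  split=> [|a a' aE a'E|c a aE] /=; rewrite ?mm0 ?mmD ?mmZ ?mul0r ?mulr0 //.
    by rewrite mulrDl mulrDr aE a'E.
  by rewrite -mulrA aE mulrCA.
move=> x y Xx Yy /=; move: b Mb.
apply: (M_ind (P := [set b | mm _ i j * mm b k l = mm b i j * mm _ k l])).
  split=> [|a a' aE a'E|c a aE] /=; rewrite ?mm0 ?mmD ?mmZ ?mul0r ?mulr0 //.
    by rewrite mulrDl mulrDr aE a'E.
  by rewrite -mulrA -aE mulrCA.
move=> x' y' Xx' Yy' /=; rewrite !mm_segre mulrACA (pX Xx Xx') (pY Yy Yy').
by rewrite mulrACA mulrC.
Qed.

(* The left-hand side is symmetric in y and y', so that it vanishes as soon as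
   it does for y = y'. *)
Let phi_segre_col x y y' i : X x -> Y y -> Y y' ->
  \sum_j phi (fun k l => x k * y l) i j * y' j = 0.
Proof.
move=> Xx Yy Yy'.
have swap z z' : Y z -> Y z' -> \sum_j phi (fun k l => x k * z l) i j * z' j =
    \sum_j phi (fun k l => x k * z' l) i j * z j.
  move=> Yz Yz'; apply: eq_bigr => j _; rewrite !phi_mulr; apply: phi_ext => k l.
  by rewrite -!mulrA (pY Yz Yz') [z j * _]mulrC.
have [_ _ sing0] := crit; have [_ YD _] := sY.
apply: (two_regular two_neq0).
have [/(_ i) + _] := sing0 _ _ Xx (YD _ _ Yy Yy').
rewrite (_ : \sum_j _ = \sum_j phi (fun k l => x k * y l) i j * y j +
  \sum_j phi (fun k l => x k * y l) i j * y' j +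
  (\sum_j phi (fun k l => x k * y' l) i j * y j +
   \sum_j phi (fun k l => x k * y' l) i j * y' j)).
  have [/(_ i) -> _] := sing0 _ _ Xx Yy; have [/(_ i) -> _] := sing0 _ _ Xx Yy'.
  by rewrite -swap // add0r addr0 mulr_natl mulr2n.
rewrite -!big_split; apply: eq_bigr => j _ /=.
rewrite vecDE -mulrDr -mulrDr -mulrDl -phiD; congr (_ * _); apply: phi_ext => k l.
by rewrite vecDE mulrDr.
Qed.

Let phi_segre_row x x' y j : X x -> X x' -> Y y ->
  \sum_i x' i * phi (fun k l => x k * y l) i j = 0.
Proof.
move=> Xx Xx' Yy.
have swap z z' : X z -> X z' -> \sum_i z' i * phi (fun k l => z k * y l) i j =
    \sum_i z i * phi (fun k l => z' k * y l) i j.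
  move=> Xz Xz'; apply: eq_bigr => i _; rewrite ![_ * phi _ _ _]mulrC !phi_mulr.
  by apply: phi_ext => k l; rewrite mulrAC (pX Xz Xz') -mulrA mulrAC mulrA mulrAC mulrC mulrA.
have [_ _ sing0] := crit; have [_ XD _] := sX.
apply: (two_regular two_neq0).
have [_ /(_ j)] := sing0 _ _ (XD _ _ Xx Xx') Yy.
rewrite (_ : \sum_i _ = \sum_i x i * phi (fun k l => x k * y l) i j +
  \sum_i x' i * phi (fun k l => x k * y l) i j +
  (\sum_i x i * phi (fun k l => x' k * y l) i j +
   \sum_i x' i * phi (fun k l => x' k * y l) i j)).
  have [_ /(_ j) ->] := sing0 _ _ Xx Yy; have [_ /(_ j) ->] := sing0 _ _ Xx' Yy.
  by rewrite -swap // add0r addr0 mulr_natl mulr2n.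
rewrite -!big_split; apply: eq_bigr => i _ /=.
rewrite vecDE -mulrDl -mulrDl -mulrDr -phiD; congr (_ * _); apply: phi_ext => k l.
by rewrite vecDE mulrDl.
Qed.

Let M_col a y i : M a -> Y y -> \sum_j phi (mm a) i j * y j = 0.
Proof.
move=> Ma Yy; move: a Ma; apply: (M_ind (P := [set a | \sum_j phi (mm a) i j * y j = 0])).
  split=> [|a b /= aE bE|c a /= aE] /=.
  - by apply: big1 => j _; rewrite phi_mm0 mul0r.
  - under eq_bigr => j _ do rewrite phi_mmD mulrDl.
    by rewrite big_split /= aE bE addr0.
  - under eq_bigr => j _ do rewrite phi_mmZ -mulrA.
    by rewrite -mulr_sumr aE mulr0.
move=> x y' Xx Yy' /=; rewrite -[RHS](phi_segre_col i Xx Yy' Yy).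
by apply: eq_bigr => j _; congr (_ * _); apply: phi_ext => k l; rewrite mm_segre.
Qed.

Let M_row a x j : M a -> X x -> \sum_i x i * phi (mm a) i j = 0.
Proof.
move=> Ma Xx; move: a Ma; apply: (M_ind (P := [set a | \sum_i x i * phi (mm a) i j = 0])).
  split=> [|a b /= aE bE|c a /= aE] /=.
  - by apply: big1 => i _; rewrite phi_mm0 mulr0.
  - under eq_bigr => i _ do rewrite phi_mmD mulrDr.
    by rewrite big_split /= aE bE addr0.
  - under eq_bigr => i _ do rewrite phi_mmZ mulrCA.
    by rewrite -mulr_sumr aE mulr0.
move=> x' y Xx' Yy /=; rewrite -[RHS](phi_segre_row j Xx' Xx Yy).
by apply: eq_bigr => i _; congr (_ * _); apply: phi_ext => k l; rewrite mm_segre.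
Qed.

Let phi_prop a b : M a -> M b -> forall i j k l,
  phi (mm a) i j * phi (mm b) k l = phi (mm b) i j * phi (mm a) k l.
Proof.
move=> Ma Mb i j k l; rewrite !phi_mulr; apply: phi_ext => p q.
exact/phi_proportional/M_proportional.
Qed.

(** As phi m is killed by y on the right and by x on the left, the rows of the cofactor matrix are
    proportional to y and its columns to x; the matrix is therefore proportional to x y^T. *)
Let cofp_M a b c i j p q : M a -> M b -> M c ->
  cofp (phi (mm a)) (phi (mm b)) i j * mm c p q =
  cofp (phi (mm a)) (phi (mm b)) p q * mm c i j.
Proof.
move=> Ma Mb; move: c.
have := fun x Xx => cofp_col (phi_prop Ma Mb)
  (fun j => M_row (x := x) j Ma Xx) (fun j => M_row j Mb Xx).
have := fun y Yy => cofp_row (fun i => M_col (y := y) i Ma Yy) (fun i => M_col i Mb Yy).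
move: (cofp _ _) => N Nrow Ncol.
apply: (M_ind (P := [set c | N i j * mm c p q = N p q * mm c i j])).
  split=> [|a' b' /= aE bE|k a' /= aE] /=; first by rewrite !mm0 !mulr0.
    by rewrite !mmD !mulrDr aE bE.
  by rewrite !mmZ !(mulrCA _ k) aE.
move=> x y Xx Yy /=; rewrite !mm_segre !mulrA (Ncol x Xx i j p).
by rewrite mulrAC (Nrow y Yy p j q) mulrAC.
Qed.

(* The last condition is cof n = c m for n = phi m, polarised: it determines c
   because the entries of the elements of [M] generate the unit ideal. *)
Definition critical_lift : set (ext R) := [set w |
  [/\ graph u v t w, M (El 0 (fun _ _ => 0) (mm w) 0) &
    forall b, M b -> forall i j,
      cofp (phi (mm w)) (phi (mm b)) i j = cc w * mm b i j]].
Local Notation L := critical_lift.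

Let L_submodule : submodule L.
Proof.
have [g0 gD gZ] := graph_submodule R; have [M0 MD MZ] := M_submodule.
split=> [|w w' [gw Mw wE] [gw' Mw' w'E]|c w [gw Mw wE]].
- split=> //.
    rewrite (_ : El _ _ _ _ = 0) //.
    by rewrite -[RHS](El0 u v R); apply: El_ext => // i j; rewrite mm0.
  by move=> b Mb i j; rewrite cc0 mul0r /cofp !phi_mm0 !mul0r subr0.
- split; first exact: gD.
    rewrite (_ : El _ _ _ _ = El 0 (fun _ _ => 0) (mm w) 0 +
      El 0 (fun _ _ => 0) (mm w') 0); first exact: MD.
    by rewrite ElD; apply: El_ext => [|i j|i j|]; rewrite ?mmD ?addr0.
  move=> b Mb i j; rewrite ccD mulrDl -wE // -w'E //.
  by rewrite /cofp !phi_mmD; ring.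
- split; first exact: gZ.
    rewrite (_ : El _ _ _ _ = c *: El 0 (fun _ _ => 0) (mm w) 0); first exact: MZ.
    by rewrite ElZ; apply: El_ext => [|i j|i j|]; rewrite ?mmZ ?mulr0.
  move=> b Mb i j; rewrite ccZ -mulrA -wE //.
  by rewrite /cofp !phi_mmZ; ring.
Qed.

(** Existence of c. The ideal J consists of the possible denominators r of the quotient of cof n by
    m, and it contains the entries of all elements of M. *)
Let L_lift a : M a -> exists2 w, L w & mm w =2 mm a.
Proof.
move=> Ma; pose J : set R := [set r | exists c, forall b, M b -> forall i j,
  r * cofp (phi (mm a)) (phi (mm b)) i j = c * mm b i j].
have [||c cP] := M_comaximal (J := J).
- split=> [|r s [c cP] [d dP]|s r [c cP]].
  + by exists 0 => b _ i j; rewrite !mul0r.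
  + by exists (c + d) => b Mb i j; rewrite !mulrDl cP // dP.
  + by exists (s * c) => b Mb i j; rewrite -!mulrA cP.
(* With the entry (p, q) of b' as denominator, the numerator is the entry (p, q) of the cofactor
   polarised with the same b', by [cofp_M] and proportionality. *)
- move=> _ [b' [p [q [Mb' ->]]]]; exists (cofp (phi (mm a)) (phi (mm b')) p q) => b Mb i j.
  rewrite -cofp_M // mulrC /cofp !mulrBl -!mulrA.
  have E k l : phi (mm b) k l * mm b' p q = phi (mm b') k l * mm b p q.
    rewrite mulrC [RHS]mulrC; apply: phi_proportional.
    exact: M_proportional.
  by rewrite !E.
exists (El c (phi (mm a)) (mm a) 0) => [|i j]; last by rewrite mm_El.
split; first exact: graph_El.
  rewrite (_ : El _ _ _ _ = a) //; rewrite [RHS]M_El //.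
  by apply: El_ext => // i j; rewrite mm_El.
move=> b Mb i j; rewrite cc_El // -cP // mul1r /cofp.
have E k l : phi (mm (El c (phi (mm a)) (mm a) 0)) k l = phi (mm a) k l.
  by apply: phi_ext => p q; rewrite mm_El.
by rewrite !E.
Qed.

Let L_lift_segre x y : X x -> Y y ->
  exists2 w, L w & forall i j, mm w i j = x i * y j.
Proof.
move=> Xx Yy; have [w Lw wE] := L_lift (M_segre Xx Yy).
by exists w => // i j; rewrite wE mm_segre.
Qed.

Let L_comaximal : comaximal (mm_entries u v L).
Proof.
move=> J iJ sJ; apply: M_comaximal => // _ [a [i [j [Ma ->]]]].
by have [w Lw wE] := L_lift Ma; apply: sJ; exists w, i, j; rewrite wE.
Qed.

Let L_mm w w' i j k l : L w -> L w' ->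
  mm w i j * mm w' k l = mm w' i j * mm w k l.
Proof.
move=> [_ Mw _] [_ Mw' _]; have := M_proportional Mw Mw' i j k l.
by rewrite !mm_El.
Qed.

(** For the c-coordinates, both sides equal an entry of the cofactor polarised in w and w', which is
    symmetric because their images under phi are proportional. *)
Let L_scale w w' i j : L w -> L w' -> mm w i j *: w' = mm w' i j *: w.
Proof.
move=> Lw Lw'; have [g0 gD gZ] := graph_submodule R.
have [gw _ _] := Lw; have [gw' _ _] := Lw'.
apply: graph_inj => //; [exact: gZ | exact: gZ | |].
  have cof w1 w2 : L w1 -> L w2 -> cofp (phi (mm w1)) (phi (mm w2)) i j = cc w1 * mm w2 i j.
    move=> [_ _ w1E] [_ Mw2 _]; have := w1E _ Mw2 i j; rewrite mm_El // => <-.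
    by apply: cofp_ext => // p q; apply: phi_ext => k l; rewrite mm_El.
  rewrite !ccZ mulrC -cof // [RHS]mulrC -cof //; apply: cofpC => p q k l.
  rewrite !phi_mulr; apply: phi_ext => {}p {}q.
  by apply: phi_proportional => *; apply: L_mm.
by move=> k l; rewrite !mmZ L_mm.
Qed.

Let L_proportional : proportional L.
Proof.
move=> w w' Lw Lw' i j; apply/eqP; rewrite -subr_eq0; apply/eqP.
rewrite -[LHS]mul1r; set d := _ - _.
apply: (comaximal_radical L_comaximal (J := [set r | r * d = 0])).
  split=> [|a b aE bE|c a aE] /=; first by rewrite mul0r.
    by rewrite mulrDl aE bE addr0.
  by rewrite -mulrA aE mulr0.
(* Each factor of a 2 x 2 minor needs one r to become a multiple of b, whose own minors vanish;
   hence the exponent 2. *)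
move=> _ [b [k [l [Lb ->]]]]; exists 2%N => /=; set r := mm b k l.
have scal a p : L a -> r * a p = mm a k l * b p.
  by move=> La; have /ffunP/(_ p) := L_scale k l Lb La; rewrite !vecZE.
rewrite /d (_ : _ * _ = (r * w i) * (r * w' j) - (r * w j) * (r * w' i)); last ring.
by rewrite !scal //; ring.
Qed.

Lemma critical_lift_config : config u v t L.
Proof.
split=> [|w []//|//]; apply/locally_spanned_byP; split=> // J iJ sJ.
have [J0 JD JM] := iJ.
apply: (comaximal_radical (comaximal_mul cX cY) iJ).
(* The decomposable multiple supplied by [decomposable_El] is x_s^2 y_r w. Its m-entry at (s, r) is
   x_s^3 y_r^2, and one more factor y_r makes it the cube of x_s y_r. *)
move=> _ [_ [_ [[x [s [Xx ->]]] [y [r [Yy ->]]] ->]]]; exists 3%N.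
have [w Lw wE] := L_lift_segre Xx Yy; have [gw _ wcof] := Lw.
have [_ _ LZ] := L_submodule.
(* The auxiliary form f of [decomposable_El] is taken to be the s-th coordinate, so that f.x =
   x_s. *)
pose d (i : 'I_3) : R := (i == s)%:R.
have dx : dot3 d x = x s.
  rewrite /dot3 (bigD1 s) //= /d eqxx mul1r big1 ?addr0 // => i /negPf ->.
  by rewrite mul0r.
pose n := phi (fun k l => x k * y l).
have cofn i j : cofp n n i j = cc w * (x i * y j).
  have := wcof _ (M_segre Xx Yy) i j; rewrite mm_segre => <-.
  have E1 k l : phi (mm w) k l = n k l by apply: phi_ext.
  have E2 k l : phi (mm (segre_vec u v x y)) k l = n k l.
    by apply: phi_ext => p q; rewrite mm_segre.
  by rewrite /cofp !E1 !E2.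
have := decomposable_El u v two_neq0 d r
  (fun j => phi_segre_row j Xx Xx Yy) (fun i => phi_segre_col i Xx Yy Yy) cofn.
rewrite dx; set v1 := uv_vec _ _ _ _; set v2 := uv_vec _ _ _ _; set v3 := uv_vec _ _ _ _.
rewrite (_ : El _ _ _ _ = w); last first.
  by rewrite [RHS]gw; apply: El_ext => //; apply: phi_ext => k l; rewrite wE.
move=> dec; have Lz : L ((x s ^+ 2 * y r) *: w) by apply: LZ.
have /(JM (y r)) : J (mm ((x s ^+ 2 * y r) *: w) s r).
  apply: dot_in_ideal => // S; apply: sJ; exists ((x s ^+ 2 * y r) *: w), S.
  by split=> //; split=> //; exists v1, v2, v3.
by rewrite mmZ wE; congr J; ring.
Qed.

Lemma point_pair_critical_lift : point_pair u v L = (X, Y).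
Proof.
have [X0 XD XZ] := sX; have [Y0 YD YZ] := sY.
have Mcol a j : M a -> X (mm_col a j).
  move: a; apply: (M_ind (P := [set a | X (mm_col a j)])) => /=.
    split=> [|a b aX bX|c a aX] /=.
    - by rewrite mm_col0.
    - by rewrite mm_colD; apply: XD.
    - by rewrite mm_colZ; apply: XZ.
  move=> x y Xx Yy /=; rewrite (_ : mm_col _ _ = y j *: x); first exact: XZ.
  by apply/ffunP => i; rewrite vecZE mm_colE mm_segre mulrC.
have Mrow a i : M a -> Y (mm_row a i).
  move: a; apply: (M_ind (P := [set a | Y (mm_row a i)])) => /=.
    split=> [|a b aX bX|c a aX] /=.
    - by rewrite mm_row0.
    - by rewrite mm_rowD; apply: YD.
    - by rewrite mm_rowZ; apply: YZ.
  move=> x y Xx Yy /=; rewrite (_ : mm_row _ _ = x i *: y); first exact: YZ.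
  by apply/ffunP => j; rewrite vecZE mm_rowE mm_segre.
congr pair; apply/seteqP; split.
- apply: lin_span_min => // _ [w [j [[_ Mw _] ->]]]; have := Mcol _ j Mw.
  by congr X; apply/ffunP => i; rewrite !mm_colE mm_El.
(* Each y_j x is a column of a lift of x y^T, and the y_j generate the unit ideal. *)
- move=> x Xx; rewrite -[x]scale1r.
  have [s0 sD sZ] := lin_span_submodule (columns u v L).
  apply: (cY (J := [set r | lin_span (columns u v L) (r *: x)])) => [|_ [y [j [Yy ->]]]] /=.
    split=> [|a b aX bX|c a aX] /=; first by rewrite scale0r.
      by rewrite scalerDl; apply: sD.
    by rewrite -scalerA; apply: sZ.
  have [w Lw wE] := L_lift_segre Xx Yy; apply: sub_lin_span; exists w, j; split=> //.
  by apply/ffunP => i; rewrite vecZE mm_colE wE mulrC.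
- apply: lin_span_min => // _ [w [i [[_ Mw _] ->]]]; have := Mrow _ i Mw.
  by congr Y; apply/ffunP => j; rewrite !mm_rowE mm_El.
- move=> y Yy; rewrite -[y]scale1r.
  have [s0 sD sZ] := lin_span_submodule (rows u v L).
  apply: (cX (J := [set r | lin_span (rows u v L) (r *: y)])) => [|_ [x [i [Xx ->]]]] /=.
    split=> [|a b aX bX|c a aX] /=; first by rewrite scale0r.
      by rewrite scalerDl; apply: sD.
    by rewrite -scalerA; apply: sZ.
  have [w Lw wE] := L_lift_segre Xx Yy; apply: sub_lin_span; exists w, i; split=> //.
  by apply/ffunP => j; rewrite vecZE mm_rowE wE.
Qed.

End Critical.
End FromCritical.

(** * Base change, and the degree decomposition in a frame of W *)

Section Frame.
Variables (K : fieldType) (u v : 3.-tuple (vec 'I_6 K)).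
Hypothesis two_neq0 : 2%:R != 0 :> K.
Hypothesis spanning : forall x : vec 'I_6 K, exists g h : 'I_3 -> K,
  x = \sum_i g i *: tnth u i + \sum_i h i *: tnth v i.

Local Notation cc := (cc u v).
Local Notation nn := (nn u v).
Local Notation mm := (mm u v).
Local Notation dd := (dd u v).
Local Notation El := (El u v).
Local Notation mm_col := (mm_col u v).
Local Notation mm_row := (mm_row u v).

Section BaseChangePlanes.
Variables (R S : comAlgType K) (f : {lrmorphism R -> S}).

Lemma point_pair_base_change (L : set (ext R)) : point_pair u v (base_change f L) =
  (base_change f (point_pair u v L).1, base_change f (point_pair u v L).2).
Proof.
congr pair; rewrite /= base_change_span; apply/seteqP; split.
- apply: lin_span_min => [|_ [w [j [Lw ->]]]]; first exact: lin_span_submodule.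
  move: w Lw; apply: (base_change_min
    (M := [set w | lin_span (map_vec f @` columns u v L) (mm_col w j)])).
    have [s0 sD sZ] := lin_span_submodule (map_vec f @` columns u v L).
    split=> [|a b aX bX|c a aX] /=.
    - by rewrite mm_col0.
    - by rewrite mm_colD; apply: sD.
    - by rewrite mm_colZ; apply: sZ.
  move=> w Lw /=; apply: sub_lin_span; exists (mm_col w j); first by exists w, j.
  by apply/ffunP => i; rewrite mm_colE ffunE mm_colE mm_map_vec.
- apply: lin_span_min => [|_ [_ [w [j [Lw ->]]] <-]]; first exact: lin_span_submodule.
  apply: sub_lin_span; exists (map_vec f w), j; split; first exact: map_in_base_change.
  by apply/ffunP => i; rewrite mm_colE ffunE mm_colE mm_map_vec.
- apply: lin_span_min => [|_ [w [i [Lw ->]]]]; first exact: lin_span_submodule.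
  move: w Lw; apply: (base_change_min
    (M := [set w | lin_span (map_vec f @` rows u v L) (mm_row w i)])).
    have [s0 sD sZ] := lin_span_submodule (map_vec f @` rows u v L).
    split=> [|a b aX bX|c a aX] /=.
    - by rewrite mm_row0.
    - by rewrite mm_rowD; apply: sD.
    - by rewrite mm_rowZ; apply: sZ.
  move=> w Lw /=; apply: sub_lin_span; exists (mm_row w i); first by exists w, i.
  by apply/ffunP => j; rewrite mm_rowE ffunE mm_rowE mm_map_vec.
- apply: lin_span_min => [|_ [_ [w [i [Lw ->]]] <-]]; first exact: lin_span_submodule.
  apply: sub_lin_span; exists (map_vec f w), i; split; first exact: map_in_base_change.
  by apply/ffunP => j; rewrite mm_rowE ffunE mm_rowE mm_map_vec.
Qed.

End BaseChangePlanes.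

Section Parts.
Variable R : comAlgType K.
Implicit Types (a b : ext R) (c d : R) (m n : 'I_3 -> 'I_3 -> R).

(* For [e1, .., e4] in {0, 1}, the sum of the selected summands in the
   decomposition of the third exterior power of U (+) V by the degree in U. *)
Definition graded_part (e1 e2 e3 e4 : R) : set (ext R) := [set a | a =
  El (e1 * cc a) (fun i j => e2 * nn a i j) (fun i j => e3 * mm a i j) (e4 * dd a)].

Lemma graded_part_submodule e1 e2 e3 e4 : submodule (graded_part e1 e2 e3 e4).
Proof.
split=> [|a b aE bE|c a aE]; rewrite /graded_part /=.
- rewrite -[LHS](El0 u v R).
  by apply: El_ext => [|i j|i j|]; rewrite ?cc0 ?nn0 ?mm0 ?dd0 mulr0.
- rewrite {1}aE {1}bE ElD.
  by apply: El_ext => [|i j|i j|]; rewrite ?ccD ?nnD ?mmD ?ddD mulrDr.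
- rewrite {1}aE ElZ.
  by apply: El_ext => [|i j|i j|]; rewrite ?ccZ ?nnZ ?mmZ ?ddZ mulrCA.
Qed.

Lemma graded_part_El e1 e2 e3 e4 c n m d : e1 * c = c ->
  (forall i j, e2 * n i j = n i j) -> (forall i j, e3 * m i j = m i j) ->
  e4 * d = d -> graded_part e1 e2 e3 e4 (El c n m d).
Proof.
move=> cE nE mE dE; rewrite /graded_part /=.
by apply: El_ext => [|i j|i j|]; rewrite ?cc_El ?nn_El ?mm_El ?dd_El.
Qed.

Lemma from_base_wspan_min (P Q T : set (vec 'I_6 K)) (M : set (ext R)) :
  submodule M ->
  (forall x y z, P x -> Q y -> T z -> M (wedge3 (emb R x) (emb R y) (emb R z))) ->
  from_base R (wspan P Q T) `<=` M.
Proof.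
move=> sM wM; rewrite /from_base /wspan base_change_span; apply: lin_span_min => //.
move=> _ [_ [x [y [z [Px Qy Tz ->]]]] <-]; rewrite (map_vec_wedge3 (in_alg R)).
exact: wM.
Qed.

(** [graded_part 1 1 1 1] consists of the elements that equal [El] of their coordinates. As [ext R]
    is the whole exterior algebra this is a condition; it holds in degree three because [u] and [v]
    span W. *)
Lemma from_base_wspan_all :
  from_base R (wspan [set: vec 'I_6 K] [set: vec 'I_6 K] [set: vec 'I_6 K]) `<=`
  graded_part 1 1 1 1.
Proof.
apply: from_base_wspan_min => [|x y z _ _ _]; first exact: graded_part_submodule.
have [g1 [h1 ->]] := spanning_uv spanning (emb R x).
have [g2 [h2 ->]] := spanning_uv spanning (emb R y).
have [g3 [h3 ->]] := spanning_uv spanning (emb R z).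
by rewrite wedge3_uv //; apply: graded_part_El => *; rewrite mul1r.
Qed.

Let dot_emb_pairing (k : K) (b : ext K) a :
  dot (emb R (k *: pairing_vec b)) a = k%:A * top_coord (wedge a (emb R b)).
Proof.
rewrite {1}/emb (map_vecZ (in_alg R)) dotZl /= (map_pairing_vec (in_alg R)).
by rewrite dot_pairing_vec.
Qed.

Let volV (r : R) : (volume u v)%:A * ((volume u v)^-1%:A * r) = r.
Proof.
rewrite mulrA -scalerAl mul1r scalerA mulfV ?volume_neq0 //.
by rewrite scale1r mul1r.
Qed.

Lemma top_wedge_c a : top_coord (wedge a (emb R (basis_c u))) = - ((volume u v)%:A * dd a).
Proof. by rewrite ddE dot_emb_pairing scaleNr mulNr mulrN volV opprK. Qed.

Lemma top_wedge_n a i j :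
  top_coord (wedge a (emb R (basis_n u v i j))) = (volume u v)%:A * mm a i j.
Proof. by rewrite mmE dot_emb_pairing volV. Qed.

Lemma top_wedge_m a i j :
  top_coord (wedge a (emb R (basis_m u v i j))) = - ((volume u v)%:A * nn a i j).
Proof. by rewrite nnE dot_emb_pairing scaleNr mulNr mulrN volV opprK. Qed.

(** The symplectic form in coordinates. It turns isotropy of A into symmetry of phi, and a_1 /\ a_2
    into a quadratic form. *)
Lemma top_wedge_El a c n m : top_coord (wedge a (El c n m 0)) =
  (volume u v)%:A * (\sum_i \sum_j n i j * mm a i j -
                     \sum_i \sum_j m i j * nn a i j - c * dd a).
Proof.
have topD (b b' : ext R) : top_coord (b + b') = top_coord b + top_coord b'.
  exact: vecDE.
have topZ k (b : ext R) : top_coord (k *: b) = k * top_coord b by exact: vecZE.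
have topS (F : 'I_3 -> ext R) : top_coord (\sum_i F i) = \sum_i top_coord (F i).
  by rewrite !sum3E !topD.
have S (w : 'I_3 -> 'I_3 -> R) (B : 'I_3 -> 'I_3 -> ext R) k (r : 'I_3 -> 'I_3 -> R) :
    (forall i j, top_coord (wedge a (B i j)) = k * r i j) ->
    top_coord (wedge a (\sum_i \sum_j w i j *: B i j)) = k * \sum_i \sum_j w i j * r i j.
  move=> Br; rewrite wedge_sumr topS mulr_sumr; apply: eq_bigr => i _.
  rewrite wedge_sumr topS mulr_sumr; apply: eq_bigr => j _.
  by rewrite wedgeZr topZ Br mulrCA.
have topm i j : top_coord (wedge a (emb R (basis_m u v i j))) =
    - (volume u v)%:A * nn a i j by rewrite top_wedge_m mulNr.
rewrite ElE scale0r addr0 !wedgeDr !topD wedgeZr topZ top_wedge_c.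
rewrite (S _ _ _ _ (top_wedge_n a)) (S _ _ _ _ topm).
by move: (\sum_i _) (\sum_i _) (dd a) (_%:A) => A B d k; ring.
Qed.

End Parts.

Section Decomposition.
Variables U V : {vspace vec 'I_6 K}.
Hypotheses (hu : basis_of U u) (hv : basis_of V v).
Variable R : comAlgType K.
Implicit Types (a b : ext R) (c d : R) (m n : 'I_3 -> 'I_3 -> R).

Let emb_U x : x \in U -> exists g, emb R x = uv_vec u v g (fun=> 0).
Proof.
move=> xU; exists (fun i => (coord u i x)%:A).
rewrite {1}(coord_basis hu xU) /uv_vec [X in _ + X]big1 => [|i _]; last by rewrite scale0r.
rewrite addr0 {1}/emb (map_vec_sum (in_alg R)); apply: eq_bigr => i _.
by rewrite (map_vecZ (in_alg R)) (tnth_nth 0).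
Qed.

Let emb_V x : x \in V -> exists h, emb R x = uv_vec u v (fun=> 0) h.
Proof.
move=> xV; exists (fun i => (coord v i x)%:A).
rewrite {1}(coord_basis hv xV) /uv_vec [X in X + _]big1 => [|i _]; last by rewrite scale0r.
rewrite add0r {1}/emb (map_vec_sum (in_alg R)); apply: eq_bigr => i _.
by rewrite (map_vecZ (in_alg R)) (tnth_nth 0).
Qed.

Let uU i : tnth u i \in U. Proof. exact/(basis_mem hu)/mem_tnth. Qed.
Let vV i : tnth v i \in V. Proof. exact/(basis_mem hv)/mem_tnth. Qed.

Let wedge3_in_wspan (P Q T : {vspace vec 'I_6 K}) x y z :
  x \in P -> y \in Q -> z \in T ->
  from_base R (wspan [set` P] [set` Q] [set` T]) (emb R (wedge3 x y z)).
Proof.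
move=> xP yQ zT; apply: (map_in_base_change (in_alg R)); apply: sub_lin_span.
by exists x, y, z.
Qed.

Let cross0l (h : 'I_3 -> R) i : cross (fun=> 0) h i = 0.
Proof. by rewrite /cross !mul0r subr0. Qed.
Let cross0r (h : 'I_3 -> R) i : cross h (fun=> 0) i = 0.
Proof. by rewrite /cross !mulr0 subr0. Qed.
Let det3_0 (f g : 'I_3 -> R) : det3 f g (fun=> 0) = 0.
Proof. by rewrite /det3 /dot3 big1 // => i _; rewrite cross0r mulr0. Qed.
Let det30 (f g : 'I_3 -> R) : det3 (fun=> 0) f g = 0.
Proof. by rewrite /det3 /dot3 big1 // => i _; rewrite mul0r. Qed.

Let simp := (cross0l, cross0r, det3_0, det30, mul0r, mulr0, addr0, add0r, mul1r).

Lemma from_base_cube : from_base R (wedge_cube U) = graded_part 1 0 0 0.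
Proof.
apply/seteqP; split.
  apply: from_base_wspan_min => [|x y z xU yU zU]; first exact: graded_part_submodule.
  have [g1 ->] := emb_U xU; have [g2 ->] := emb_U yU; have [g3 ->] := emb_U zU.
  by rewrite wedge3_uv //; apply: graded_part_El => *; rewrite ?simp.
move=> a ->; rewrite ElE !(mul0r, mul1r) scale0r addr0.
rewrite [X in _ + X]big1 => [|i _]; last by apply: big1 => j _; rewrite mul0r scale0r.
rewrite [X in _ + X + _]big1 => [|i _]; last by apply: big1 => j _; rewrite mul0r scale0r.
rewrite !addr0; have [_ _] := lin_span_submodule (map_vec (in_alg R) @` wedge_cube U).
by apply; apply: wedge3_in_wspan.
Qed.

Lemma from_base_UUV :
  from_base R (wspan [set` U] [set` U] [set` V]) = graded_part 0 1 0 0.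
Proof.
apply/seteqP; split.
  apply: from_base_wspan_min => [|x y z xU yU zV]; first exact: graded_part_submodule.
  have [g1 ->] := emb_U xU; have [g2 ->] := emb_U yU; have [h3 ->] := emb_V zV.
  by rewrite wedge3_uv //; apply: graded_part_El => *; rewrite ?simp.
move=> a ->; rewrite ElE !mul0r !scale0r addr0 add0r.
rewrite [X in _ + X]big1 => [|i _]; last by apply: big1 => j _; rewrite mul0r scale0r.
have sub := lin_span_submodule (map_vec (in_alg R) @` wspan [set` U] [set` U] [set` V]).
have [_ _ sZ] := sub.
rewrite addr0; apply: (submodule_sum sub) => i; apply: (submodule_sum sub) => j.
by apply: sZ; apply: wedge3_in_wspan.
Qed.

Lemma from_base_UVV :
  from_base R (wspan [set` U] [set` V] [set` V]) = graded_part 0 0 1 0.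
Proof.
apply/seteqP; split.
  apply: from_base_wspan_min => [|x y z xU yV zV]; first exact: graded_part_submodule.
  have [g1 ->] := emb_U xU; have [h2 ->] := emb_V yV; have [h3 ->] := emb_V zV.
  by rewrite wedge3_uv //; apply: graded_part_El => *; rewrite ?simp.
move=> a ->; rewrite ElE !mul0r !scale0r addr0 add0r.
rewrite [X in X + _]big1 => [|i _]; last by apply: big1 => j _; rewrite mul0r scale0r.
have sub := lin_span_submodule (map_vec (in_alg R) @` wspan [set` U] [set` V] [set` V]).
have [_ _ sZ] := sub.
rewrite add0r; apply: (submodule_sum sub) => i; apply: (submodule_sum sub) => j.
by apply: sZ; apply: wedge3_in_wspan.
Qed.

(** The graded parts are independent, so the components can only be those read off from the
    coordinates of [a]; the last condition puts [a] in degree three. *)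
Lemma decomposesP a a1 a2 a3 : decomposes U V a a1 a2 a3 <->
  [/\ dd a = 0, a1 = El 0 (fun _ _ => 0) (mm a) 0, a2 = El 0 (nn a) (fun _ _ => 0) 0,
      a3 = El (cc a) (fun _ _ => 0) (fun _ _ => 0) 0 & graded_part 1 1 1 1 a].
Proof.
rewrite /decomposes from_base_cube from_base_UUV from_base_UVV /graded_part /=.
split=> [[E1 E2 E3 E]|[d0 -> -> -> E]].
  have {}E1 : a1 = El 0 (fun _ _ => 0) (mm a1) 0.
    by rewrite {1}E1; apply: El_ext => [|i j|i j|]; rewrite ?simp.
  have {}E2 : a2 = El 0 (nn a2) (fun _ _ => 0) 0.
    by rewrite {1}E2; apply: El_ext => [|i j|i j|]; rewrite ?simp.
  have {}E3 : a3 = El (cc a3) (fun _ _ => 0) (fun _ _ => 0) 0.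
    by rewrite {1}E3; apply: El_ext => [|i j|i j|]; rewrite ?simp.
  have aE : a = El (cc a3) (nn a2) (mm a1) 0.
    by rewrite E E1 E2 E3 !ElD; apply: El_ext => [|i j|i j|]; rewrite ?cc_El ?nn_El ?mm_El ?simp.
  have d0 : dd a = 0 by rewrite aE dd_El.
  split=> //.
  - by rewrite E1; apply: El_ext => // i j; rewrite aE !mm_El.
  - by rewrite E2; apply: El_ext => // i j; rewrite aE !nn_El.
  - by rewrite E3; apply: El_ext => //; rewrite aE !cc_El.
  - by rewrite {1}aE; apply: El_ext => [|i j|i j|]; rewrite aE ?cc_El ?nn_El ?mm_El ?dd_El // mul1r.
split; try by apply: El_ext => [|i j|i j|]; rewrite ?cc_El ?nn_El ?mm_El ?dd_El ?simp.
rewrite {1}E !ElD; apply: El_ext => [|i j|i j|]; rewrite ?simp //.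
Qed.

Lemma project_config t (L : set (ext R)) : config u v t L ->
  project U V L = segre u v (point_pair u v L).
Proof.
move=> cL; rewrite (point_pair_segre two_neq0 spanning cL).
have [_ gL _] := cL; apply/seteqP; split.
  by move=> _ [a [a2 [a3 [La /decomposesP[_ -> _ _ _]]]]]; exists a.
move=> _ [a La ->]; exists a, (El 0 (nn a) (fun _ _ => 0) 0),
  (El (cc a) (fun _ _ => 0) (fun _ _ => 0) 0); split=> //; apply/decomposesP.
have ga := gL _ La; split=> //; first exact: (graph_dd two_neq0 spanning ga).
rewrite /graded_part /= {1}ga; apply: El_ext => [|i j|i j|]; rewrite mul1r //.
  by rewrite (graph_nn two_neq0 spanning ga).
by rewrite (graph_dd two_neq0 spanning ga).
Qed.

End Decomposition.
End Frame.

(** * The Lagrangian space as a graph *)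

Section DualNumbers.
Variable K : fieldType.
Local Notation D := (dual_numbers K).

Definition dual_eps : D := qpoly.in_qpoly 'X^2 'X.

Let epsE : (dual_eps : {poly K}) = 'X.
Proof. by rewrite qpoly.in_qpoly_small // qpoly.mk_monic_Xn size_polyX size_polyXn. Qed.

Lemma dual_eps_sqr : dual_eps * dual_eps = 0.
Proof.
apply: val_inj; suff E : polydiv.Pdiv.CommonRing.rmodp
    ((dual_eps : {poly K}) * dual_eps) (qpoly.mk_monic 'X^2) = 0 by exact: E.
rewrite epsE qpoly.mk_monic_Xn -expr2.
by rewrite polydiv.Pdiv.RingMonic.rmodpp ?monicXn.
Qed.

Lemma dual_eps_scale_eq0 (k : K) : k *: dual_eps = 0 -> k = 0.
Proof.
move=> /(congr1 (fun x : D => (x : {poly K})`_1)).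
rewrite [LHS](_ : _ = (k *: (dual_eps : {poly K}))`_1) //.
by rewrite epsE coefZ coefX coef0 mulr1.
Qed.

Lemma dual_aug_is_zmod_morphism : zmod_morphism (@dual_aug K).
Proof. by move=> x y; rewrite /dual_aug coefB. Qed.

Lemma dual_aug_is_monoid_morphism : monoid_morphism (@dual_aug K).
Proof.
split=> [|x y]; first by rewrite /dual_aug coef1.
suff E (p : {poly K}) :
    (polydiv.Pdiv.CommonRing.rmodp p (qpoly.mk_monic 'X^2))`_0 = p`_0.
  by rewrite /dual_aug -coef0M; apply: E.
rewrite qpoly.mk_monic_Xn [in RHS](polydiv.Pdiv.RingMonic.rdivp_eq (monicXn K 2) p).
by rewrite coefD coefMXn add0r.
Qed.

HB.instance Definition _ :=
  GRing.isZmodMorphism.Build D K (@dual_aug K) dual_aug_is_zmod_morphism.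
HB.instance Definition _ :=
  GRing.isMonoidMorphism.Build D K (@dual_aug K) dual_aug_is_monoid_morphism.

Lemma dual_aug_eps : dual_aug dual_eps = 0.
Proof. by rewrite /dual_aug epsE coefX. Qed.

Lemma dual_aug_scalar (k : K) : dual_aug k%:A = k.
Proof. by rewrite /dual_aug /= coefZ coef1 mulr1. Qed.

End DualNumbers.

Section Frames.
Variables (K : fieldType) (U V : {vspace vec 'I_6 K}) (u v : 3.-tuple (vec 'I_6 K)).

Lemma spanning_of_bases : basis_of U u -> basis_of V v -> (U + V)%VS = fullv ->
  forall x : vec 'I_6 K, exists g h : 'I_3 -> K,
    x = \sum_i g i *: tnth u i + \sum_i h i *: tnth v i.
Proof.
move=> hu hv UV x; have := memvf x; rewrite -UV => /memv_addP[y yU [z zV ->]].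
exists (fun i => coord u i y), (fun i => coord v i z).
rewrite {1}(coord_basis hu yU) {1}(coord_basis hv zV).
by congr (_ + _); apply: eq_bigr => i _; rewrite (tnth_nth 0).
Qed.

End Frames.

(** * F as a linear section of the Grassmannian, and its tangent space at u *)

Section LinearSection.
Variables (K : fieldType) (A : {vspace ext K}).

Lemma emb_id (I : finType) (x : vec I K) : emb (K^o : comAlgType K) x = x.
Proof. by apply/ffunP => i; rewrite ffunE /=; apply: mulr1. Qed.

Lemma from_base_sub (I : finType) (R S : comAlgType K) (f : {lrmorphism R -> S})
    (X : set (vec I K)) (L : set (vec I R)) :
  L `<=` from_base R X -> base_change f L `<=` from_base S X.
Proof.
move=> LX; have sub := lin_span_submodule (map_vec (in_alg S) @` X).
apply: base_change_min => // w /LX; move: w.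
apply: (base_change_min (M := [set w | from_base S X (map_vec f w)])).
  have [s0 sD sZ] := sub.
  split=> [|a b aX bX|c a aX] /=; first by rewrite map_vec0.
    by rewrite map_vecD; apply: sD.
  by rewrite map_vecZ; apply: sZ.
move=> w Xw /=; rewrite -/(emb R w) (map_vec_emb f).
exact: (map_in_base_change (in_alg S)).
Qed.

Lemma from_base_vspace (w : ext K) :
  from_base (K^o : comAlgType K) [set` A] w -> w \in A.
Proof.
move: w; apply: (@base_change_min _ _ (in_alg (K^o : comAlgType K)) _ _
  ([set w | w \in A] : set (ext K))) => [|w wA] /=.
  by split=> [|x y xA yA|c x xA] /=; [apply: mem0v | apply: memvD | apply: memvZ].
by have := emb_id w; rewrite /emb => ->.
Qed.

Lemma from_base_isotropic (R : comAlgType K) :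
  (forall a b, a \in A -> b \in A -> top_coord (wedge a b) = 0) ->
  forall a b, from_base R [set` A] a -> from_base R [set` A] b ->
    top_coord (wedge a b) = 0.
Proof.
move=> isoA a b Aa Ab; move: a Aa.
apply: (base_change_min (M := [set a : ext R | top_coord (wedge a b) = 0])).
  split=> [|x y /= xE yE|c x /= xE] /=; rewrite /top_coord.
  - by rewrite wedge0l vec0E.
  - rewrite /top_coord in xE yE; by rewrite wedgeDl vecDE xE yE addr0.
  - rewrite /top_coord in xE; by rewrite wedgeZl vecZE xE mulr0.
move=> a aA /=; move: b Ab.
apply: (base_change_min (M := [set b : ext R | top_coord (wedge _ b) = 0])).
  split=> [|x y /= xE yE|c x /= xE] /=; rewrite /top_coord.
  - by rewrite wedge0r vec0E.
  - rewrite /top_coord in xE yE; by rewrite wedgeDr vecDE xE yE addr0.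
  - rewrite /top_coord in xE; by rewrite wedgeZr vecZE xE mulr0.
move=> b bA /=; rewrite -(map_vec_wedge (in_alg R)) /top_coord ffunE.
by have := isoA _ _ aA bA; rewrite /top_coord => ->; rewrite rmorph0.
Qed.

Variable F : subfunctor K {set 'I_6}.
Hypotheses (hF : morin_configuration F) (hA : lagrangian A) (hspan : linear_span F A).

(** Two planes whose Pluecker vectors lie in A have wedge product 0, so a plane in P(A) satisfies
    all the conditions sigma_e with e in F, and the Morin property puts it in F. *)
Lemma morin_linear_section (R : comAlgType K) (L : set (ext R)) :
  F L <-> grass L /\ L `<=` from_base R [set` A].
Proof.
have [_ FE] := hF; have [FA _] := hspan; have [_ _ isoA] := hA.
split=> [FL|[gL LA]]; first by have [gL _] := (FE R L).1 FL; have [] := FA R L FL.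
apply/FE; split=> // S f e Fe; have [_ eA] := FA S e Fe; split.
  rewrite /grass /=; apply: (base_change_locally_spanned_by (f := f) _ gL).
  move=> _ [x [y [z ->]]].
  by exists (map_vec f x), (map_vec f y), (map_vec f z); apply: (map_vec_wedge3 f).
move=> a b ea Lb; apply: from_base_isotropic => //; first exact: eA.
exact: (from_base_sub LA Lb).
Qed.

End LinearSection.

(** The vectors are u_k + e sum_j n_kj v_j; since e^2 = 0, only terms with at most one factor from V
    survive. *)
Lemma decomposable_tangent (K : fieldType) (u v : 3.-tuple (vec 'I_6 K)) (R : comAlgType K)
    (e : R) (n : 'I_3 -> 'I_3 -> R) : 2%:R != 0 :> K -> e * e = 0 ->
  exists x y z, El u v 1 (fun i j => e * n i j) (fun _ _ => 0) 0 = wedge3 x y z.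
Proof.
move=> two_neq0 e2.
pose w k : vec 'I_6 R := uv_vec u v (fun i => (i == k)%:R) (fun j => e * n k j).
exists (w 0), (w 1), (w (1 + 1)); rewrite (wedge3_uv u v two_neq0).
have ee x y : e * x * (e * y) = 0 by rewrite mulrACA e2 mul0r.
have c0 k l j : cross (fun j => e * n k j) (fun j => e * n l j) j = 0.
  by rewrite /cross !ee subr0.
apply: El_ext => [|i j|i j|].
- by rewrite /det3 /dot3 sum3E /cross /=; ring.
- by case: (ord3P i) => ->; rewrite /cross /=; ring.
- by rewrite !c0 !mulr0 !addr0.
- by rewrite /det3 /dot3 big1 // => i _; rewrite c0 mulr0.
Qed.

Section Tangent.
Variables (K : fieldType) (U V : {vspace vec 'I_6 K}) (u v : 3.-tuple (vec 'I_6 K)).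
Hypothesis two_neq0 : 2%:R != 0 :> K.
Hypotheses (hu : basis_of U u) (hv : basis_of V v) (hW : (U + V)%VS = fullv).
Variables (A : {vspace ext K}) (F : subfunctor K {set 'I_6}).
Hypotheses (hF : morin_configuration F) (hA : lagrangian A) (hspan : linear_span F A).
Hypothesis hsmooth : finite_smooth_at F (wedge_cube U).

Let spanning := spanning_of_bases hu hv hW.

Local Notation El := (El u v).

Lemma basis_c_cube : wedge_cube U (basis_c u).
Proof.
apply: sub_lin_span; exists (tnth u 0), (tnth u 1), (tnth u (1 + 1)).
by split=> //; apply/(basis_mem hu)/mem_tnth.
Qed.

Lemma basis_c_in : basis_c u \in A.
Proof.
have [FU _] := hsmooth; have [_ sub] := (morin_linear_section hF hA hspan _).1 FU.
exact/from_base_vspace/sub/basis_c_cube.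
Qed.

(** d is the pairing with u up to a scalar, and A is isotropic and contains u. *)
Lemma coord_d_eq0 a : a \in A -> dot (coord_d u v) a = 0.
Proof.
move=> aA; have [_ _ iso] := hA.
by rewrite /coord_d dotZl dot_pairing_vec iso ?mulr0 ?basis_c_in.
Qed.

Lemma emb_El (R : comAlgType K) a : a \in A -> emb R a =
  El (dot (coord_c u v) a)%:A (fun i j => (dot (coord_n u v i j) a)%:A)
     (fun i j => (dot (coord_m u v i j) a)%:A) 0.
Proof.
move=> aA; have [sub _ _] := hA.
have := from_base_wspan_all two_neq0 spanning
  (map_in_base_change (in_alg R) (sub _ aA)).
rewrite /graded_part /= -/(emb R a) => {1}->.
by apply: El_ext => [|i j|i j|]; rewrite mul1r ?cc_emb ?nn_emb ?mm_emb ?dd_emb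
  ?coord_d_eq0 // scale0r.
Qed.

Lemma cube_line x : wedge_cube U x -> exists k, x = k *: basis_c u.
Proof.
move=> Ux; have := map_in_base_change (in_alg (K^o : comAlgType K)) Ux.
rewrite -/(from_base (K^o : comAlgType K) (wedge_cube U)).
rewrite (from_base_cube two_neq0 spanning hu) /graded_part /= -/(emb (K^o : comAlgType K) x).
set c := cc u v _ => E; exists c; rewrite -[LHS]emb_id E.
transitivity (El c (fun _ _ => 0) (fun _ _ => 0) 0); last by rewrite El_c emb_id.
by apply: El_ext => [|i j|i j|]; rewrite ?mul0r ?mul1r.
Qed.

(* For e^2 = 0 this is the plane u + e a; [smooth_tangent] takes e in the dual
   numbers. *)
Lemma tangent_point (R : comAlgType K) (e : R) a : e * e = 0 -> a \in A ->
  (forall i j, dot (coord_m u v i j) a = 0) ->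
  F (lin_span [set El 1 (fun i j => e * (dot (coord_n u v i j) a)%:A)
                      (fun _ _ => 0) 0]).
Proof.
move=> e2 aA ma0; set z := El _ _ _ _.
have zA : from_base R [set` A] z.
  have [_ sD sZ] := lin_span_submodule (map_vec (in_alg R) @` [set` A]).
  (* The coefficient of u offsets the c-coordinate of e a, so that the sum has c = 1 exactly. *)
  have -> : z = (1 - e * (dot (coord_c u v) a)%:A) *: emb R (basis_c u) + e *: emb R a.
    rewrite (emb_El R aA) -(El_c u v) ElZ ElD; apply: El_ext => [|i j|i j|].
    - by ring.
    - by rewrite add0r.
    - by rewrite ma0 scale0r mulr0 addr0.
    - by rewrite mulr0 addr0.
  apply: sD; apply: sZ; apply: (map_in_base_change (in_alg R)) => //.
  exact: basis_c_in.
have cz : dot (emb R (coord_c u v)) z = 1 by apply: cc_El.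
apply/(morin_linear_section hF hA hspan); split; last first.
  by apply: lin_span_min => [|_ -> //]; apply: lin_span_submodule.
split; first exact: lin_span_submodule.
exists 1%N, (fun=> z), (fun=> emb R (coord_c u v)); split.
- by move=> _; apply: sub_lin_span.
- by move=> _; apply: decomposable_tangent.
- by rewrite big_ord1.
move=> _; apply: (lin_span_min
  (L := [set w | dot (emb R (coord_c u v)) z *: w = dot (emb R (coord_c u v)) w *: z])).
  split=> [|x y /= xE yE|c x /= xE] /=; first by rewrite dot0r scaler0 scale0r.
    by rewrite scalerDr xE yE dotDr scalerDl.
  by rewrite scalerA mulrC -scalerA xE scalerA dotZr.
by move=> w ->.
Qed.

Let cube_nn (R : comAlgType K) c n m d :
  from_base R (wedge_cube U) (El c n m d) -> forall i j, n i j = 0.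
Proof.
rewrite (from_base_cube two_neq0 spanning hu) /graded_part /= => E i j.
have := congr1 (fun w => nn u v w i j) E; rewrite !nn_El // mul0r.
exact.
Qed.

(** An element of A with m = 0 is a tangent vector of F at u: it gives the point u + eps a of F over
    the dual numbers. By smoothness this point is constant, so n = 0 and only c is left. *)
Lemma smooth_tangent a : a \in A -> (forall i j, dot (coord_m u v i j) a = 0) ->
  a = dot (coord_c u v) a *: basis_c u.
Proof.
move=> aA ma0.
pose D := dual_numbers K; pose e : D := dual_eps K.
pose n i j := dot (coord_n u v i j) a.
pose z : ext D := El 1 (fun i j => e * (n i j)%:A) (fun _ _ => 0) 0.
have FL : F (lin_span [set z]) := tangent_point (dual_eps_sqr K) aA ma0.
have augz : map_vec (@dual_aug K) z = basis_c u.
  rewrite /z El_nc map_vecD map_vecZ map_vec_sum rmorph1 scale1r.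
  rewrite big1 => [|i _]; last first.
    rewrite map_vec_sum big1 // => j _.
    by rewrite map_vecZ rmorphM /= dual_aug_eps mul0r scale0r.
  by rewrite addr0; apply/ffunP => S; rewrite !ffunE /= dual_aug_scalar.
have augL : base_change (@dual_aug K) (lin_span [set z]) = wedge_cube U.
  rewrite base_change_span; apply/seteqP; split.
    apply: lin_span_min => [|_ [_ -> <-]]; first exact: lin_span_submodule.
    by rewrite augz; apply: basis_c_cube.
  move=> x /cube_line[k ->].
  have [_ _ sZ] := lin_span_submodule (map_vec (@dual_aug K) @` [set z]).
  by apply: sZ; apply: sub_lin_span; exists z.
have [_ /(_ _ FL augL) LE] := hsmooth.
have n0 i j : n i j = 0.
  have : from_base D (wedge_cube U) z by rewrite -LE; apply: sub_lin_span.
  by move/cube_nn/(_ i j); rewrite mulr_algr => /dual_eps_scale_eq0.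
have := emb_El (K^o : comAlgType K) aA; rewrite emb_id => {1}->.
rewrite [LHS](_ : _ = El (dot (coord_c u v) a)%:A (fun _ _ => 0) (fun _ _ => 0) 0).
  by rewrite El_c emb_id; congr (_ *: _); apply: mulr1.
apply: El_ext => [//|i j|i j|//]; first by rewrite [dot _ _](n0 i j) scale0r.
by rewrite ma0 scale0r.
Qed.

End Tangent.

Lemma sum_delta (R : comNzRingType) (m : 'I_3 -> 'I_3 -> R) i j :
  \sum_k \sum_l m k l * ((k == i) && (l == j))%:R = m i j.
Proof.
rewrite (bigD1 i) //= [X in _ + X]big1 ?addr0 => [|k /negPf ki]; last first.
  by apply: big1 => l _; rewrite ki mulr0.
rewrite (bigD1 j) //= big1 ?addr0 => [|l /negPf lj]; first by rewrite !eqxx mulr1.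
by rewrite lj andbF mulr0.
Qed.

Lemma sum_scaled_delta (K : fieldType) (R : comAlgType K) (m : 'I_3 -> 'I_3 -> R) i j :
  \sum_k \sum_l m k l * ((k == i) && (l == j))%:R%:A = m i j.
Proof.
rewrite -[RHS]sum_delta; apply: eq_bigr => k _; apply: eq_bigr => l _.
by case: (_ && _); rewrite ?scale1r ?scale0r.
Qed.

Section GraphOfA.
Variables (K : fieldType) (U V : {vspace vec 'I_6 K}) (u v : 3.-tuple (vec 'I_6 K)).
Hypothesis two_neq0 : 2%:R != 0 :> K.
Hypotheses (hu : basis_of U u) (hv : basis_of V v) (hW : (U + V)%VS = fullv).
Variables (A : {vspace ext K}) (F : subfunctor K {set 'I_6}).
Hypotheses (hF : morin_configuration F) (hA : lagrangian A) (hspan : linear_span F A).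
Hypothesis hsmooth : finite_smooth_at F (wedge_cube U).

Let spanning := spanning_of_bases hu hv hW.

Local Notation El := (El u v).

Let mm_mx (a : ext K) : 'M[K]_3 := \matrix_(i, j) dot (coord_m u v i j) a.

Let mm_mx_linear : linear mm_mx.
Proof. by move=> k a b; apply/matrixP => i j; rewrite !mxE dotDr dotZr. Qed.

HB.instance Definition _ := GRing.isLinear.Build K (ext K) 'M[K]_3 *:%R mm_mx mm_mx_linear.

(** By [smooth_tangent] the elements of A with m = 0 form at most a line; as dim A = 10 = 1 + 9, the
    map m sends A onto all 3 x 3 matrices. *)
Lemma mm_lift k l : exists a, a \in A /\
  forall i j, dot (coord_m u v i j) a = ((i == k) && (j == l))%:R.
Proof.
pose f := linfun mm_mx.
have kerA : (A :&: lker f <= <[basis_c u]>)%VS.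
  apply/subvP => a /memv_capP[aA]; rewrite memv_ker lfunE /= => /eqP fa0.
  apply/vlineP; exists (dot (coord_c u v) a).
  apply: (smooth_tangent two_neq0 hu hv hW hF hA hspan hsmooth aA) => i j.
  by have /matrixP/(_ i j) := fa0; rewrite !mxE.
have imA : (f @: A)%VS = fullv.
  apply/eqP; rewrite eqEdim subvf dimvf /=; have [_ dimA _] := hA.
  have le1 : (\dim (A :&: lker f) <= 1)%N.
    by apply: leq_trans (dimvS kerA) _; rewrite dim_vline leq_b1.
  rewrite -(leq_add2l 1) -[X in (X <= _)%N]/10%N -dimA -(limg_ker_dim f A).
  by rewrite leq_add2r.
have /memv_imgP[a aA E] : delta_mx k l \in (f @: A)%VS by rewrite imA memvf.
exists a; split=> // i j; have /matrixP/(_ i j) := E.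
by rewrite lfunE /= !mxE => <-.
Qed.

(** Column (k, l) of phi is the n-coordinate of a lift b_kl in A of the elementary matrix. The
    pairing of b_ij with b_kl is [volume] times t_ijkl - t_klij, so isotropy gives the symmetry. *)
Lemma linear_section_graph : exists t,
  (forall i j k l, t i j k l = t k l i j) /\
  forall R : comAlgType K, from_base R [set` A] = graph u v t (R := R).
Proof.
have [a aP] := boolp.choice (fun p : 'I_3 * 'I_3 => mm_lift p.1 p.2).
pose b k l := a (k, l).
have bA k l : b k l \in A by have [] := aP (k, l).
have mb i j k l : dot (coord_m u v i j) (b k l) = ((i == k) && (j == l))%:R.
  by have [_ /(_ i j)] := aP (k, l).
pose t i j k l := dot (coord_n u v i j) (b k l).
exists t; split=> [i j k l|R].
  have [_ _ iso] := hA; pose K0 := K^o : comAlgType K.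
  have := top_wedge_El two_neq0 spanning (emb K0 (b i j))
    (dot (coord_c u v) (b k l))%:A (fun p q => (t p q k l)%:A)
    (fun p q => (dot (coord_m u v p q) (b k l))%:A).
  rewrite -(emb_El two_neq0 hu hv hW hF hA hspan hsmooth K0 (bA k l)).
  rewrite dd_emb (coord_d_eq0 v hu hF hA hspan hsmooth) // scale0r mulr0 subr0.
  rewrite [LHS](_ : _ = 0); last by rewrite !emb_id iso.
  under eq_bigr => p _ do under eq_bigr => q _ do rewrite mm_emb mb.
  under [X in _ - X]eq_bigr => p _ do under eq_bigr => q _ do rewrite nn_emb mb mulrC.
  rewrite (sum_scaled_delta (fun p q => (t p q k l)%:A : K0)).
  rewrite (sum_scaled_delta (fun p q => (t p q i j)%:A : K0)).
  move/esym/eqP; rewrite -scalerAl mul1r -[_ - _]scalerBl.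
  rewrite scalerA scaler_eq0 oner_eq0 orbF mulf_eq0 subr_eq0.
  by rewrite (negPf (volume_neq0 two_neq0 spanning)) => /eqP.
have subG : from_base R [set` A] `<=` graph u v t (R := R).
  apply: base_change_min => [|x xA]; first exact: graph_submodule.
  rewrite -/(emb R x) (emb_El two_neq0 hu hv hW hF hA hspan hsmooth R xA).
  set c := _%:A; set m := fun i j => (dot (coord_m u v i j) x)%:A.
  rewrite [X in graph _ _ _ X](_ : _ = El c (phi t m) m 0); first exact: graph_El.
  apply: El_ext => // i j; rewrite /phi.
  (* Subtracting the lifts leaves an element of A with m = 0, hence a multiple of u, which has n =
     0: the n-coordinate of x is that of the lifts. *)
  pose y := x - \sum_k \sum_l dot (coord_m u v k l) x *: b k l.
  have yA : y \in A.
    apply: memvB => //; apply: memv_suml => k _; apply: memv_suml => l _.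
    exact: memvZ.
  have dotxy f : dot f x = dot f y + \sum_k \sum_l dot (coord_m u v k l) x * dot f (b k l).
    rewrite -{1}[x](subrK (\sum_k \sum_l dot (coord_m u v k l) x *: b k l)) dotDr.
    congr (_ + _); rewrite dot_sumr; apply: eq_bigr => k _; rewrite dot_sumr.
    by apply: eq_bigr => l _; rewrite dotZr.
  have y0 p q : dot (coord_m u v p q) y = 0.
    have := dotxy (coord_m u v p q).
    under [X in _ + X]eq_bigr => k _ do under eq_bigr => l _ do
      rewrite mb [p == k]eq_sym [q == l]eq_sym.
    rewrite sum_delta => /eqP; rewrite -subr_eq subrr => /eqP/esym. exact.
  rewrite dotxy (smooth_tangent two_neq0 hu hv hW hF hA hspan hsmooth yA y0).
  rewrite dotZr coord_nc // mulr0 add0r scaler_suml; apply: eq_bigr => k _.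
  rewrite scaler_suml; apply: eq_bigr => l _; exact: (rmorphM (in_alg R)).
have bG k l : graph u v t (emb R (b k l)).
  by apply: subG; apply: (map_in_base_change (in_alg R)); apply: bA.
have cA := basis_c_in hu hF hA hspan hsmooth.
have cG : graph u v t (emb R (basis_c u)).
  by apply: subG; apply: (map_in_base_change (in_alg R)).
apply/seteqP; split=> // w wG.
have [_ sD sZ] := lin_span_submodule (map_vec (in_alg R) @` [set` A]).
have [_ gD gZ] := graph_submodule u v t R.
(* s lies in A and has the same m as w. Both are in the graph, so they differ only in c, which a
   multiple of u corrects. *)
pose s := \sum_k \sum_l mm u v w k l *: emb R (b k l).
have sA : from_base R [set` A] s.
  have sub := lin_span_submodule (map_vec (in_alg R) @` [set` A]).
  apply: (submodule_sum sub) => k; apply: (submodule_sum sub) => l; apply: sZ.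
  by apply: (map_in_base_change (in_alg R)); apply: bA.
rewrite (_ : w = (cc u v w - cc u v s) *: emb R (basis_c u) + s).
  by apply: sD => //; apply: sZ; apply: (map_in_base_change (in_alg R)).
apply: (graph_inj two_neq0 spanning wG).
- by apply: gD; [apply: gZ | apply: subG].
- by rewrite ccD ccZ cc_emb coord_cc // scale1r mulr1 subrK.
move=> i j; rewrite mmD mmZ mm_emb coord_mc // scale0r mulr0 add0r.
rewrite /s -[LHS]sum_delta.
rewrite (_ : mm u v (\sum_k _) i j = \sum_k \sum_l mm u v (mm u v w k l *: emb R (b k l)) i j).
  apply: eq_bigr => k _; apply: eq_bigr => l _; rewrite mmZ mm_emb mb.
  by rewrite [i == k]eq_sym [j == l]eq_sym; case: (_ && _); rewrite ?scale1r ?scale0r.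
have mm_sum (G : 'I_3 -> ext R) : mm u v (\sum_k G k) i j = \sum_k mm u v (G k) i j.
  by rewrite !sum3E !mmD.
by rewrite mm_sum; apply: eq_bigr => k _; rewrite mm_sum.
Qed.

End GraphOfA.

(** * The equation of V_A *)

Section Polynomials.
Import (canonicals, coercions) mpoly.
Variables (K : fieldType) (N : nat).
Local Notation MP := (mpoly.mpoly N K).
Local Notation "'Y_ k" := (mpoly.mpolyX K (mpoly.mnm1 k) : MP) (at level 8, k at level 2).

Lemma mmap_variables (q : MP) : mpoly.mmap (in_alg MP) (fun k => 'Y_k) q = q.
Proof.
rewrite [RHS]mpoly.mpolyE /mpoly.mmap; apply: eq_bigr => m _.
by rewrite mpoly.mmap1_id mulr_algl.
Qed.

Variables (R : comAlgType K) (h : 'I_N -> R) (k : 'I_N).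
Definition mp_eval (p : MP) : R := mpoly.mmap (in_alg R) h p.
Definition mp_deriv (p : MP) : R := mp_eval (mpoly.mderiv k p).

Lemma mp_evalM p q : mp_eval (p * q) = mp_eval p * mp_eval q. Proof. exact: rmorphM. Qed.
Lemma mp_eval_sum (F : 'I_3 -> MP) : mp_eval (\sum_i F i) = \sum_i mp_eval (F i).
Proof. exact: raddf_sum. Qed.
Lemma mp_eval_scalar c : mp_eval c%:A = c%:A.
Proof. by rewrite mpoly.alg_mpolyC /mp_eval mpoly.mmapC. Qed.
Lemma mp_eval_X l : mp_eval 'Y_l = h l. Proof. by rewrite /mp_eval mpoly.mmapX mpoly.mmap1U. Qed.

Lemma mp_derivM p q : mp_deriv (p * q) = mp_deriv p * mp_eval q + mp_eval p * mp_deriv q.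
Proof. by rewrite /mp_deriv mpoly.mderivM [LHS]raddfD /= -!mp_evalM. Qed.
Lemma mp_deriv_sum (F : 'I_3 -> MP) : mp_deriv (\sum_i F i) = \sum_i mp_deriv (F i).
Proof. by rewrite /mp_deriv raddf_sum mp_eval_sum. Qed.
Lemma mp_deriv_scalar c : mp_deriv c%:A = 0.
Proof. by rewrite /mp_deriv mpoly.alg_mpolyC mpoly.mderivC; apply: raddf0. Qed.
Lemma mp_deriv_X l : mp_deriv 'Y_l = (l == k)%:R.
Proof.
rewrite /mp_deriv mpoly.mderivX mpoly.mnm1E; case: eqP => [->|_].
  have := mpoly.addmK (mpoly.mnm1 k) mpoly.mnm0; rewrite mpoly.add0m => ->.
  by rewrite scale1r /mp_eval mpoly.mmapX mpoly.mmap11.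
by rewrite scale0r; apply: raddf0.
Qed.

End Polynomials.

Section EquationOfVA.
Import (canonicals, coercions) mpoly.
Variables (K : fieldType) (U V : {vspace vec 'I_6 K}) (u v : 3.-tuple (vec 'I_6 K)).
Hypothesis two_neq0 : 2%:R != 0 :> K.
Hypotheses (hu : basis_of U u) (hv : basis_of V v) (hW : (U + V)%VS = fullv).
Variables (A : {vspace ext K}) (t : 'I_3 -> 'I_3 -> 'I_3 -> 'I_3 -> K).
Hypothesis t_sym : forall i j k l, t i j k l = t k l i j.
Hypothesis graphA : forall R : comAlgType K, from_base R [set` A] = graph u v t (R := R).
Variable q : mpoly.mpoly (3 + 3) K.
Hypothesis hq : equation_VA A U V u v q.

Let spanning := spanning_of_bases hu hv hW.
Local Notation MP := (mpoly.mpoly (3 + 3) K).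
Local Notation El := (El u v).
Local Notation vol := (volume u v).

(** The defining property of q is applied to the element of A over (x, y) with c = 0. *)
Lemma eval_equation (R : comAlgType K) (x y : vec 'I_3 R) : eval_at q x y =
  vol%:A * \sum_i \sum_j phi t (fun k l => x k * y l) i j * (x i * y j).
Proof.
pose m i j := x i * y j.
have Aa : from_base R [set` A] (El 0 (phi t m) m 0) by rewrite graphA; apply: graph_El.
rewrite (hq (a2 := El 0 (phi t m) (fun _ _ => 0) 0) (a3 := 0) Aa); last first.
  apply/(decomposesP two_neq0 spanning hu hv); split.
  - by rewrite dd_El.
  - by rewrite segre_vecE; apply: El_ext => // i j; rewrite mm_El.
  - by apply: El_ext => // i j; rewrite nn_El.
  - by rewrite cc_El // El0.
  - by apply: (graded_part_El two_neq0 spanning) => *; rewrite mul1r.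
rewrite top_wedge_El // mul0r subr0 [X in _ - X]big1 ?subr0.
  congr (_ * _); apply: eq_bigr => i _; apply: eq_bigr => j _.
  by rewrite segre_vecE mm_El.
by move=> i _; apply: big1 => j _; rewrite mul0r.
Qed.

Let pol_x (i : 'I_3) : MP := mpoly.mpolyX K (mpoly.mnm1 (lshift 3 i)).
Let pol_y (i : 'I_3) : MP := mpoly.mpolyX K (mpoly.mnm1 (rshift 3 i)).

(* The condition on q over the polynomial ring itself, at the generic point. *)
Lemma equation_poly : q =
  vol%:A * \sum_i \sum_j phi t (fun k l => pol_x k * pol_y l) i j * (pol_x i * pol_y j).
Proof.
pose x : vec 'I_3 MP := [ffun i => pol_x i].
pose y : vec 'I_3 MP := [ffun i => pol_y i].
have := eval_equation x y; rewrite /eval_at.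
have -> : mpoly.mmap (in_alg MP) (coords x y) q = q.
  rewrite -[RHS]mmap_variables; congr (mpoly.mmap _ _ _); apply: boolp.funext => k.
  by rewrite /coords; case: split_ordP => i ->; rewrite ffunE.
move=> {1}->; congr (_ * _); apply: eq_bigr => i _; apply: eq_bigr => j _.
by rewrite !ffunE; congr (_ * _); apply: phi_ext => k l; rewrite !ffunE.
Qed.

Lemma phi_symmetric (R : comAlgType K) (m m' : 'I_3 -> 'I_3 -> R) :
  \sum_i \sum_j phi t m i j * m' i j = \sum_i \sum_j phi t m' i j * m i j.
Proof.
rewrite !pair_bigA /=.
have E (n n' : 'I_3 -> 'I_3 -> R) : \sum_p phi t n p.1 p.2 * n' p.1 p.2 =
    \sum_p \sum_r n r.1 r.2 * n' p.1 p.2 * (t p.1 p.2 r.1 r.2)%:A.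
  apply: eq_bigr => p _; rewrite /phi pair_bigA /= mulr_suml.
  by apply: eq_bigr => r _; rewrite mulrAC.
rewrite !E exchange_big; apply: eq_bigr => p _; apply: eq_bigr => r _.
by rewrite t_sym [n in n * _]mulrC.
Qed.

(** By symmetry of phi, the derivative of the quadratic form at m = x y^T is twice its polar form
    against the derivative of m; the last factor is the partial derivative of x_i y_j. *)
Lemma eval_mderiv (R : comAlgType K) (x y : vec 'I_3 R) k :
  eval_at (mpoly.mderiv k q) x y = 2%:R * vol%:A *
  \sum_i \sum_j phi t (fun k l => x k * y l) i j *
    ((lshift 3 i == k)%:R * y j + x i * (rshift 3 j == k)%:R).
Proof.
set h := coords x y.
have hx i : h (lshift 3 i) = x i by rewrite /h /coords (unsplitK (inl i)).
have hy i : h (rshift 3 i) = y i by rewrite /h /coords (unsplitK (inr i)).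
pose d i j := (lshift 3 i == k)%:R * y j + x i * (rshift 3 j == k)%:R : R.
have mp_eval_xy i j : mp_eval h (pol_x i * pol_y j) = x i * y j by rewrite mp_evalM !mp_eval_X hx hy.
have mp_deriv_xy i j : mp_deriv h k (pol_x i * pol_y j) = d i j
  by rewrite mp_derivM !mp_deriv_X !mp_eval_X hx hy.
have mp_eval_phi i j : mp_eval h (phi t (fun k l => pol_x k * pol_y l) i j) =
    phi t (fun k l => x k * y l) i j.
  rewrite /phi mp_eval_sum; apply: eq_bigr => p _; rewrite mp_eval_sum; apply: eq_bigr => r _.
  by rewrite mp_evalM mp_eval_xy mp_eval_scalar.
have mp_deriv_phi i j : mp_deriv h k (phi t (fun k l => pol_x k * pol_y l) i j) = phi t d i j.
  rewrite /phi mp_deriv_sum; apply: eq_bigr => p _; rewrite mp_deriv_sum; apply: eq_bigr => r _.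
  by rewrite mp_derivM mp_deriv_xy mp_deriv_scalar mp_eval_scalar mulr0 addr0.
change (mp_deriv h k q = 2%:R * vol%:A * \sum_i \sum_j phi t (fun k l => x k * y l) i j * d i j).
rewrite equation_poly mp_derivM mp_deriv_scalar mul0r add0r mp_eval_scalar.
rewrite [2%:R * _]mulrC -mulrA; congr (_ * _); rewrite mp_deriv_sum.
transitivity (\sum_i \sum_j phi t d i j * (x i * y j) +
              \sum_i \sum_j phi t (fun k l => x k * y l) i j * d i j); last first.
  by rewrite (phi_symmetric d) mulr_natl mulr2n.
rewrite -big_split; apply: eq_bigr => i _; rewrite mp_deriv_sum -big_split.
by apply: eq_bigr => j _; rewrite mp_derivM mp_deriv_phi mp_eval_xy mp_eval_phi mp_deriv_xy.
Qed.

(** The derivatives in x_i give the rows of phi (x y^T) y, those in y_j the entries of x^T phi (x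
    y^T), up to the invertible factor 2 [volume]. *)
Lemma sing_critical (R : comAlgType K) p : sing q R p <-> critical t p.
Proof.
have vol2 (r : R) : 2%:R * vol%:A * r = 0 -> r = 0.
  rewrite -mulrA => /(two_regular two_neq0).
  rewrite mulr_algl => /(congr1 (fun s => vol^-1 *: s)).
  by rewrite scalerA mulVf ?volume_neq0 // scale1r scaler0.
have lr i j : (lshift 3 i == rshift 3 j) = false :> bool.
  by apply/negbTE; rewrite -val_eqE /= neq_ltn ltn_addr ?ltn_ord.
have lx (x y : vec 'I_3 R) i0 : \sum_i \sum_j phi t (fun k l => x k * y l) i j *
    ((lshift 3 i == lshift 3 i0)%:R * y j + x i * (rshift 3 j == lshift 3 i0)%:R) =
    \sum_j phi t (fun k l => x k * y l) i0 j * y j.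
  rewrite (bigD1 i0) //= [X in _ + X]big1 ?addr0 => [|i /negPf ii0].
    by apply: eq_bigr => j _; rewrite eqxx mul1r eq_sym lr mulr0 addr0.
  apply: big1 => j _; rewrite (inj_eq (@lshift_inj _ _)) ii0 eq_sym lr.
  by rewrite mul0r mulr0 addr0 mulr0.
have ly (x y : vec 'I_3 R) j0 : \sum_i \sum_j phi t (fun k l => x k * y l) i j *
    ((lshift 3 i == rshift 3 j0)%:R * y j + x i * (rshift 3 j == rshift 3 j0)%:R) =
    \sum_i x i * phi t (fun k l => x k * y l) i j0.
  apply: eq_bigr => i _.
  rewrite (bigD1 j0) //= [X in _ + X]big1 ?addr0 => [|j /negPf jj0].
    by rewrite eqxx lr mul0r add0r mulr1 mulrC.
  by rewrite (inj_eq (@rshift_inj _ _)) jj0 lr mul0r mulr0 addr0 mulr0.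
split=> [[pX pY S]|[pX pY S]]; split=> // x y Xx Yy.
  split=> i; apply: vol2; have := S _ _ Xx Yy.
    by move/(_ (lshift 3 i)); rewrite eval_mderiv lx.
  by move/(_ (rshift 3 i)); rewrite eval_mderiv ly.
move=> k; rewrite eval_mderiv; have [Sx Sy] := S _ _ Xx Yy.
by case: (split_ordP k) => i ->; rewrite ?lx ?ly ?Sx ?Sy mulr0.
Qed.

End EquationOfVA.

(** * The complement of u in coordinates, and the isomorphism *)

Section Main.
Variables (K : fieldType) (U V : {vspace vec 'I_6 K}) (u v : 3.-tuple (vec 'I_6 K)).
Hypothesis two_neq0 : 2%:R != 0 :> K.
Hypotheses (hu : basis_of U u) (hv : basis_of V v) (hW : (U + V)%VS = fullv).
Variables (A : {vspace ext K}) (F : subfunctor K {set 'I_6}).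
Hypotheses (hF : morin_configuration F) (hA : lagrangian A) (hspan : linear_span F A).
Variable t : 'I_3 -> 'I_3 -> 'I_3 -> 'I_3 -> K.
Hypothesis graphA : forall R : comAlgType K, from_base R [set` A] = graph u v t (R := R).

Let spanning := spanning_of_bases hu hv hW.

(** A linear form vanishing at u involves only n, m and d. On the graph d = 0 and n is linear in m,
    so its values lie in the ideal of the entries of m; conversely these entries are values of such
    forms. *)
Lemma minus_point_config (R : comAlgType K) (L : set (ext R)) :
  minus_point F (wedge_cube U) R L <-> config u v t L.
Proof.
split=> [[FL [n [f [a [fu La sum1]]]]]|[gL subL cL]].
  have [gL LA] := (morin_linear_section hF hA hspan L).1 FL.
  have subL : L `<=` graph u v t (R := R) by rewrite -graphA.
  split=> // J iJ sJ; rewrite -sum1; apply: is_ideal_sum => // k.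
  have [J0 JD JM] := iJ; have Jm i j : J (mm u v (a k) i j) by apply: sJ; exists (a k), i, j.
  have Jsum (G : 'I_3 -> 'I_3 -> R) (c : 'I_3 -> 'I_3 -> R) : (forall i j, J (G i j)) ->
      J (\sum_i \sum_j G i j * c i j).
    move=> JG; apply: is_ideal_sum => // i; apply: is_ideal_sum => // j.
    by rewrite mulrC; apply: JM.
  rewrite (subL _ (La k)) -/(emb R (f k)) dot_El (fu k _ (basis_c_cube hu)).
  rewrite scale0r mulr0 mul0r add0r addr0; apply: JD; apply: (Jsum) => // i j.
  exact: Jsum.
split.
  by apply/(morin_linear_section hF hA hspan); rewrite graphA.
pose J : set R := [set r | exists n (f : 'I_n -> ext K) (a : 'I_n -> ext R),
  [/\ forall k w, wedge_cube U w -> dot (f k) w = 0, forall k, L (a k) &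
    \sum_k dot (map_vec (in_alg R) (f k)) (a k) = r]].
have [_ _ LZ] : submodule L by case: gL.
apply: (cL J).
  split=> [|_ _ [n [f [a [fU La <-]]]] [m [g [b [gU Lb <-]]]]|c _ [n [f [a [fU La <-]]]]].
  - by exists 0, (fun=> 0), (fun=> 0); split; [case|case|rewrite big_ord0].
  - exists (n + m)%N, (fun k => match split k with inl i => f i | inr j => g j end),
      (fun k => match split k with inl i => a i | inr j => b j end).
    split=> [k|k|]; [by case: (split k)|by case: (split k)|].
    rewrite big_split_ord /=; congr (_ + _); apply: eq_bigr => k _.
      by rewrite (unsplitK (inl k)).
    by rewrite (unsplitK (inr k)).
  - exists n, f, (fun k => c *: a k); split=> // [k|]; first exact: LZ.
    by rewrite mulr_sumr; apply: eq_bigr => k _; rewrite dotZr.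
move=> _ [w [i [j [Lw ->]]]]; exists 1%N, (fun=> coord_m u v i j), (fun=> w).
split=> // [_ x /(cube_line two_neq0 hu hv hW)[k ->]|]; last by rewrite big_ord1.
by rewrite dotZr coord_mc // mulr0.
Qed.

End Main.

Theorem theorem1p6 (RR : realType)
    (F : subfunctor RR[i] {set 'I_6})
    (U V : {vspace vec 'I_6 RR[i]})
    (u v : 3.-tuple (vec 'I_6 RR[i]))
    (A : {vspace ext RR[i]})
    (q : mpoly.mpoly (3 + 3) RR[i])
    (hF : morin_configuration F)
    (hfin : finite_scheme F)
    (hu : basis_of U u)
    (hsmooth : finite_smooth_at F (wedge_cube U))
    (hA : lagrangian A)
    (hspan : linear_span F A)
    (hUV : (U :&: V)%VS = 0%VS)
    (hW : (U + V)%VS = fullv)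
    (hv : basis_of V v)
    (hq : equation_VA A U V u v q) :
  exists eta : forall R : comAlgType RR[i],
      set (ext R) -> set (vec 'I_3 R) * set (vec 'I_3 R),
    scheme_iso (minus_point F (wedge_cube U)) (sing q) eta /\
    forall (R : comAlgType RR[i]) (L : set (ext R)),
      minus_point F (wedge_cube U) R L ->
      project U V L = segre u v (eta R L).
Proof.
have two_neq0 : 2%:R != 0 :> RR[i] by rewrite Num.Theory.pnatr_eq0.
have spanning := spanning_of_bases hu hv hW.
have [t [t_sym graphA]] := linear_section_graph two_neq0 hu hv hW hF hA hspan hsmooth.
have configP (R : comAlgType RR[i]) (L : set (ext R)) :=
  minus_point_config two_neq0 hu hv hW hF hA hspan graphA L.
have singP (R : comAlgType RR[i]) p := sing_critical two_neq0 hu hv hW t_sym graphA hq (R := R) p.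
exists (fun R => point_pair u v (R := R)); split=> [|R L /configP cL]; last first.
  exact: project_config cL.
split=> [R|R S f L _]; last exact: point_pair_base_change.
split=> [L /configP cL|L L'|[X Y] /singP crit].
- exact/singP/(point_pair_critical two_neq0 spanning).
- move=> /set_mem/configP cL /set_mem/configP cL' eL.
  by apply/seteqP; split; [apply: (point_pair_inj _ _ cL cL') | apply: (point_pair_inj _ _ cL' cL)].
- exists (critical_lift u v t X Y); last exact: point_pair_critical_lift.
  exact/configP/critical_lift_config.
Qed.
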